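(* Let $p$ be a prime, $\mathbf{k}$ an algebraically closed field of characteristic $p$, and $V=\mathbf{k}^3$ (so $n=3$). Let $d\geq 1$ and $e\geq 0$ be integers, and let $1\leq t<p$ and $q=p^k$ ($k\ge 0$) be such that $tq\leq d<(t+1)q$. Then: - If $e>(t+1)q-2$ then $h^1(d,e)=0$. - If $e<tq$ then $h^1(d,e)=s_{(d-1,e)}$. - If $tq\leq e\leq (t+1)q-2$ then $$\begin{aligned}h^1(d,e)=F^q(h_t^{\vee})\cdot h^1(d-tq,e-tq)&+F^q(h_{t-1}^{\vee})\cdot s^{(q)}_{(e-1+(2-t)q,\,d-tq)}\\&+F^q(h_{t-2}^{\vee})\cdot h^0\big(q(t+1)-d-2,\,q(t+1)-e-2\big)^{\vee}.\end{aligned}$$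
   Context: $\mathbf{P}=\mathbb{P}V=\operatorname{Proj}(\operatorname{Sym}V)\simeq\mathbf{P}^2$, with tautological sequence $0\to\mathcal{R}\to V\otimes\mathcal{O}_{\mathbf{P}}\to\mathcal{O}_{\mathbf{P}}(1)\to 0$. $D^d$ is the $d$-th divided power functor, $D^d\mathcal{R}=(\operatorname{Sym}^d(\mathcal{R}^{\vee}))^{\vee}$ (with $D^d\mathcal{R}=0$ for $d<0$), and $\mathcal{F}(e)=\mathcal{F}\otimes\mathcal{O}_{\mathbf{P}}(e)$. $[W]\in A=\mathbb{Z}[x_1,x_2,x_3]/\langle x_1x_2x_3-1\rangle$ denotes the character of a finite-dimensional $\operatorname{SL}_3$-representation $W$ (with $[V]=x_1+x_2+x_3$). Define $$h^0(d,e)=[H^0(\mathbf{P},D^d\mathcal{R}(e-1))],\qquad h^1(d,e)=[H^1(\mathbf{P},D^d\mathcal{R}(e-1))];$$ in particular $h^0(-1,e)=0$ by the convention above. The ring endomorphism ${}^{\vee}:A\to A$ sends $x_i\mapsto x_i^{-1}$, and for $q$ a power of $p$ the ring endomorphism $F^q:A\to A$ sends $x_i\mapsto x_i^q$. The $h_m$ are the complete symmetric functions in $x_1,x_2,x_3$ (with $h_m=0$ for $m<0$), and for $a\ge b\ge 0$, $s_{(a,b)}=h_ah_b-h_{a+1}h_{b-1}$. The $q$-truncated versions are $$h^{(q)}_m=\sum_{\substack{a_1+a_2+a_3=m\\0\leq a_i<q}}x_1^{a_1}x_2^{a_2}x_3^{a_3},\qquad s^{(q)}_{(a,b)}=h^{(q)}_ah^{(q)}_b-h^{(q)}_{a+1}h^{(q)}_{b-1}.$$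 *)

(* Defs.v *)
From HB Require Import structures.
From mathcomp Require Import all_boot all_order all_algebra ring_quotient.
From mathcomp Require Import boolp classical_sets functions cardinality fsbigop.
From mathcomp Require Import mpoly.

Set Implicit Arguments.
Unset Strict Implicit.
Unset Printing Implicit Defensive.

Import Order.TTheory GRing.Theory Num.Theory.

Local Open Scope ring_scope.

(******************************************************************************)
(* The ring chA = Z[x_1,x_2,x_3]/<x_1 x_2 x_3 - 1>                            *)
(******************************************************************************)

Definition detP : {mpoly int[3]} := \prod_(i < 3) 'X_i - 1.

Definition det_ideal : {pred {mpoly int[3]}} :=
  fun f => `[< exists g, f = g * detP >].

Lemma mmap_detP (S : comNzRingType) (g : 'I_3 -> S) :
  \prod_i g i = 1 -> mmap intr g detP = 0.
Proof.
move=> g1; rewrite rmorphB rmorph1 rmorph_prod /=.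
by rewrite (eq_bigr g) ?g1 ?subrr // => i _; rewrite mmapX mmap1U.
Qed.

Lemma mmap_det_ideal (S : comNzRingType) (g : 'I_3 -> S) f :
  \prod_i g i = 1 -> f \in det_ideal -> mmap intr g f = 0.
Proof. by move=> g1 /asboolP [h ->]; rewrite rmorphM /= mmap_detP ?mulr0. Qed.

Lemma det_ideal_closed : idealr_closed det_ideal.
Proof.
split.
- by apply/asboolP; exists 0; rewrite mul0r.
- apply/negP => /(@mmap_det_ideal int (fun=> 1)).
  by rewrite rmorph1 big1 // => /(_ erefl) /eqP; rewrite oner_eq0.
- move=> a u v /asboolP [f ->] /asboolP [g ->]; apply/asboolP.
  by exists (a * f + g); rewrite mulrDl mulrA.
Qed.

HB.instance Definition _ := isIdealr.Build {mpoly int[3]} det_ideal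
  det_ideal_closed.

Definition chA : Type := {ideal_quot det_ideal}.
HB.instance Definition _ := GRing.ComNzRing.on chA.

Definition piA (f : {mpoly int[3]}) : chA := \pi_({ideal_quot det_ideal})%qT f.

Definition xA (i : 'I_3) : chA := piA 'X_i.

Lemma prod_x : \prod_i xA i = 1.
Proof.
rewrite /xA /piA -rmorph_prod -[RHS](rmorph1 (\pi_({ideal_quot det_ideal})%qT)).
apply/eqP; rewrite -Quotient.idealrBE; apply/asboolP; exists 1.
by rewrite mul1r.
Qed.

(* The ring endomorphism of chA sending x_i to g i. *)
Section Substitution.
Variable g : {g : 'I_3 -> chA | \prod_i g i = 1}.

Definition subst (a : chA) : chA := mmap intr (sval g) (repr a).

Lemma subst_pi f : subst (piA f) = mmap intr (sval g) f.
Proof.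
apply/eqP; rewrite -subr_eq0 -rmorphB /=; apply/eqP.
apply: mmap_det_ideal; first exact: (svalP g).
by rewrite Quotient.idealrBE reprK.
Qed.

Lemma piA_surj a : exists f, a = piA f.
Proof. by exists (repr a); rewrite /piA reprK. Qed.

Lemma subst_zmod : zmod_morphism subst.
Proof.
move=> a b; have [f ->] := piA_surj a; have [h ->] := piA_surj b.
by rewrite /piA -rmorphB -!/(piA _) !subst_pi rmorphB.
Qed.

Lemma subst_monoid : monoid_morphism subst.
Proof.
split=> [|a b].
  have e : piA 1 = 1 by rewrite /piA rmorph1.
  by rewrite -{1}e subst_pi rmorph1.
have [f ->] := piA_surj a; have [h ->] := piA_surj b.
by rewrite /piA -rmorphM -!/(piA _) !subst_pi rmorphM.
Qed.

HB.instance Definition _ := GRing.isZmodMorphism.Build chA chA subst subst_zmod.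
HB.instance Definition _ := GRing.isMonoidMorphism.Build chA chA subst subst_monoid.

Lemma subst_x i : subst (xA i) = sval g i.
Proof. by rewrite subst_pi mmapX mmap1U. Qed.

End Substitution.

Lemma prod_xV : \prod_i (\prod_(j | j != i) xA j) = 1.
Proof.
have e : (\prod_i (\prod_(j | j != i) xA j)) * (\prod_i xA i) = 1.
  rewrite -big_split big1 //= => i _.
  by rewrite mulrC -[RHS]prod_x [RHS](bigD1 i).
by rewrite prod_x mulr1 in e.
Qed.

Lemma prod_xX q : \prod_i xA i ^+ q = 1.
Proof. by rewrite prodrXl prod_x expr1n. Qed.

(* In chA the inverse of x_i is the product of the other two variables. *)
Definition dual : {rmorphism chA -> chA} := subst (exist _ _ prod_xV).

Definition Frob (q : nat) : {rmorphism chA -> chA} := subst (exist _ _ (prod_xX q)).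

Lemma dual_x i : dual (xA i) * xA i = 1.
Proof.
have -> : dual (xA i) = \prod_(j | j != i) xA j by exact: subst_x.
by rewrite mulrC -[RHS]prod_x [RHS](bigD1 i).
Qed.

Lemma Frob_x q i : Frob q (xA i) = xA i ^+ q.
Proof. exact: subst_x. Qed.

(******************************************************************************)
(* Symmetric functions in chA                                                 *)
(******************************************************************************)

(* The sum is empty for m < 0. *)
Definition h_trunc (q : nat) (m : int) : chA :=
  \sum_(a : {ffun 'I_3 -> 'I_q} | (\sum_i a i)%N%:Z == m) \prod_i xA i ^+ a i.

(* Exponents of a monomial of degree m are at most m. *)
Definition h_sym (m : int) : chA := h_trunc `|m|.+1 m.

Definition s_trunc (q : nat) (a b : int) : chA :=
  h_trunc q a * h_trunc q b - h_trunc q (a + 1) * h_trunc q (b - 1).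

Definition s_sym (a b : int) : chA :=
  h_sym a * h_sym b - h_sym (a + 1) * h_sym (b - 1).

(******************************************************************************)
(* The sheaves D^d R (m) on P = Proj k[x_1,x_2,x_3]                           *)
(******************************************************************************)

Section Cohomology.
Variable k : closedFieldType.

(* f : laurent k stands for the sum over u of f(u) x^u. *)
Definition laurent : Type := {ffun 'I_3 -> int} -> k.
HB.instance Definition _ :=
  GRing.Lmodule.copy laurent ({ffun 'I_3 -> int} -> k^o).

(* Sections of O(m) over the open set where x_i is invertible for i in I: *)
(* the degree m part of the localization k[x_1,x_2,x_3][x_i^-1, i in I].  *)
Definition O_sections (I : {set 'I_3}) (m : int) (f : laurent) : Prop :=
  finite_set (fun u => f u != 0) /\
  forall u, f u != 0 -> \sum_i u i = m /\ forall i, i \notin I -> 0 <= u i.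

Definition mulx (i : 'I_3) (f : laurent) : laurent :=
  fun u => f (u - [ffun j => (j == i)%:R]).

(* The dual of the tautological sequence gives                                *)
(*   R^v = (V^v (x) O) / O(-1), where O(-1) is spanned by x_1 y_1 + x_2 y_2   *)
(*   + x_3 y_3 for (y_i) the basis of V^v dual to the basis (x_i) of V,       *)
(* so Sym^d(R^v) is the quotient of Sym^d(V^v) (x) O by the multiples of this *)
(* element, and a section phi of D^d R (m) = Hom(Sym^d(R^v), O(m)) is given   *)
(* by the values phi a of a linear form at the monomials y^a of degree d,     *)
(* subject to its vanishing at (x_1 y_1 + x_2 y_2 + x_3 y_3) y^b for all b.   *)
(* For d < 0 the only section is 0.                                           *)
Definition DR_cochain : Type := 'X_{1..3} -> laurent.
HB.instance Definition _ :=
  GRing.Lmodule.copy DR_cochain ('X_{1..3} -> laurent).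

Definition DR_sections (d m : int) (I : {set 'I_3}) (phi : DR_cochain) : Prop :=
  [/\ forall a, (mdeg a)%:Z != d -> phi a = 0,
      forall a, O_sections I m (phi a) &
      forall b, \sum_i mulx i (phi (b + U_(i))%MM) = 0].

(* The Cech complex of the cover of P by the affine opens U_i = {x_i <> 0}.   *)
(* 1-cochains are indexed by all pairs (i, j); the cocycle condition forces   *)
(* c i i = 0 and c j i = - c i j.                                             *)
Definition cech_d0 (c : 'I_3 -> DR_cochain) : 'I_3 -> 'I_3 -> DR_cochain :=
  fun i j => c j - c i.

Definition cech_C0 (d m : int) (c : 'I_3 -> DR_cochain) : Prop :=
  forall i, DR_sections d m [set i]%SET (c i).

Definition cech_Z0 (d m : int) (c : 'I_3 -> DR_cochain) : Prop :=
  cech_C0 d m c /\ cech_d0 c = 0.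

Definition cech_Z1 (d m : int) (c : 'I_3 -> 'I_3 -> DR_cochain) : Prop :=
  (forall i j, DR_sections d m [set i; j]%SET (c i j)) /\
  forall i j l, c j l - c i l + c i j = 0.

Definition cech_B1 (d m : int) (c : 'I_3 -> 'I_3 -> DR_cochain) : Prop :=
  exists2 c0, cech_C0 d m c0 & cech_d0 c0 = c.

(******************************************************************************)
(* Characters                                                                 *)
(******************************************************************************)

(* The k-points of the diagonal maximal torus of SL_3. It acts on P, hence    *)
(* on the sections over each U_i, by t . x_i = t_i x_i; the vector of D^d V   *)
(* dual to the monomial y^a has weight a. An SL_3-representation and its      *)
(* restriction to the torus have the same character.                          *)
Definition torus (t : 'I_3 -> k) : Prop := \prod_i t i = 1.

Definition act (t : 'I_3 -> k) (phi : DR_cochain) : DR_cochain :=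
  fun a u => (\prod_i t i ^ ((a i)%:Z + u i)) * phi a u.

(* n = dim Z / B, for a subspace B of Z. *)
Definition is_quot_dim (M : lmodType k) (Z B : set M) (n : nat) : Prop :=
  exists2 b : 'I_n -> M, (forall i, Z (b i)) &
    forall z, Z z -> exists! c : {ffun 'I_n -> k}, B (z - \sum_i c i *: b i).

Definition quot_dim (M : lmodType k) (Z B : set M) : nat :=
  xget 0%N (is_quot_dim Z B).

(* Vectors of Z whose class in Z / B is a weight vector of weight w. *)
Definition weight_space (M : lmodType k) (T : ('I_3 -> k) -> M -> M)
    (Z B : set M) (w : 'X_{1..3}) (z : M) : Prop :=
  Z z /\ forall t, torus t -> B (T t z - (\prod_i t i ^+ w i) *: z).

(* The character of Z / B.  Each character of the torus of SL_3 comes from a  *)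
(* unique w in N^3 one of whose entries is 0. The default values (0 for an    *)
(* infinite dimension or infinitely many weights) are irrelevant below, the   *)
(* cohomology of coherent sheaves on P being finite-dimensional.              *)
Definition character (M : lmodType k) (T : ('I_3 -> k) -> M -> M)
    (Z B : set M) : chA :=
  \sum_(w \in [set w : 'X_{1..3} | exists i, w i = 0%N]%classic)
    (\prod_i xA i ^+ w i) *+ quot_dim (weight_space T Z B w) B.

Definition h0 (d e : int) : chA :=
  character (fun t c i => act t (c i)) (cech_Z0 d (e - 1)) [set 0]%classic.

Definition h1 (d e : int) : chA :=
  character (fun t c i j => act t (c i j)) (cech_Z1 d (e - 1))
    (cech_B1 d (e - 1)).

End Cohomology.

(* Main.v *)
(** For a weight w of the torus with entries summing to d + e - 1, let R be the
    space of binary forms of degree d and L_1, L_2, L_3 pairwise coprime linear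
    forms of sum zero.  In weight w, a section of D^d R (e - 1) over the open
    set where the x_i, i in I, are invertible is a functional on R that kills
    the multiples of L_l ^ (w_l + 1) for l outside I.  Hence the multiplicity of
    w in h^0 is the dimension of the degree d part of the quotient by the three
    powers, and its multiplicity in h^1 is the dimension, in the same degree, of
    the syzygies between the three powers modulo the Koszul ones.

    The syzygies of (L_i ^ a_i) are free on two generators, of degrees adding up
    to a_1 + a_2 + a_3.  In characteristic p the two degrees are equal when
    a_1 + a_2 + a_3 = 2Q and a_i <= Q, for Q = m p^r with m <= p.  Therefore the
    q-th powers of such a basis again form a basis, and with w = q u + v the
    multiplicity of w reduces to one for the weight v (when u_1 + u_2 + u_3 =
    2t), to one for its reflection q - 2 - v (when the sum is 2t - 1), or else
    to a linear function of v.  Summing over the weights, these cases give the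
    first summand, the third one, and the coefficients of the truncated Schur
    function in the second one. *)

Require Import Defs.
From HB Require Import structures.
From mathcomp Require Import all_boot all_order all_algebra.
From mathcomp Require Import boolp classical_sets functions cardinality fsbigop.
From mathcomp Require Import mpoly.
From mathcomp Require Import zify ring.

Set Implicit Arguments.
Unset Strict Implicit.
Unset Printing Implicit Defensive.

Import Order.TTheory GRing.Theory Num.Theory.
Local Open Scope ring_scope.

(** * Row spaces and orthogonality *)

(** Forms are dehomogenised: degree n - 1 becomes size at most n, and the L_i become linear
    polynomials with distinct roots. Balance in characteristic p comes from the binomials C(Q - 1,
    i), i < Q = m p^r, which are prime to p when m <= p.

    The obstacle is that q-th powers of a basis for u reach only the exponents q u_i, while q u_i +
    v_i + 1 occurs. So a syzygy (S_0, S_1, S_2) for the remainders is sent to S_0 Ga^q + S_1 De^q,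
    with (Ga, De) a basis for u having an extra factor L_0 in De_0, L_1 in Ga_1, L_2 in De_2 - Ga_2.
    As the S_i sum to zero, entry i is a term containing S_i plus a term divisible by L_i^(q (u_i +
    1)). Each extra factor cuts out a line in the plane of syzygies of balanced degree; balance at
    neighbouring exponents makes the three lines distinct, and rescaling gives (Ga, De). The
    reflection uses the same map with L_0, L_1, L_2 dividing all entries of De, Ga, De - Ga, and
    divides the image by a product of powers of the L_i.

    The number 2t arises from inverting monomials in [chA]: x^(-f) = x^(t - f), and t - f has sum 2t
    when f has sum t. *)

Section RowSpaces.
Variable F : fieldType.

Definition subspace (V : lmodType F) (P : V -> Prop) :=
  P 0 /\ forall c u v, P u -> P v -> P (c *: u + v).

Lemma subspace_sum (V : lmodType F) (P : V -> Prop) n (c : 'I_n -> F) b :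
  subspace P -> (forall i, P (b i)) -> P (\sum_i c i *: b i).
Proof.
move=> [P0 Pl] Pb; apply: (big_ind P) => // [u v Pu Pv|i _].
  by rewrite -[u]scale1r; apply: Pl.
by rewrite -[_ *: _]addr0; apply: Pl.
Qed.

(** Among the matrices whose row space lies in [P], one of maximal rank works: a vector of [P]
    outside its row space would raise the rank. *)
Lemma rowspace_exists n (P : 'rV[F]_n -> Prop) : subspace P ->
  exists A : 'M_n, forall v, (v <= A)%MS <-> P v.
Proof.
move=> sP; pose R r := `[< exists2 A : 'M_n, forall v, (v <= A)%MS -> P v & \rank A = r >].
have R0 : exists r, R r.
  exists 0%N; apply/asboolP; exists 0; last by rewrite mxrank0.
  by move=> v; rewrite submx0 => /eqP ->; case: sP.
have Rn r : R r -> (r <= n)%N by move=> /asboolP [A _ <-]; apply: rank_leq_row.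
case: (ex_maxnP R0 Rn) => r /asboolP [A AP rA] rmax.
exists A => v; split=> [|Pv]; first exact: AP.
apply: contrapT => /negP nvA.
have : R (\rank (A + v)).
  apply/asboolP; exists (A + v)%MS => // u /sub_addsmxP [[x y] ->] /=.
  rewrite addrC [y]mx11_scalar mul_scalar_mx; apply: (proj2 sP) => //.
  by apply: AP; apply: submxMl.
move/rmax; rewrite -rA leqNgt => /negP; apply.
apply: rank_ltmx; rewrite ltmxE addsmxSl /=; apply: contra nvA => h.
by apply: submx_trans h; apply: addsmxSr.
Qed.

Definition rowspace n (P : 'rV[F]_n -> Prop) : 'M[F]_n :=
  xget 0 [set A : 'M_n | forall v, (v <= A)%MS <-> P v]%classic.

Lemma mem_rowspace n (P : 'rV[F]_n -> Prop) v :
  subspace P -> (v <= rowspace P)%MS <-> P v.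
Proof.
by move=> /rowspace_exists [A AP]; rewrite /rowspace;
  case: xgetP => [B _|/(_ A) []]; [apply | exact: AP].
Qed.

(** The isomorphisms used later are polynomial formulas, so [f] is a bare function with linearity as
    a hypothesis, bijective only between the two row spaces. *)
Lemma rank_iso m n m' n' (A : 'M[F]_(m', m)) (B : 'M[F]_(n', n))
    (f : 'rV_m -> 'rV_n) :
  (forall c u v, f (c *: u + v) = c *: f u + f v) ->
  (forall v, (v <= A)%MS -> (f v <= B)%MS) ->
  (forall v, (v <= A)%MS -> f v = 0 -> v = 0) ->
  (forall w, (w <= B)%MS -> exists2 v, (v <= A)%MS & f v = w) ->
  \rank A = \rank B.
Proof.
move=> fl fAB finj fsurj.
have f0 : f 0 = 0.
  by have /eqP := fl 1 0 0; rewrite !scale1r addr0 -subr_eq0 opprD addNKr oppr_eq0 => /eqP.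
have fsum k (x : 'rV_k) (C : 'M_(k, m)) :
    f (x *m C) = x *m \matrix_i f (row i C).
  rewrite !mulmx_sum_row; elim/big_rec2: _ => // i u v _ <-.
  by rewrite fl rowK.
pose G := \matrix_i f (row i (row_base A)).
have GB : (G <= B)%MS.
  apply/row_subP => i; rewrite rowK; apply: fAB.
  by rewrite (submx_trans (row_sub _ _)) // eq_row_base.
have BG : (B <= G)%MS.
  apply/rV_subP => w /fsurj [v vA <-].
  have /submxP [x ->] : (v <= row_base A)%MS by rewrite eq_row_base.
  by rewrite fsum submxMl.
have Gfree : row_free G.
  rewrite -kermx_eq0; apply/eqP/row_matrixP => i; rewrite row0.
  set x := row i _.
  have xG : x *m G = 0 by apply/sub_kermxP; apply: row_sub.
  have /finj : (x *m row_base A <= A)%MS by rewrite (submx_trans (submxMl _ _)) ?eq_row_base.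
  rewrite fsum => /(_ xG) xA; apply: (row_free_inj (row_base_free A)).
  by rewrite xA mul0mx.
have -> : \rank B = \rank G by apply/eqP; rewrite eqn_leq !mxrankS.
by rewrite (eqP Gfree).
Qed.

Lemma eqmx_mem m1 m2 n (A : 'M[F]_(m1, n)) (B : 'M[F]_(m2, n)) :
  (forall v : 'rV_n, (v <= A)%MS <-> (v <= B)%MS) -> (A :=: B)%MS.
Proof. by move=> h; apply/eqmxP/andP; split; apply/rV_subP => v /h. Qed.

Definition orth n (A : 'M[F]_n) : 'M_n := kermx A^T.

Lemma mem_orth n (A : 'M[F]_n) (r : 'rV_n) :
  (r <= orth A)%MS <-> forall v : 'rV_n, (v <= A)%MS -> r *m v^T = 0.
Proof.
split=> [/sub_kermxP rA v /submxP [x ->]|h]; first by rewrite trmx_mul mulmxA rA mul0mx.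
apply/sub_kermxP/rowP => i; rewrite [RHS]mxE.
have /rowP /(_ 0) := h _ (row_sub i A); rewrite !mxE => {2}<-.
by apply: eq_bigr => j _; rewrite !mxE.
Qed.

Lemma rank_orth n (A : 'M[F]_n) : \rank (orth A) = (n - \rank A)%N.
Proof. by rewrite mxrank_ker mxrank_tr. Qed.

Lemma orthS n (A B : 'M[F]_n) : (A <= B)%MS -> (orth B <= orth A)%MS.
Proof.
move=> AB; apply/rV_subP => r /mem_orth h; apply/mem_orth => v vA.
by apply: h; apply: submx_trans AB.
Qed.

Lemma orthD n (A B : 'M[F]_n) : (orth (A + B)%MS :=: orth A :&: orth B)%MS.
Proof.
apply: eqmx_mem => r; rewrite sub_capmx; split=> [rAB|/andP [/mem_orth hA /mem_orth hB]].
  by apply/andP; split; apply: submx_trans rAB _; apply: orthS;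
    rewrite (addsmxSl, addsmxSr).
apply/mem_orth => v /sub_addsmxP [[x y] ->] /=.
by rewrite linearD mulmxDr hA ?hB ?submxMl // addr0.
Qed.

(** One inclusion is formal; the other is a rank count, [orthD] giving the rank of the intersection
    of the two complements. *)
Lemma orthI n (A B : 'M[F]_n) : (orth (A :&: B)%MS :=: orth A + orth B)%MS.
Proof.
apply: eqmx_sym; apply/eqmxP; apply/andP; split.
  by rewrite addsmx_sub !orthS ?capmxSl ?capmxSr.
have := mxrank_sum_cap A B; have := mxrank_sum_cap (orth A) (orth B).
rewrite -(orthD A B) !rank_orth => h1 h2.
have le : (orth A + orth B <= orth (A :&: B))%MS.
  by rewrite addsmx_sub !orthS ?capmxSl ?capmxSr.
rewrite -(mxrank_leqif_sup le).
have := rank_leq_row A; have := rank_leq_row B; have := rank_leq_row (A + B)%MS.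
have := rank_leq_row (A :&: B)%MS.
by rewrite rank_orth; lia.
Qed.

(** Intersection does not distribute over sums. The failure for the three complements is expressed
    through [A], [B], [C] themselves, by turning sums into intersections with [orthD] and [orthI];
    in [rank_P_defect] this failure is a multiplicity in the first cohomology. *)
Lemma rank_orth_defect n (A B C : 'M[F]_n) : (A :&: (B :&: C) = 0)%MS ->
  (\rank (orth A :&: (orth B + orth C)) + \rank (A + (B + C)) +
     \rank (A :&: B) + \rank (A :&: C) + \rank (B :&: C) =
   \rank (orth A :&: orth B + orth A :&: orth C) +
     \rank A + \rank B + \rank C)%N.
Proof.
move=> ABC.
have -> : \rank (orth A :&: (orth B + orth C)) = (n - \rank (A + (B :&: C)))%N.
  rewrite -rank_orth; apply/eqmx_rank/eqmxP; apply: eqmx_sym.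
  apply: (eqmx_trans (orthD _ _)); apply: cap_eqmx => //.
  exact: orthI.
have -> : \rank (orth A :&: orth B + orth A :&: orth C) =
    (n - \rank ((A + B) :&: (A + C)))%N.
  rewrite -rank_orth; apply/eqmx_rank/eqmxP; apply: eqmx_sym.
  apply: (eqmx_trans (orthI _ _)); apply: adds_eqmx; exact: orthD.
have e : \rank ((A + B) + (A + C)) = \rank (A + (B + C)).
  apply/eqmx_rank/andP; split; rewrite !addsmx_sub.
    by rewrite !(addsmxSl, submx_trans (addsmxSl B C) (addsmxSr _ _),
      submx_trans (addsmxSr B C) (addsmxSr _ _)).
  by rewrite (submx_trans (addsmxSl A B) (addsmxSl _ _))
    (submx_trans (addsmxSr A B) (addsmxSl _ _)) (submx_trans (addsmxSr A C) (addsmxSr _ _)).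
have := mxrank_sum_cap (A + B)%MS (A + C)%MS; rewrite e.
have := mxrank_sum_cap A (B :&: C)%MS; rewrite ABC mxrank0.
have := mxrank_sum_cap A B; have := mxrank_sum_cap A C.
have := rank_leq_row (A + (B :&: C))%MS; have := rank_leq_row ((A + B) :&: (A + C))%MS.
lia.
Qed.

End RowSpaces.

(** * Syzygies of powers of three linear forms *)

Notation i0 := (ord0 : 'I_3).
Notation i1 := (@Ordinal 3 1 isT).
Notation i2 := (@Ordinal 3 2 isT).

Lemma ord3P (P : 'I_3 -> Prop) : P i0 -> P i1 -> P i2 -> forall i, P i.
Proof.
move=> P0 P1 P2 [[|[|[|//]]] h]; by [
  have -> : Ordinal h = i0 by exact: val_inj |
  have -> : Ordinal h = i1 by exact: val_inj |
  have -> : Ordinal h = i2 by exact: val_inj].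
Qed.

Lemma big3 (T : Type) (idx : T) (op : Monoid.com_law idx) (E : 'I_3 -> T) i j l :
  uniq [:: i; j; l] -> \big[op/idx]_x E x = op (E i) (op (E j) (E l)).
Proof.
move=> u; have p : perm_eq (index_enum 'I_3) [:: i; j; l].
  apply: uniq_perm => //; first exact: index_enum_uniq.
  move=> x; rewrite mem_index_enum; symmetry.
  by move: i j l x u; do 4![elim/ord3P => //].
by rewrite (perm_big _ p) !big_cons big_nil Monoid.mulm1.
Qed.

Lemma sum3 (V : nmodType) (E : 'I_3 -> V) : \sum_i E i = E i0 + (E i1 + E i2).
Proof. exact: big3. Qed.

Lemma sumn3 (E : 'I_3 -> nat) : (\sum_i E i = E i0 + (E i1 + E i2))%N.
Proof. exact: big3. Qed.

Lemma third_index (i j : 'I_3) : i != j -> exists l, uniq [:: i; j; l].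
Proof.
move=> ij; suff /existsP [l] : [exists l, uniq [:: i; j; l]] by exists l.
move: i j ij; do 2![elim/ord3P => //] => _; apply/existsP;
  by [exists i0 | exists i1 | exists i2].
Qed.

Definition inc (a : 'I_3 -> nat) l : 'I_3 -> nat := fun i => (a i + (i == l))%N.

Lemma sum_inc a l : (\sum_i inc a l i = (\sum_i a i).+1)%N.
Proof.
rewrite big_split /= [X in (_ + X)%N](bigD1 l) //= eqxx.
rewrite [X in (_ + (_ + X))%N]big1 ?addn1 //.
by move=> i /negbTE ->.
Qed.

Section Syzygies.
Variables (k : closedFieldType) (L : 'I_3 -> {poly k}).
Hypothesis size_L : forall i, size (L i) = 2.
Hypothesis coprime_L : forall i j, i != j -> coprimep (L i) (L j).

Implicit Types (a b : 'I_3 -> nat) (S T G H : 'I_3 -> {poly k}) (f g p q : {poly k}).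

Lemma L_neq0 i : L i != 0.
Proof. by rewrite -size_poly_gt0 size_L. Qed.

Lemma coprime_L_exp i j m n : i != j -> coprimep (L i ^+ m) (L j ^+ n).
Proof. by move=> ij; rewrite coprimep_expl // coprimep_expr // coprime_L. Qed.

Lemma size_L_exp i n : size (L i ^+ n) = n.+1.
Proof.
have := size_exp (L i) n; rewrite size_L mul1n.
by move: (L_neq0 i) => /(expf_neq0 n); rewrite -size_poly_gt0; case: size => //= m _ ->.
Qed.

Definition prodL (a : 'I_3 -> nat) := \prod_i L i ^+ a i.

Lemma prodL_neq0 a : prodL a != 0.
Proof. by apply/prodf_neq0 => i _; rewrite expf_neq0 ?L_neq0. Qed.

Lemma size_mulf (p q : {poly k}) : p != 0 -> q != 0 ->
  (size (p * q)%R = (size p).-1 + (size q).-1 + 1)%N.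
Proof.
move=> p0 q0; rewrite size_mul //.
by move: p0 q0; rewrite -!size_poly_gt0; case: (size p) => // m; case: (size q) => // n; lia.
Qed.

Lemma size_mul_le (p q : {poly k}) m n : (size p <= m)%N -> (size q <= n)%N ->
  (size (p * q)%R <= (m + n).-1)%N.
Proof.
move=> pm qn; apply: (leq_trans (size_polyMleq _ _)).
by rewrite -!subn1 leq_sub2r // leq_add.
Qed.

Lemma size_prodL a : size (prodL a) = (\sum_i a i).+1.
Proof.
rewrite /prodL (@big3 _ _ _ _ i0 i1 i2) // sumn3 /=.
rewrite !size_mulf ?mulf_neq0 ?expf_neq0 ?L_neq0 // !size_L_exp; lia.
Qed.

Lemma dvd_prodL a p : (forall i, L i ^+ a i %| p) -> prodL a %| p.
Proof.
move=> h; rewrite /prodL (@big3 _ _ _ _ i0 i1 i2) //=.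
by rewrite !Gauss_dvdp ?h // ?coprimepMr ?coprime_L_exp.
Qed.

Definition rt i := - (L i)`_0 / (L i)`_1.

Lemma L_coef1 i : (L i)`_1 != 0.
Proof. by have := L_neq0 i; rewrite -lead_coef_eq0 /lead_coef size_L. Qed.

Lemma LE i : L i = (L i)`_1 *: ('X - (rt i)%:P).
Proof.
apply/polyP => -[|[|n]]; rewrite coefZ coefB coefX coefC /=.
- by rewrite sub0r mulrN mulrCA divff ?L_coef1 // mulr1 opprK.
- by rewrite subr0 mulr1.
- by rewrite subrr mulr0 nth_default // size_L.
Qed.

Lemma dvd_L i p : (L i %| p) = root p (rt i).
Proof. by rewrite {1}LE dvdpZl ?L_coef1 // dvdp_XsubCl. Qed.

(** A syzygy is recorded by its products with the powers rather than by its cofactors: the relation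
    becomes a vanishing sum, two entries determine the third, and linear combinations need no
    bookkeeping. The bound [n] is on sizes, so it allows degrees below [n]. *)
Definition syz (a : 'I_3 -> nat) n (S : 'I_3 -> {poly k}) :=
  [/\ \sum_i S i = 0, (forall i, L i ^+ a i %| S i)
    & (forall i, (size (S i) <= n)%N)].

Lemma syz_le a b m n S : (forall i, (a i <= b i)%N) -> (m <= n)%N ->
  syz b m S -> syz a n S.
Proof.
move=> ab mn [S0 Sd Ss]; split=> // i; last exact: leq_trans mn.
by apply: dvdp_trans (Sd i); apply: dvdp_exp2l.
Qed.

Lemma syzD a n c S T : syz a n S -> syz a n T -> syz a n (fun i => c *: S i + T i).
Proof.
move=> [S0 Sd Ss] [T0 Td Ts]; split.
- by rewrite big_split /= -scaler_sumr S0 T0 scaler0 addr0.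
- by move=> i; rewrite dvdp_add // -mul_polyC dvdp_mull.
- move=> i; rewrite (leq_trans (size_polyD _ _)) // geq_max Ts andbT.
  by rewrite (leq_trans (size_scale_leq _ _)).
Qed.

Lemma syzM a n (p : {poly k}) m S : (size p <= m.+1)%N -> syz a n S ->
  syz a (n + m) (fun i => p * S i).
Proof.
move=> sp [S0 Sd Ss]; split; first by rewrite -mulr_sumr S0 mulr0.
  by move=> i; rewrite dvdp_mull.
by move=> i; have := size_mul_le sp (Ss i); rewrite addSn addnC.
Qed.

Lemma syz_mulprod a b n S : syz a n S ->
  syz (fun i => (a i + b i)%N) (n + \sum_i b i) (fun i => prodL b * S i).
Proof.
move=> Ss; have [|T0 _ Ts] := syzM _ Ss (p := prodL b) (m := (\sum_i b i)%N).
  by rewrite size_prodL.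
split=> // i; rewrite exprD mulrC dvdp_mul //; last by case: Ss.
by rewrite /prodL (bigD1 i) //= dvdp_mulr.
Qed.

(** Since the entries sum to zero, every 2 by 2 minor of the pair equals this one up to sign, by
    [det2E]. *)
Definition det2 (S T : 'I_3 -> {poly k}) := S i0 * T i1 - S i1 * T i0.

Lemma sum3_eq0 (S : 'I_3 -> {poly k}) : \sum_i S i = 0 -> S i2 = - (S i0 + S i1).
Proof. by rewrite sum3 addrA addrC => /eqP; rewrite addr_eq0 => /eqP. Qed.

Lemma det2E S T i j : \sum_i S i = 0 -> \sum_i T i = 0 -> i != j ->
  S i * T j - S j * T i = det2 S T \/ S i * T j - S j * T i = - det2 S T.
Proof.
move=> /sum3_eq0 S2 /sum3_eq0 T2; rewrite /det2.
move: i j; do 2![elim/ord3P => //] => _; rewrite ?S2 ?T2;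
  by [left; ring | right; ring].
Qed.

(** The minor on row i and any other row is visibly divisible by L_i^(a_i), and all minors agree up
    to sign; coprimality then multiplies the three divisors. *)
Lemma dvd_det2 a m n S T : syz a m S -> syz a n T -> prodL a %| det2 S T.
Proof.
move=> [S0 Sd _] [T0 Td _]; apply: dvd_prodL => i.
have [j ij] : exists j, i != j.
  by have [->|i0i] := eqVneq i i0; [exists i1 | exists i0].
have h : L i ^+ a i %| S i * T j - S j * T i.
  by apply: dvdp_sub; [apply: dvdp_mulr | apply: dvdp_mull].
by case: (det2E S0 T0 ij) h => ->; rewrite ?dvdpNr.
Qed.

Lemma size_det2 m n (S T : 'I_3 -> {poly k}) : (forall i, (size (S i) <= m)%N) ->
  (forall i, (size (T i) <= n)%N) -> (size (det2 S T) <= (m + n).-1)%N.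
Proof.
move=> Sm Tn; rewrite /det2 (leq_trans (size_polyD _ _)) // size_polyN geq_max.
by rewrite !size_mul_le.
Qed.

Lemma cramer G H S i : \sum_i G i = 0 -> \sum_i H i = 0 -> \sum_i S i = 0 ->
  det2 G H * S i = det2 S H * G i + det2 G S * H i.
Proof.
move=> /sum3_eq0 G2 /sum3_eq0 H2 /sum3_eq0 S2; rewrite /det2.
by move: i; elim/ord3P; rewrite ?G2 ?H2 ?S2; ring.
Qed.

(** A determinantal criterion for freeness in the style of Saito: the minor of two syzygies is
    always a multiple of [prodL a], and being a nonzero constant multiple of it lets Cramer's rule
    produce polynomial coordinates. Here [al] and [be] are degrees, hence the successors in the size
    bounds. *)
Definition syz_basis a al be G H :=
  [/\ (al + be = \sum_i a i)%N, syz a al.+1 G, syz a be.+1 H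
    & exists2 c, c != 0 & det2 G H = c *: prodL a].

Lemma syz_basisC a al be G H : syz_basis a al be G H -> syz_basis a be al H G.
Proof.
move=> [e Gs Hs [c c0 cE]]; split=> //; first by rewrite addnC.
by exists (- c); rewrite ?oppr_eq0 // scaleNr -cE /det2; ring.
Qed.

Lemma syz_basis_det a al be G H : syz_basis a al be G H -> det2 G H != 0.
Proof. by move=> [_ _ _ [c c0 ->]]; rewrite scaler_eq0 (negbTE c0) prodL_neq0. Qed.

Lemma syz_basis_span a al be G H n S : syz_basis a al be G H -> syz a n S ->
  exists f g : {poly k}, [/\ (size f <= n - al)%N, (size g <= n - be)%N
    & forall i, S i = f * G i + g * H i].
Proof.
move=> bGH sS; have d0 := syz_basis_det bGH.
case: bGH => e sG sH [c c0 cE].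
(* Bounds one Cramer numerator: one of [T], [U] is [S], the other is the basis vector of degree [x],
   and the coordinate obtained belongs to the basis vector of degree [y]. *)
have aux T (U : 'I_3 -> {poly k}) m m' (x y : nat) : syz a m T -> syz a m' U ->
    (m + m' = n + x.+1)%N -> (x + y = \sum_i a i)%N ->
    exists2 f : {poly k}, (size f <= n - y)%N & det2 T U = f * det2 G H.
  move=> sT sU mm' bb'; have /dvdpP [f fE] := dvd_det2 sT sU.
  exists (c^-1 *: f); last first.
    by rewrite cE fE -scalerAl -scalerAr scalerA mulVf // scale1r.
  have [->|f0] := eqVneq f 0; first by rewrite scaler0 size_poly0.
  rewrite size_scale ?invr_eq0 //.
  have e1 : size (det2 T U) = ((size f).-1 + \sum_i a i + 1)%N.
    by rewrite fE size_mulf ?prodL_neq0 // size_prodL.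
  have e2 : (size (det2 T U) <= (m + m').-1)%N.
    by case: sT sU => _ _ Ts [_ _ Us]; apply: size_det2.
  have e3 : (0 < size f)%N by rewrite size_poly_gt0.
  by move: e1 e2 e3 mm' bb'; move: (size f) (size _); lia.
have [f sf fE] := aux _ _ _ _ be al sS sH erefl (etrans (addnC _ _) e).
have [g sg gE] := aux _ _ _ _ al be sG sS (addnC _ _) e.
exists f, g; split=> // i; apply: (mulfI d0).
case: sG sH sS => G0 _ _ [H0 _ _] [S0 _ _].
by rewrite (cramer i G0 H0 S0) fE gE; ring.
Qed.

Lemma syz_basis_free a al be G H f g : syz_basis a al be G H ->
  (forall i, f * G i + g * H i = 0) -> f = 0 /\ g = 0.
Proof.
move=> /syz_basis_det d0 h; split; apply: (mulIf d0); rewrite mul0r.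
  have -> : f * det2 G H = (f * G i0 + g * H i0) * H i1 - (f * G i1 + g * H i1) * H i0.
    by rewrite /det2; ring.
  by rewrite !h !mul0r subrr.
have -> : g * det2 G H = (f * G i1 + g * H i1) * G i0 - (f * G i0 + g * H i0) * G i1.
  by rewrite /det2; ring.
by rewrite !h !mul0r subrr.
Qed.

Lemma prodL_inc a l : prodL (inc a l) = L l * prodL a.
Proof.
rewrite /prodL (bigD1 l) //= [in RHS](bigD1 l) //= mulrA -exprS.
congr (_ * _); first by rewrite /inc eqxx addn1.
by apply: eq_bigr => i /negbTE il; rewrite /inc il addn0.
Qed.

Lemma syz_incM a l n S : syz a n S -> syz (inc a l) n.+1 (fun i => L l * S i).
Proof.
move=> sS; have [|T0 Td Ts] := syzM _ sS (p := L l) (m := 1); first by rewrite size_L.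
split=> [//||i]; last by rewrite -addn1.
move=> i; rewrite /inc; have [->|il] := eqVneq i l; last by rewrite addn0.
rewrite addn1 exprS dvdp_mul2l ?L_neq0 //; case: sS => _ h _; exact: h.
Qed.

(** Raising one exponent multiplies the determinant by L_l. One basis vector is multiplied by L_l,
    and the other must already vanish to one order more at the root of L_l in entry l. Assuming
    [al <= be], a constant multiple of [G] may be added to [H] without raising its degree. *)
Lemma syz_basis_inc a l al be G H : syz_basis a al be G H ->
  exists al' be' G' H', syz_basis (inc a l) al' be' G' H'.
Proof.
wlog le : al be G H / (al <= be)%N => [hw|] bGH.
  have [le|/ltnW le] := leqP al be.
    exact: (hw _ _ G H le bGH).
  exact: (hw _ _ H G le (syz_basisC bGH)).
have [e sG sH [c c0 cE]] := bGH.
have incM al' be' G' H' : (al' + be' = \sum_i a i)%N -> syz a al'.+1 G' ->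
    syz a be'.+1 H' -> L l ^+ (a l).+1 %| H' l -> det2 G' H' = c *: prodL a ->
    syz_basis (inc a l) al'.+1 be' (fun i => L l * G' i) H'.
  move=> e' sG' [H0 Hd Hs] Hl cE'; split; first by rewrite sum_inc -e'.
  - exact: syz_incM.
  - split=> // i; rewrite /inc.
    by have [->|il] := eqVneq i l; rewrite ?addn1 ?addn0.
  - by exists c => //; rewrite prodL_inc scalerAr -cE' /det2; ring.
have [[_ Gd Gs] [_ Hd Hs]] := (sG, sH).
have /dvdpP [g gE] := Gd l; have /dvdpP [h hE] := Hd l.
have dvdS p : (L l ^+ (a l).+1 %| p * L l ^+ a l) = root p (rt l).
  by rewrite exprS dvdp_mul2r ?expf_neq0 ?L_neq0 // dvd_L.
have [g0|g0] := eqVneq g.[rt l] 0.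
  exists be.+1, al, (fun i => L l * H i), G.
  have [e' _ _ [c' c0' cE']] := syz_basisC bGH.
  split; first by rewrite sum_inc -e'.
  - exact: syz_incM.
  - split=> [|i|//]; first by case: sG.
    rewrite /inc; have [->|il] := eqVneq i l; last by rewrite addn0.
    by rewrite addn1 gE dvdS; apply/eqP.
  - by exists c' => //; rewrite prodL_inc scalerAr -cE' /det2; ring.
(* Chosen so that the cofactor of entry l in ka G + H vanishes at the root of L_l. *)
pose ka := - (h.[rt l] / g.[rt l]).
exists al.+1, be, (fun i => L l * G i), (fun i => ka *: G i + H i).
apply: incM => //.
- by apply: syzD => //; apply: syz_le sG.
- rewrite gE hE -mul_polyC mulrA -mulrDl dvdS; apply/eqP.
  by rewrite !hornerE /ka mulNr divfK // addNr.
- by rewrite -cE /det2 -!mul_polyC; ring.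
Qed.

Lemma dec_inc a : (0 < \sum_i a i)%N -> exists l a', a = inc a' l.
Proof.
move=> h; have [l al|a0] := pickP (fun l => 0 < a l)%N; last first.
  by move: h; rewrite big1 // => i _; have := a0 i; case: (a i).
exists l, (fun i => (a i - (i == l))%N); apply: funext => i; rewrite /inc.
by have [->|_] := eqVneq i l; rewrite ?subnK ?subn0 ?addn0.
Qed.

Lemma syz_basis_exists a : exists al be G H, (al <= be)%N /\ syz_basis a al be G H.
Proof.
suff [al [be [G [H b]]]] : exists al be G H, syz_basis a al be G H.
  have [|/ltnW] := leqP al be; first by exists al, be, G, H.
  by exists be, al, H, G; split=> //; apply: syz_basisC.
have [n] := ubnP (\sum_i a i)%N; elim: n a => // n IHn a an.
have [a0|/dec_inc [l [a' aE]]] := posnP (\sum_i a i)%N; last first.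
  have [|al [be [G [H b]]]] := IHn a'; last by rewrite aE; apply: syz_basis_inc b.
  by move: an; rewrite aE sum_inc.
have az i : a i = 0%N by apply/eqP; move: a0; rewrite (bigD1 i) //=; case: (a i).
pose v (x y z : {poly k}) (i : 'I_3) := if i == i0 then x else if i == i1 then y else z.
(* With all exponents 0 the syzygies are all triples of sum zero, and two constant ones generate
   them. *)
exists 0%N, 0%N, (v 1 0 (- 1)), (v 0 1 (- 1)); split=> //.
- split; first by rewrite sum3 /v /= add0r subrr.
    by move=> i; rewrite az dvd1p.
  by elim/ord3P; rewrite /v /= ?size_poly0 ?size_polyN ?size_poly1.
- split; first by rewrite sum3 /v /= add0r subrr.
    by move=> i; rewrite az dvd1p.
  by elim/ord3P; rewrite /v /= ?size_poly0 ?size_polyN ?size_poly1.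
- exists 1; rewrite ?oner_eq0 // scale1r /det2 /v /= mul0r mulr1 subr0.
  by rewrite /prodL big1 // => i _; rewrite az.
Qed.

End Syzygies.

Lemma rVpoly_inj0 (k : fieldType) N (v : 'rV[k]_N) : rVpoly v = 0 -> v = 0.
Proof. by move=> h; rewrite -[v]rVpolyK h linear0. Qed.

(** * Polynomials of bounded size as row vectors, and their functionals *)

Section Pairing.
Variables (k : fieldType) (N : nat).
Implicit Types (r v : 'rV[k]_N) (f g : {poly k}).

Definition pairing r f : k := \sum_(i < N) r 0 i * f`_i.

Lemma pairing_is_linear r : linear (pairing r : {poly k} -> k^o).
Proof.
move=> c f g; rewrite /pairing scaler_sumr -big_split; apply: eq_bigr => i _ /=.
by rewrite coefD coefZ mulrDr mulrCA.
Qed.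

HB.instance Definition _ r :=
  GRing.isLinear.Build k {poly k} k^o _ (pairing r) (pairing_is_linear r).

Lemma mulmx_tr_eq0 r v : r *m v^T = 0 <-> pairing r (rVpoly v) = 0.
Proof.
have e : (r *m v^T) 0 0 = pairing r (rVpoly v).
  by rewrite mxE; apply: eq_bigr => i _; rewrite mxE coef_rVpoly_ord.
by split=> [h|h]; [rewrite -e h mxE | rewrite [LHS]mx11_scalar e h raddf0].
Qed.

Lemma pairing_Xn r (i : 'I_N) : pairing r 'X^i = r 0 i.
Proof.
rewrite /pairing (bigD1 i) //= coefXn eqxx mulr1 big1 ?addr0 // => j ji.
by rewrite coefXn (negbTE ji : (_ == _ :> nat) = _) mulr0.
Qed.

Definition multiples (D : {poly k}) : 'M[k]_N := rowspace (fun v => D %| rVpoly v).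

Lemma subspace_multiples (D : {poly k}) :
  subspace (fun v : 'rV[k]_N => D %| rVpoly v).
Proof.
split=> [|c u v Du Dv]; first by rewrite linear0 dvdp0.
rewrite linearP /=; apply: dvdp_add => //.
rewrite -mul_polyC; exact: dvdp_mull.
Qed.

Lemma mem_multiples D v : (v <= multiples D)%MS <-> D %| rVpoly v.
Proof. exact: mem_rowspace (subspace_multiples D). Qed.

Lemma size_rVpoly v : (size (rVpoly v) <= N)%N.
Proof. exact: size_poly. Qed.

End Pairing.

Section Multiples.
Variables (k : fieldType).
Implicit Types (D : {poly k}).

Lemma rank_multiples N D : D != 0 -> \rank (multiples N D) = (N - (size D).-1)%N.
Proof.
move=> D0; rewrite -[RHS](mxrank1 k); symmetry.
have sD (v : 'rV[k]_(N - (size D).-1)) : (size (rVpoly v * D)%R <= N)%N.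
  have [->|v0] := eqVneq (rVpoly v) 0; first by rewrite mul0r size_poly0.
  rewrite size_mul //.
  have := size_rVpoly v; move: v0 D0; rewrite -!size_poly_gt0.
  by move: (size (rVpoly v)) => m; case: (size D) => // n /=; lia.
apply: (rank_iso (f := fun v => poly_rV (rVpoly v * D))).
- by move=> c u v; rewrite linearP mulrDl -scalerAl linearP.
- by move=> v _; apply/mem_multiples; rewrite poly_rV_K // dvdp_mull.
- move=> v _ /(congr1 rVpoly); rewrite poly_rV_K // linear0 => /eqP.
  by rewrite mulf_eq0 (negbTE D0) orbF => /eqP/rVpoly_inj0.
- move=> w /mem_multiples/dvdpP [f fE]; exists (poly_rV f); first exact: submx1.
  rewrite poly_rV_K -?fE ?rVpolyK //.
  have [->|f0] := eqVneq f 0; first by rewrite size_poly0.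
  have : (size (rVpoly w) <= N)%N := size_rVpoly w.
  rewrite fE size_mul //; move: f0 D0; rewrite -!size_poly_gt0.
  by case: (size D) => // n; move: (size f) => m /=; lia.
Qed.

Lemma multiples_cap N D D' : coprimep D D' ->
  (multiples N D :&: multiples N D' :=: multiples N (D * D')%R)%MS.
Proof.
move=> c; apply: eqmx_mem => v; rewrite sub_capmx; split=> [/andP [] |].
  by move=> /mem_multiples h /mem_multiples h'; apply/mem_multiples; rewrite Gauss_dvdp ?h.
by move=> /mem_multiples; rewrite Gauss_dvdp // => /andP [h h'];
  apply/andP; split; apply/mem_multiples.
Qed.

End Multiples.

(** * Dimensions of spaces of syzygies *)

Section SyzygyDimension.
Variables (k : closedFieldType) (L : 'I_3 -> {poly k}).
Hypothesis size_L : forall i, size (L i) = 2.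
Hypothesis coprime_L : forall i j, i != j -> coprimep (L i) (L j).
Implicit Types (a b : 'I_3 -> nat) (S T G H : 'I_3 -> {poly k}) (f g p q : {poly k}).

Local Notation syz := (syz L).
Local Notation syz_basis := (syz_basis L).
Local Notation prodL := (prodL L).

Definition powerspace N a i : 'M[k]_N := multiples N (L i ^+ a i).

Lemma rank_powerspace N a i : \rank (powerspace N a i) = (N - a i)%N.
Proof. by rewrite rank_multiples ?expf_neq0 ?L_neq0 // size_L_exp. Qed.

Lemma rank_powerspace_cap N a i j : i != j ->
  \rank (powerspace N a i :&: powerspace N a j) = (N - (a i + a j))%N.
Proof.
move=> ij; rewrite multiples_cap ?coprime_L_exp // rank_multiples.
  by rewrite size_mulf ?expf_neq0 ?L_neq0 // !size_L_exp // addn1.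
by rewrite mulf_neq0 ?expf_neq0 ?L_neq0.
Qed.

Lemma powerspace_cap3 N a : (N <= \sum_i a i)%N ->
  (powerspace N a i0 :&: (powerspace N a i1 :&: powerspace N a i2) = 0)%MS.
Proof.
move=> le; apply/eqP/rowV0P => v; rewrite !sub_capmx.
move=> /andP [/mem_multiples h0 /andP [/mem_multiples h1 /mem_multiples h2]].
apply: rVpoly_inj0.
apply: contraTeq le => v0; rewrite -ltnNge -(size_prodL size_L).
have d : prodL a %| rVpoly v by apply: dvd_prodL => //; elim/ord3P.
exact: leq_trans (dvdp_leq v0 d) (size_rVpoly v).
Qed.

Definition rank_sum N a :=
  \rank (powerspace N a i0 + (powerspace N a i1 + powerspace N a i2)).

(** The third entry being forced, syzygies of size at most [N] are coded by row vectors of length 2N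
    holding the first two entries. *)
Definition triple N (w : 'rV[k]_(N + N)) : 'I_3 -> {poly k} := fun i =>
  if i == i0 then rVpoly (lsubmx w) else
  if i == i1 then rVpoly (rsubmx w) else - (rVpoly (lsubmx w) + rVpoly (rsubmx w)).

Lemma triple_linear N c (u v : 'rV[k]_(N + N)) i :
  triple (c *: u + v) i = c *: triple u i + triple v i.
Proof.
rewrite /triple !linearP.
by move: i; elim/ord3P; rewrite //= -!mul_polyC; ring.
Qed.

Lemma triple0 N i : triple (0 : 'rV[k]_(N + N)) i = 0.
Proof. by rewrite /triple !linear0 addr0 oppr0 !if_same. Qed.

Lemma triple_sum N (w : 'rV[k]_(N + N)) : \sum_i triple w i = 0.
Proof. by rewrite sum3 /triple /=; ring. Qed.

Lemma triple_size N (w : 'rV[k]_(N + N)) i : (size (triple w i) <= N)%N.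
Proof.
move: i; elim/ord3P; rewrite /triple /= ?size_rVpoly //.
by rewrite size_polyN (leq_trans (size_polyD _ _)) // geq_max !size_rVpoly.
Qed.

Definition syz_space N a : 'M[k]_(N + N) := rowspace (fun w => syz a N (triple w)).

Lemma mem_syz_space N a w : (w <= syz_space N a)%MS <-> syz a N (triple w).
Proof.
apply: mem_rowspace; split=> [|c u v su sv].
  by split=> [|i|i]; rewrite ?triple_sum ?triple0 ?dvdp0 ?size_poly0.
have [S0 Sd Ss] := syzD c su sv.
by split=> [|i|i]; rewrite ?triple_sum ?triple_linear.
Qed.

Lemma tripleK N a S : syz a N S ->
  triple (row_mx (poly_rV (S i0)) (poly_rV (S i1)) : 'rV[k]_(N + N)) =1 S.
Proof.
move=> [S0 _ Ss]; rewrite /triple row_mxKl row_mxKr !poly_rV_K //.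
by elim/ord3P; rewrite //= (sum3_eq0 S0).
Qed.

Lemma rank_syz_space_param N a m (phi : 'rV[k]_m -> 'I_3 -> {poly k}) :
  (forall c u v i, phi (c *: u + v) i = c *: phi u i + phi v i) ->
  (forall v, syz a N (phi v)) ->
  (forall v, (forall i, phi v i = 0) -> v = 0) ->
  (forall S, syz a N S -> exists v, forall i, S i = phi v i) ->
  \rank (syz_space N a) = m.
Proof.
move=> lin syzphi inj surj; rewrite -[RHS](mxrank1 k m); symmetry.
apply: (rank_iso (f := fun v => row_mx (poly_rV (phi v i0)) (poly_rV (phi v i1)))).
- by move=> c u v; rewrite !lin !linearP scale_row_mx add_row_mx.
- move=> v _; apply/mem_syz_space; have [S0 Sd Ss] := syzphi v.
  by split=> [|i|i]; rewrite ?triple_sum ?(tripleK (syzphi v)).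
- by move=> v _ h; apply: inj => i; rewrite -(tripleK (syzphi v)) h triple0.
- move=> w /mem_syz_space /[dup] sw /surj [v vE]; exists v; first exact: submx1.
  by rewrite -[w in RHS]hsubmxK -!vE /triple /= !rVpolyK.
Qed.

(** Coordinates on the basis are free polynomials of sizes at most N - al and N - be; the truncated
    subtraction is right, since a generator of degree at least [N] contributes nothing. *)
Lemma rank_syz_space_basis N a al be G H : syz_basis a al be G H ->
  \rank (syz_space N a) = (N - al + (N - be))%N.
Proof.
move=> b; have [e sG sH _] := b.
have aux n m (p : {poly k}) T : (size p <= n - m)%N -> syz a m.+1 T ->
    syz a n (fun i => p * T i).
  move=> sp sT; have [nm|mn] := leqP n m.
    have -> : (fun i => p * T i) = fun=> 0.
      apply: funext => i; suff -> : p = 0 by rewrite mul0r.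
      by apply/eqP; rewrite -size_poly_eq0 -leqn0 (leq_trans sp) // leqn0 subn_eq0.
    by split=> [|i|i]; rewrite ?dvdp0 ?size_poly0 // big1.
  have := @syzM _ L a m.+1 p (n - m.+1) T; rewrite subnKC // => h; apply: h => //.
  by apply: leq_trans sp _; lia.
apply: (@rank_syz_space_param _ _ _ (fun v i => rVpoly (lsubmx v) * G i + rVpoly (rsubmx v) * H i)).
- by move=> c u v i; rewrite !linearP /= -!mul_polyC; ring.
- move=> v.
  have := syzD 1 (aux _ _ _ _ (size_rVpoly (lsubmx v)) sG)
    (aux _ _ _ _ (size_rVpoly (rsubmx v)) sH).
  by under eq_fun do rewrite scale1r.
- move=> v /(syz_basis_free size_L b) [h1 h2]; rewrite -[v]hsubmxK.
  by rewrite -(rVpolyK (lsubmx v)) -(rVpolyK (rsubmx v)) h1 h2 !linear0 row_mx0.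
- move=> S /(syz_basis_span size_L coprime_L b) [f [g [sf sg SE]]].
  by exists (row_mx (poly_rV f) (poly_rV g)) => i; rewrite row_mxKl row_mxKr !poly_rV_K.
Qed.

(** Rank-nullity for the projection to entry 0: its image is the intersection of the first power
    space with the sum of the other two, and its kernel is the intersection of those two. *)
Lemma rank_syz_space N a :
  (\rank (syz_space N a) + rank_sum N a = \sum_i (N - a i))%N.
Proof.
pose F : 'M[k]_(N + N, N) := col_mx 1%:M 0.
have FE w : w *m F = lsubmx w by rewrite -{1}[w]hsubmxK mul_row_col mulmx1 mulmx0 addr0.
rewrite -(mxrank_mul_ker (syz_space N a) F).
have -> : \rank (syz_space N a *m F) =
    \rank (powerspace N a i0 :&: (powerspace N a i1 + powerspace N a i2)).
  apply/eqmx_rank/eqmxP/eqmx_mem => v; rewrite sub_capmx; split.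
    move=> /submxP [x ->]; rewrite mulmxA FE.
    have /mem_syz_space [S0 Sd Ss] : (x *m syz_space N a <= syz_space N a)%MS by exact: submxMl.
    move: (x *m _) S0 Sd Ss => w S0 Sd Ss; apply/andP; split.
      by apply/mem_multiples; apply: Sd i0.
    rewrite -[lsubmx w](addrK (rsubmx w)) -[lsubmx w + _]opprK.
    rewrite addmx_sub // eqmx_opp.
      apply: submx_trans (addsmxSr _ _); apply/mem_multiples.
      by rewrite linearN linearD; apply: Sd i2.
    apply: submx_trans (addsmxSl _ _); apply/mem_multiples; exact: Sd i1.
  move=> /andP [/mem_multiples v0 /sub_addsmxP [[x y] /= vE]].
  set v1 := x *m _ in vE; set v2 := y *m _ in vE.
  have /mem_multiples v1d : (v1 <= powerspace N a i1)%MS by exact: submxMl.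
  have /mem_multiples v2d : (v2 <= powerspace N a i2)%MS by exact: submxMl.
  have -> : v = row_mx v (- v1) *m F by rewrite FE row_mxKl.
  apply: submxMr; apply/mem_syz_space; split; first exact: triple_sum.
    rewrite /triple row_mxKl row_mxKr; elim/ord3P => //=.
      by rewrite linearN dvdpNr.
    by rewrite linearN dvdpNr vE linearD addrAC subrr add0r.
  exact: triple_size.
have -> : \rank (syz_space N a :&: kermx F) =
    \rank (powerspace N a i1 :&: powerspace N a i2).
  apply: (rank_iso (f := fun w : 'rV_(N + N) => rsubmx w)).
  - by move=> c u v; rewrite linearP.
  - move=> w; rewrite !sub_capmx => /andP [/mem_syz_space [_ Sd _] /sub_kermxP].
    rewrite FE => l0; apply/andP; split; apply/mem_multiples; first exact: Sd i1.
    by have := Sd i2; rewrite /triple /= l0 linear0 add0r dvdpNr.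
  - move=> w; rewrite sub_capmx => /andP [_ /sub_kermxP]; rewrite FE => l0 r0.
    by rewrite -[w]hsubmxK l0 r0 row_mx0.
  - move=> v; rewrite sub_capmx => /andP [/mem_multiples v1 /mem_multiples v2].
    exists (row_mx 0 v); last by rewrite row_mxKr.
    rewrite sub_capmx; apply/andP; split; last first.
      by apply/sub_kermxP; rewrite FE row_mxKl.
    apply/mem_syz_space; split; [exact: triple_sum | | exact: triple_size].
    rewrite /triple row_mxKl row_mxKr linear0 add0r.
    by elim/ord3P; rewrite //= ?dvdp0 ?dvdpNr.
rewrite sumn3 -!(rank_powerspace N a) /rank_sum.
have := mxrank_sum_cap (powerspace N a i0) (powerspace N a i1 + powerspace N a i2)%MS.
have := mxrank_sum_cap (powerspace N a i1) (powerspace N a i2).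
by lia.
Qed.

End SyzygyDimension.

(** * Balanced syzygies in characteristic p *)

(** As m <= p, an integer strictly between 0 and Q = m p^r is below p^(r + 1), so p^x with x > r
    divides neither j nor Q - j, while for x <= r it divides Q. *)
Lemma logn_sub_mul p r m j : prime p -> (m <= p)%N -> (0 < j < m * p ^ r)%N ->
  logn p (m * p ^ r - j) = logn p j.
Proof.
move=> pp mp /andP [j0 jQ]; set Q := (m * p ^ r)%N.
have Qj0 : (0 < Q - j)%N by rewrite subn_gt0.
have QP : (Q <= p ^ r.+1)%N by rewrite expnS leq_mul2r mp orbT.
suff e x : (x <= logn p (Q - j))%N = (x <= logn p j)%N.
  by apply/eqP; rewrite eqn_leq e leqnn -e leqnn.
rewrite -!pfactor_dvdn //; have [xr|rx] := leqP x r.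
  by rewrite dvdn_subr // ?dvdn_mull ?dvdn_exp2l // ltnW.
have big y : (0 < y < Q)%N -> (p ^ x %| y)%N = false.
  move=> /andP [y0 yQ]; apply/negP => /dvdn_leq; rewrite y0 => /(_ isT).
  rewrite leqNgt (leq_trans yQ) // (leq_trans QP) // leq_exp2l //; exact: prime_gt1.
by rewrite !big ?j0 ?Qj0 //= ltn_subrL j0 (leq_ltn_trans _ jQ).
Qed.

(** Consecutive binomials have the ratio (Q - (i + 1)) / (i + 1), which is a p-adic unit by
    [logn_sub_mul]. *)
Lemma logn_bin_pred p r m i : prime p -> (m <= p)%N -> (i < m * p ^ r)%N ->
  logn p 'C((m * p ^ r).-1, i) = 0.
Proof.
move=> pp mp; elim: i => [|i IHi] iQ; first by rewrite bin0 logn1.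
have := mul_bin_left (m * p ^ r).-1 i; move/(congr1 (logn p)).
have Q0 : (0 < m * p ^ r)%N by apply: leq_trans iQ.
have le : (i.+1 <= (m * p ^ r).-1)%N by rewrite -ltnS prednK.
rewrite !lognM ?bin_gt0 ?subn_gt0 // ?(ltnW le) // IHi ?(ltnW iQ) // addn0.
have -> : ((m * p ^ r).-1 - i = m * p ^ r - i.+1)%N by lia.
by rewrite logn_sub_mul //; lia.
Qed.

Lemma bin_pred_neq0 (k : fieldType) p r m i : p \in [pchar k] -> (m <= p)%N ->
  (i < m * p ^ r)%N -> 'C((m * p ^ r).-1, i)%:R != 0 :> k.
Proof.
move=> pk mp iQ; have pp := pcharf_prime pk.
rewrite -(dvdn_pcharf pk) -(expn1 p) pfactor_dvdn ?logn_bin_pred // bin_gt0.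
by rewrite -ltnS prednK //; apply: leq_trans iQ.
Qed.

Lemma poly_horner_inj (k : closedFieldType) (f g : {poly k}) :
  (forall y, f.[y] = g.[y]) -> f = g.
Proof.
move=> h; apply/eqP; rewrite -subr_eq0; apply/negP => /negP/closed_nonrootP [y].
by rewrite /root hornerD hornerN h subrr eqxx.
Qed.

Section Vanishing.
Variables (k : closedFieldType) (L : 'I_3 -> {poly k}).
Hypothesis size_L : forall i, size (L i) = 2.
Hypothesis coprime_L : forall i j, i != j -> coprimep (L i) (L j).
Implicit Types (a b : 'I_3 -> nat) (S T G H : 'I_3 -> {poly k}) (f g p q : {poly k}).

Local Notation prodL := (prodL L).

Lemma L_expE i m : L i ^+ m = ((L i)`_1 ^+ m) *: ('X - (rt L i)%:P) ^+ m.
Proof. by rewrite {1}(LE size_L i) exprZn. Qed.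

(* For a functional r on polynomials of degree < Q, the polynomial
   Phi(Y) = r((X - Y)^(Q-1)) vanishes to order Q - a at the root of L i as soon
   as r kills the multiples of L i ^+ a: expand X - Y around that root. *)
Lemma rank_sum_full Q a : (forall i, (i < Q)%N -> 'C(Q.-1, i)%:R != 0 :> k) ->
  (\sum_i (Q - a i) = Q)%N -> rank_sum L Q a = Q.
Proof.
case: Q => [|n] /= bin0 aQ; first by apply/eqP; rewrite -leqn0 rank_leq_row.
set W := (powerspace L n.+1 a i0 + (powerspace L n.+1 a i1 + powerspace L n.+1 a i2))%MS.
have killW r i f : (r <= orth W)%MS -> L i ^+ a i %| f -> (size f <= n.+1)%N ->
    pairing r f = 0.
  move=> /mem_orth rW df sf; rewrite -(poly_rV_K sf); apply/mulmx_tr_eq0/rW.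
  have h : (poly_rV f <= powerspace L n.+1 a i)%MS.
    by apply/mem_multiples; rewrite poly_rV_K.
  apply: submx_trans h _; move: i {df}; elim/ord3P.
  - exact: addsmxSl.
  - exact: submx_trans (addsmxSl _ _) (addsmxSr _ _).
  - exact: submx_trans (addsmxSr _ _) (addsmxSr _ _).
suff orth0 : \rank (orth W) = 0.
  have := rank_orth W; rewrite orth0 => /esym/eqP; rewrite subn_eq0 => h.
  by apply/eqP; rewrite eqn_leq rank_leq_row.
apply/eqP; rewrite mxrank_eq0; apply/eqP/eqP/rowV0P => r rW.
pose Phi : {poly k} := \sum_(i < n.+1)
  ((-1) ^+ i * pairing r 'X^(n - i) *+ 'C(n, i)) *: 'X^i.
pose Psi (c : k) : {poly k} := \sum_(i < n.+1)
  ((-1) ^+ i * pairing r (('X - c%:P) ^+ (n - i)) *+ 'C(n, i)) *: ('X - c%:P) ^+ i.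
have PhiE y : Phi.[y] = pairing r (('X - y%:P) ^+ n).
  rewrite exprBn linear_sum horner_sum; apply: eq_bigr => i _.
  rewrite hornerZ hornerXn linearMn /= mulrnAl; congr (_ *+ _).
  have -> : (-1) ^+ i * 'X^(n - i) * y%:P ^+ i = ((-1) ^+ i * y ^+ i) *: 'X^(n - i).
    by rewrite -mul_polyC polyCM !polyC_exp polyCN mulrAC.
  by rewrite linearZ /= -mulrA [pairing _ _ * _]mulrC mulrA.
have PhiPsi c : Phi = Psi c.
  apply: poly_horner_inj => y; rewrite PhiE.
  have -> : 'X - y%:P = ('X - c%:P) - (y - c)%:P.
    by rewrite polyCB opprB addrA subrK.
  rewrite exprBn linear_sum horner_sum; apply: eq_bigr => i _.
  rewrite hornerZ horner_exp !hornerE linearMn /= mulrnAl; congr (_ *+ _).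
  set E := _ ^+ (n - i).
  have -> : (-1) ^+ i * E * (y - c)%:P ^+ i = ((-1) ^+ i * (y - c) ^+ i) *: E.
    by rewrite -mul_polyC polyCM !polyC_exp polyCN mulrAC.
  by rewrite linearZ /= -mulrA [pairing _ _ * _]mulrC mulrA.
have dPhi i : L i ^+ (n.+1 - a i) %| Phi.
  rewrite L_expE dvdpZl ?expf_neq0 ?L_coef1 // (PhiPsi (rt L i)).
  apply: (big_ind (fun f => _ %| f)) => [|f g|j _]; [exact: dvdp0 | exact: dvdp_add |].
  have [le|lt] := leqP (a i) (n - j).
    rewrite (killW _ i) ?mulr0 ?mul0rn ?scale0r ?dvdp0 //.
      have := L_expE i (n - j) => /(congr1 (fun f => ((L i)`_1 ^+ (n - j))^-1 *: f)).
      rewrite scalerA mulVf ?expf_neq0 ?L_coef1 // scale1r => <-.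
      by rewrite -mul_polyC dvdp_mull // dvdp_exp2l.
    by rewrite size_exp_XsubC ltnS leq_subr.
  by rewrite -mul_polyC dvdp_mull // dvdp_exp2l //; lia.
(* [Phi] has degree at most Q - 1 but is divisible by pairwise coprime powers of total degree Q. *)
have Phi0 : Phi = 0.
  apply/eqP; apply: contraT => Pn0.
  have : (size (prodL (fun i => n.+1 - a i)%N) <= size Phi)%N.
    by apply: dvdp_leq => //; apply: dvd_prodL.
  rewrite size_prodL // aQ leqNgt ltnS.
  suff -> : (size Phi <= n.+1)%N by [].
  apply: (big_ind (fun f : {poly k} => (size f <= n.+1)%N)) => [|f g sf sg|j _].
  - by rewrite size_poly0.
  - by rewrite (leq_trans (size_polyD _ _)) // geq_max sf.
  - by rewrite (leq_trans (size_scale_leq _ _)) // size_polyXn ltnS -ltnS.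
(* The coefficient of index n - i of [Phi] is entry i of [r] up to sign and a binomial, nonzero by
   hypothesis. *)
apply/rowP => i; rewrite mxE -pairing_Xn.
have in1 : (n - i < n.+1)%N by rewrite ltnS leq_subr.
have := congr1 (fun f : {poly k} => f`_(n - i)) Phi0.
rewrite coef0 coef_sum (bigD1 (Ordinal in1)) //= big1 ?addr0; last first.
  by move=> j; rewrite coefZ coefXn => /negbTE h; rewrite eq_sym (h : (_ == _ :> nat) = _) mulr0.
rewrite coefZ coefXn eqxx mulr1 subKn -1?ltnS // -mulr_natr => /eqP.
by rewrite !mulf_eq0 signr_eq0 (negbTE (bin0 _ in1)) orbF => /eqP.
Qed.

End Vanishing.

Section Basis.
Variables (k : closedFieldType) (L : 'I_3 -> {poly k}).
Hypothesis size_L : forall i, size (L i) = 2.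
Hypothesis coprime_L : forall i j, i != j -> coprimep (L i) (L j).
Implicit Types (a b : 'I_3 -> nat) (S T G H : 'I_3 -> {poly k}) (f g : {poly k}).

Local Notation syz := (syz L).
Local Notation syz_basis := (syz_basis L).

Definition no_syz a n := forall S, syz a n S -> forall i, S i = 0.

Lemma no_syz_le a b m n : (forall i, (a i <= b i)%N) -> (m <= n)%N ->
  no_syz a n -> no_syz b m.
Proof. by move=> ab mn h S sS; apply/h/(syz_le ab mn). Qed.

Lemma rank_no_syz a n : (\rank (syz_space L n a) = 0)%N -> no_syz a n.
Proof.
move=> r0 S sS i; rewrite -(tripleK sS).
set w := row_mx _ _; suff -> : w = 0 by rewrite triple0.
apply/eqP; rewrite -submx0.
have /eqP : \rank (syz_space L n a) = 0%N by [].
rewrite mxrank_eq0 => /eqP <-; apply/mem_syz_space.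
by have [S0 Sd Ss] := sS; split=> [|j|j]; rewrite ?triple_sum ?(tripleK sS).
Qed.

(** Here the numbers Q - a_i sum to Q, so the three power spaces fill everything by [rank_sum_full],
    and the dimension count of [rank_syz_space] leaves no room for a syzygy. Both generators then
    have degree Q: this is the balanced case. *)
Lemma no_syz_pred Q a : (forall i, (i < Q)%N -> 'C(Q.-1, i)%:R != 0 :> k) ->
  (forall i, (a i <= Q)%N) -> (\sum_i a i = 2 * Q)%N -> no_syz a Q.
Proof.
move=> binQ aQ sa; apply: rank_no_syz.
have e : (\sum_i (Q - a i) = Q)%N.
  rewrite sumn3; have := aQ i0; have := aQ i1; have := aQ i2.
  by move: sa; rewrite sumn3; lia.
have := rank_syz_space size_L Q a.
by rewrite rank_sum_full // e; lia.
Qed.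

Lemma syz_basis_no_syz a al be G H n : syz_basis a al be G H -> no_syz a n ->
  (n <= al)%N.
Proof.
move=> b no; rewrite leqNgt; apply/negP => lt.
have d0 := syz_basis_det size_L b; have [_ sG _ _] := b.
have G0 := no _ (syz_le (fun i => leqnn _) lt sG).
by move: d0; rewrite /det2 !G0 !mul0r subrr eqxx.
Qed.

(** When the degrees add up correctly, the cofactor of [prodL a] in the minor has degree 0, so it
    suffices that the minor does not vanish. *)
Lemma syz_basis_det_intro a al be G H : (al + be = \sum_i a i)%N ->
  syz a al.+1 G -> syz a be.+1 H -> det2 G H != 0 -> syz_basis a al be G H.
Proof.
move=> e sG sH d0; split=> //.
have /dvdpP [f fE] := dvd_det2 coprime_L sG sH.
have f0 : f != 0 by apply: contraNneq d0 => f0; rewrite fE f0 mul0r.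
have e1 : size (det2 G H) = ((size f).-1 + \sum_i a i + 1)%N.
  by rewrite fE size_mulf ?prodL_neq0 // size_prodL.
have e2 : (size (det2 G H) <= (al.+1 + be.+1).-1)%N.
  by case: sG sH => _ _ Gs [_ _ Hs]; apply: size_det2.
have e3 : (size f <= 1)%N.
  by move: e1 e2 e; move: (size f) (size _); lia.
exists f`_0; last by rewrite -mul_polyC -size1_polyC.
by apply: contraNneq f0 => f00; rewrite (size1_polyC e3) f00.
Qed.

Lemma syz_basis_gap t a : (\sum_i a i = 2 * t)%N -> no_syz a t ->
  exists G H, syz_basis a t t G H.
Proof.
move=> sa no; have [al [be [G [H [le b]]]]] := syz_basis_exists size_L a.
have tal := syz_basis_no_syz b no; have [e _ _ _] := b.
have [alt bet] : al = t /\ be = t by lia.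
by exists G, H; rewrite -{1}alt -{1}bet.
Qed.

Lemma syz_basis_gap1 t a : (\sum_i a i = (2 * t).+1)%N -> no_syz a t ->
  exists G H, syz_basis a t t.+1 G H.
Proof.
move=> sa no; have [al [be [G [H [le b]]]]] := syz_basis_exists size_L a.
have tal := syz_basis_no_syz b no; have [e _ _ _] := b.
have [alt bet] : al = t /\ be = t.+1 by lia.
by exists G, H; rewrite -{1}alt -bet.
Qed.

Lemma syz_basis_neq0 a al be G H : syz_basis a al be G H -> exists i, G i != 0.
Proof.
move=> /(syz_basis_det size_L) d0; apply/existsP; apply: contraNT d0.
rewrite negb_exists => /forallP G0.
have G0' i : G i = 0 by apply/eqP; have := G0 i; rewrite negbK.
by rewrite /det2 !G0' !mul0r subrr.
Qed.

Lemma syz_span_const t a G H S : syz_basis a t t G H -> syz a t.+1 S ->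
  exists x y : k, forall i, S i = x *: G i + y *: H i.
Proof.
move=> b sS; have [f [g [sf sg SE]]] := syz_basis_span size_L coprime_L b sS.
have [fc gc] : (size f <= 1)%N /\ (size g <= 1)%N by split; [move: sf|move: sg]; rewrite subSnn.
by exists f`_0, g`_0 => i; rewrite SE (size1_polyC fc) (size1_polyC gc) !coefC !mul_polyC.
Qed.

(** In the balanced case the syzygies of degree [t] form a plane over [k]. There a vanishing minor
    means proportionality by a scalar, not merely by a rational function. *)
Lemma syz_proportional t a S T : (\sum_i a i = 2 * t)%N -> no_syz a t ->
  syz a t.+1 S -> syz a t.+1 T -> det2 S T = 0 ->
  (exists i, S i != 0) -> (exists i, T i != 0) ->
  exists2 c : k, c != 0 & forall i, S i = c *: T i.
Proof.
move=> sa no sS sT dST [i Si] [j Tj].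
have [G [H b]] := syz_basis_gap sa no.
have [x [y SE]] := syz_span_const b sS; have [z [w TE]] := syz_span_const b sT.
have xw : x * w = y * z.
  have : det2 S T = (x * w - y * z) *: det2 G H.
    by rewrite /det2 !SE !TE -!mul_polyC; ring.
  rewrite dST => /esym/eqP; rewrite scaler_eq0 (negbTE (syz_basis_det size_L b)) orbF subr_eq0.
  by move/eqP.
have [x0|x0] := eqVneq x 0.
  have y0 : y != 0 by apply: contraNneq Si => y0; rewrite SE x0 y0 !scale0r addr0.
  have z0 : z = 0.
    by apply/eqP; move: xw => /esym/eqP; rewrite x0 mul0r mulf_eq0 (negbTE y0).
  have w0 : w != 0 by apply: contraNneq Tj => w0; rewrite TE z0 w0 !scale0r addr0.
  exists (y / w); first by rewrite mulf_neq0 ?invr_eq0.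
  by move=> l; rewrite SE TE x0 z0 !scale0r !add0r scalerA divfK.
have z0 : z != 0.
  apply: contraNneq Tj => z0; rewrite TE z0; move/eqP: xw.
  by rewrite z0 mulr0 mulf_eq0 (negbTE x0) /= => /eqP ->; rewrite !scale0r addr0.
exists (x / z); first by rewrite mulf_neq0 ?invr_eq0.
move=> l; rewrite SE TE scalerDr !scalerA divfK //; congr (_ + _ *: _).
by apply: (mulIf z0); rewrite mulrAC divfK.
Qed.

(* Three pairwise independent vectors X0, X1, X2 of the plane of syzygies of
   degree t, rescaled so that X2 is the difference of the other two. *)
Lemma syz_pencil t a (X : 'I_3 -> 'I_3 -> {poly k}) : (\sum_i a i = 2 * t)%N ->
  (forall l, syz a t.+1 (X l)) ->
  (forall i j, i != j -> det2 (X i) (X j) != 0) ->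
  exists x y : k, let G i := x *: X i1 i in let H i := y *: X i0 i in
    syz_basis a t t G H /\ forall i, H i - G i = X i2 i.
Proof.
move=> sa sX dX.
have b : syz_basis a t t (X i1) (X i0).
  by apply: syz_basis_det_intro => //; [rewrite sa; lia | apply: dX].
have [x [y XE]] := syz_span_const b (sX i2).
exists (- x), y => G H; split=> [|i]; last by rewrite XE /G scaleNr opprK addrC.
have sc c l : syz a t.+1 (fun i => c *: X l i).
  have := syzD (c - 1) (sX l) (sX l); congr (syz _ _ _); apply: funext => i.
  by rewrite -{2}[X l i]scale1r -scalerDl subrK.
apply: syz_basis_det_intro; [by rewrite sa; lia | exact: sc | exact: sc |].
have e : det2 G H = (- x * y) *: det2 (X i1) (X i0).
  by rewrite /det2 /G /H -!mul_polyC; ring.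
rewrite -/G -/H e scaler_eq0 (negbTE (dX i1 i0 isT)) orbF mulf_neq0 // ?oppr_eq0.
  (* A zero coordinate would make [X i2] proportional to one of the two other vectors. *)
  apply: contraTneq (dX i2 i0 isT) => x0.
  by rewrite /det2 !XE x0 -!mul_polyC negbK; apply/eqP; ring.
apply: contraTneq (dX i2 i1 isT) => y0.
by rewrite /det2 !XE y0 -!mul_polyC negbK; apply/eqP; ring.
Qed.

(** Removing a common factor L_l lowers the exponent at [l] only, because L_l is coprime to the
    other two forms. *)
Lemma syz_div a l n S : syz (inc a l) n.+1 S -> (forall i, L l %| S i) ->
  exists2 Z, syz a n Z & forall i, S i = L l * Z i.
Proof.
move=> [S0 Sd Ss] LS; exists (fun i => S i %/ L l); last by move=> i; rewrite mulrC divpK.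
have SE i : S i = L l * (S i %/ L l) by rewrite mulrC divpK.
split.
- apply: (mulfI (L_neq0 size_L l)); rewrite mulr0 mulr_sumr -[RHS]S0.
  by apply: eq_bigr => i _; rewrite -SE.
- move=> i; have := Sd i; rewrite {1}SE /inc; have [->|il] := eqVneq i l.
    by rewrite addn1 exprS dvdp_mul2l ?L_neq0.
  by rewrite addn0 Gauss_dvdpr // coprimep_expl // coprime_L.
- by move=> i; rewrite size_divp ?L_neq0 // size_L leq_subLR add1n.
Qed.

End Basis.

(** * Frobenius pullbacks of syzygies *)

Section Frobenius.
Variables (k : closedFieldType) (L : 'I_3 -> {poly k}).
Hypothesis size_L : forall i, size (L i) = 2.
Hypothesis coprime_L : forall i j, i != j -> coprimep (L i) (L j).
Variables (p r : nat).
Hypothesis pchar_k : p \in [pchar k].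
Implicit Types (a b u : 'I_3 -> nat) (S T G H : 'I_3 -> {poly k}) (f g : {poly k}).

Local Notation syz := (syz L).
Local Notation syz_basis := (syz_basis L).
Local Notation prodL := (prodL L).
Local Notation no_syz := (no_syz L).
Local Notation q := (p ^ r)%N.

Let p_prime : prime p := pcharf_prime pchar_k.

Lemma q_gt0 : (0 < q)%N.
Proof. by rewrite expn_gt0 prime_gt0. Qed.

Lemma exprDq f g : (f + g) ^+ q = f ^+ q + g ^+ q.
Proof.
have ch : p \in [pchar {poly k}] by rewrite pchar_poly.
by apply: exprDn_pchar; rewrite pnatX pnatE ?ch.
Qed.

Lemma exprBq f g : (f - g) ^+ q = f ^+ q - g ^+ q.
Proof. by apply/eqP; rewrite eq_sym subr_eq -exprDq subrK. Qed.

Lemma expr0q : (0 : {poly k}) ^+ q = 0.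
Proof. by rewrite expr0n; move: q_gt0; case: q. Qed.

Lemma size_exprq f n : (size f <= n.+1)%N -> (size (f ^+ q)%R <= (q * n).+1)%N.
Proof.
move=> sf; apply: leq_trans (size_poly_exp_leq _ _) _.
by rewrite ltnS mulnC leq_mul2l -subn1 leq_subLR add1n sf orbT.
Qed.

Lemma syz_exprq a n S : syz a n.+1 S ->
  syz (fun i => q * a i)%N (q * n).+1 (fun i => S i ^+ q).
Proof.
move=> [S0 Sd Ss]; split=> [|i|i]; last exact: size_exprq.
  by rewrite sum3 -!exprDq -sum3 S0 expr0q.
by rewrite mulnC exprM dvdp_exp2r.
Qed.

Lemma det2_exprq S T :
  det2 (fun i => S i ^+ q) (fun i => T i ^+ q) = det2 S T ^+ q.
Proof. by rewrite /det2 exprBq !exprMn. Qed.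

Lemma syz_basis_exprq a al be G H : syz_basis a al be G H ->
  syz_basis (fun i => q * a i)%N (q * al) (q * be)
    (fun i => G i ^+ q) (fun i => H i ^+ q).
Proof.
move=> b; have d0 := syz_basis_det size_L b.
have [e sG sH _] := b; apply: syz_basis_det_intro => //.
- by rewrite -mulnDr e big_distrr.
- exact: syz_exprq.
- exact: syz_exprq.
- by rewrite det2_exprq expf_neq0.
Qed.

(** The case r = 0 of the binomial criterion. It is applied to the quotients u, which are of the
    size of t < p, whereas the criterion for general r serves for vanishing. *)
Lemma no_syz_small Q a : (Q <= p)%N -> (forall i, (a i <= Q)%N) ->
  (\sum_i a i = 2 * Q)%N -> no_syz a Q.
Proof.
move=> Qp; apply: no_syz_pred => // i iQ.
by have := @bin_pred_neq0 k p 0 Q i pchar_k Qp; rewrite expn0 muln1; apply.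
Qed.

Section Combination.
Variables (u : 'I_3 -> nat) (t : nat) (Ga De : 'I_3 -> {poly k}).
Hypothesis basis_u : syz_basis u t t Ga De.

(** The syzygy [G] for the remainders supplies the coefficients of the q-th powers. The formula
    singles out entries 0 and 1, but [combE2] rewrites it with entry 2, so all three indices can be
    treated alike. *)
Definition comb G : 'I_3 -> {poly k} := fun i => G i0 * Ga i ^+ q + G i1 * De i ^+ q.

Lemma comb_sum G : \sum_i comb G i = 0.
Proof.
have [_ /syz_exprq [Ga0 _ _] /syz_exprq [De0 _ _] _] := basis_u.
by rewrite big_split /= -!mulr_sumr Ga0 De0 !mulr0 addr0.
Qed.

Lemma combE2 G i : \sum_i G i = 0 ->
  comb G i = G i1 * (De i - Ga i) ^+ q - G i2 * Ga i ^+ q.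
Proof. by move=> /sum3_eq0 ->; rewrite /comb exprBq; ring. Qed.

Lemma comb_size G n i : (forall i, (size (G i) <= n.+1)%N) ->
  (size (comb G i) <= (q * t + n).+1)%N.
Proof.
move=> sG; have [_ [_ _ Gas] [_ _ Des] _] := basis_u.
rewrite (leq_trans (size_polyD _ _)) // geq_max.
have aux f g : (size f <= n.+1)%N -> (size g <= t.+1)%N ->
    (size (f * g ^+ q)%R <= (q * t + n).+1)%N.
  by move=> sf /size_exprq sg; have := size_mul_le sf sg; rewrite addSn addnS addnC.
by rewrite !aux.
Qed.

Lemma det2_comb G H : det2 (comb G) (comb H) = det2 G H * det2 Ga De ^+ q.
Proof. by rewrite -det2_exprq /det2 /comb; ring. Qed.

Lemma comb_dvd G i : L i ^+ (q * u i) %| comb G i.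
Proof.
have [_ /syz_exprq [_ Gad _] /syz_exprq [_ Ded _] _] := basis_u.
by apply: dvdp_add; apply: dvdp_mull.
Qed.

End Combination.

(** Raising u at l gives the odd sum 2t + 1, so there is a syzygy X_l of degree t for the raised
    exponents. If X_i and X_j were proportional, X_i would be a syzygy for u raised at both i and j,
    of sum 2(t + 1), in a size excluded by balance; this is where t + 1 <= p enters. The pencil
    lemma then rescales X_1, X_0 into the basis. *)
Lemma normal_basis_even u t : (\sum_i u i = 2 * t)%N -> (forall i, (u i <= t)%N) ->
  (t < p)%N -> exists Ga De, syz_basis u t t Ga De /\
    [/\ L i0 ^+ (u i0).+1 %| De i0, L i1 ^+ (u i1).+1 %| Ga i1
      & L i2 ^+ (u i2).+1 %| De i2 - Ga i2].
Proof.
move=> su ut tp.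
have no : no_syz u t by apply: no_syz_small => //; apply: ltnW.
have no2 i j : i != j -> no_syz (inc (inc u i) j) t.+1.
  move=> ij; apply: no_syz_small => // [l|]; last by rewrite !sum_inc su; lia.
  rewrite /inc; have [->|lj] := eqVneq l j; last first.
    by rewrite addn0; case: eqP => _; have := ut l; lia.
  by rewrite eq_sym (negbTE ij) addn0 addn1 ltnS.
have /choice [X] : forall l, exists X, syz (inc u l) t.+1 X /\ exists i, X i != 0.
  move=> l.
  have [||G [H b]] := @syz_basis_gap1 _ _ size_L t (inc u l).
  - by rewrite sum_inc su.
  - by apply: no_syz_le no => // i; apply: leq_addr.
  by exists G; split; [case: b | apply: syz_basis_neq0 b].
move=> hX; have sX l : syz u t.+1 (X l).
  by apply: syz_le (proj1 (hX l)) => // i; apply: leq_addr.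
have dX i j : i != j -> det2 (X i) (X j) != 0.
  move=> ij; apply/eqP => d0.
  have [c c0 XE] := syz_proportional size_L coprime_L su no (sX i) (sX j) d0
    (proj2 (hX i)) (proj2 (hX j)).
  have [l] := proj2 (hX i); rewrite (no2 i j ij (X i)) ?eqxx //.
  have [S0 Sd Ss] := proj1 (hX i); split=> // m; rewrite {1}/inc.
  have [->|mj] := eqVneq m j; last by rewrite addn0.
  rewrite XE -mul_polyC dvdp_mull //; have [[_ Td _] _] := hX j.
  by have := Td j; rewrite /inc eqxx eq_sym (negbTE ij) addn0.
have [x [y [b dE]]] := syz_pencil size_L coprime_L su sX dX.
exists (fun i => x *: X i1 i), (fun i => y *: X i0 i); split=> //.
have hl l : L l ^+ (u l).+1 %| X l l.
  by have [[_ Td _] _] := hX l; have := Td l; rewrite /inc eqxx addn1.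
by split; [| | rewrite dE]; rewrite -?mul_polyC ?dvdp_mull.
Qed.

(** [comb] shifts degrees by q t and multiplies determinants, so it carries a basis for the
    remainders to a basis for the full exponents. *)
Lemma syz_basis_translate u t ro al be G H :
  (\sum_i u i = 2 * t)%N -> (forall i, (u i <= t)%N) -> (t < p)%N ->
  (forall i, (ro i <= q)%N) -> syz_basis ro al be G H ->
  exists G' H', syz_basis (fun i => q * u i + ro i)%N (q * t + al) (q * t + be) G' H'.
Proof.
move=> su ut tp roq b; have [Ga [De [bu [De0 Ga1 De2]]]] := normal_basis_even su ut tp.
exists (comb Ga De G), (comb Ga De H).
have syz_comb n S : syz ro n.+1 S ->
    syz (fun i => q * u i + ro i)%N (q * t + n).+1 (comb Ga De S).
  move=> [S0 Sd Ss]; split; [exact: comb_sum bu S | | by move=> i; apply: (comb_size bu)].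
  have [_ /syz_exprq [_ Gad _] /syz_exprq [_ Ded _] _] := bu.
  (* The q-th power of L_i^(u_i + 1) is enough because remainders are at most q. *)
  have dvd_big i f : L i ^+ (u i).+1 %| f -> L i ^+ (q * u i + ro i) %| f ^+ q.
    move=> h; apply: (@dvdp_trans _ ((L i ^+ (u i).+1) ^+ q)); last exact: dvdp_exp2r.
    by rewrite -exprM dvdp_exp2l // mulSn [in X in (_ <= X)%N]mulnC addnC leq_add2r.
  elim/ord3P.
  - apply: dvdp_add; last by apply: dvdp_mull; apply: dvd_big.
    by rewrite exprD mulrC dvdp_mul.
  - apply: dvdp_add; first by apply: dvdp_mull; apply: dvd_big.
    by rewrite exprD mulrC dvdp_mul.
  - rewrite combE2 //; apply: dvdp_sub; first by apply: dvdp_mull; apply: dvd_big.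
    by rewrite exprD mulrC dvdp_mul.
have d0 := syz_basis_det size_L b; have du0 := syz_basis_det size_L bu.
have [e sG sH _] := b; apply: syz_basis_det_intro => //.
- by rewrite big_split /= -big_distrr /= su -e; lia.
- exact: syz_comb.
- exact: syz_comb.
- by rewrite det2_comb mulf_neq0 ?expf_neq0.
Qed.

(** Now every entry of a basis vector must be divisible by one L_l, so the vectors are L_l Y_l with
    Y_l a syzygy of degree t for u + 1 lowered at l, of sum 2t + 1. If two were proportional, L_j
    would divide Y_i, and the quotient would be a syzygy excluded by balance at sum 2t. *)
Lemma normal_basis_odd u t : ((\sum_i u i).+1 = 2 * t)%N -> (forall i, (u i < t)%N) ->
  (t < p)%N -> exists Ga De, syz_basis (fun i => (u i).+1) t.+1 t.+1 Ga De /\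
    forall i, [/\ L i0 %| De i, L i1 %| Ga i & L i2 %| De i - Ga i].
Proof.
move=> su ut tp; set U := fun i => (u i).+1.
have sU : (\sum_i U i = 2 * t.+1)%N by rewrite sumn3 /U; rewrite sumn3 in su; lia.
have noU : no_syz U t.+1.
  by apply: no_syz_small => // i; rewrite /U ltnS ltnW.
have no1 l : no_syz (inc u l) t.
  apply: no_syz_small => // [|i|]; [exact: ltnW| |by rewrite sum_inc su].
  by rewrite /inc; have := ut i; case: eqP => _; lia.
pose w l : 'I_3 -> nat := fun i => (u i + (i != l))%N.
have wU l : inc (w l) l = U.
  by apply: funext => i; rewrite /inc /w /U; case: eqP => _ /=; lia.
have wE i j l : uniq [:: i; j; l] -> w i = inc (inc u l) j.
  move=> uq; apply: funext => m; rewrite /inc /w -addnA; congr addn.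
  by move: i j l m uq; do 4![elim/ord3P => //].
have /choice [Y] : forall l, exists Y, syz (w l) t.+1 Y /\ exists i, Y i != 0.
  move=> l.
  have [j lj] : exists j, l != j.
    by have [->|h] := eqVneq l i0; [exists i1 | exists i0].
  have [m uq] := third_index lj; rewrite (wE _ _ _ uq).
  have [||G [H b]] := @syz_basis_gap1 _ _ size_L t (inc (inc u m) j).
  - by rewrite !sum_inc su.
  - by apply: no_syz_le (no1 m) => // i; apply: leq_addr.
  by exists G; split; [case: b | apply: syz_basis_neq0 b].
move=> hY; pose X l := fun i => L l * Y l i.
have sX l : syz U t.+2 (X l) by rewrite -(wU l); apply: syz_incM => //; case: (hY l).
have X0 l : exists i, X l i != 0.
  by have [_ [i Yi]] := hY l; exists i; apply: mulf_neq0 => //; exact: L_neq0.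
have dX i j : i != j -> det2 (X i) (X j) != 0.
  move=> ij; apply/eqP => d0.
  have [c c0 XE] := syz_proportional size_L coprime_L sU noU (sX i) (sX j) d0 (X0 i) (X0 j).
  have [m uq] := third_index ij; have [sY [l]] := hY i.
  rewrite (wE _ _ _ uq) in sY.
  have [n|Z sZ YE] := syz_div size_L coprime_L sY; last first.
    by rewrite YE (no1 _ _ sZ) mulr0 eqxx.
  rewrite -(Gauss_dvdpr _ (coprime_L (_ : j != i))) 1?eq_sym //.
  by have := XE n; rewrite /X => ->; rewrite -mul_polyC mulrCA dvdp_mulr.
have [x [y [b dE]]] := syz_pencil size_L coprime_L sU sX dX.
exists (fun i => x *: X i1 i), (fun i => y *: X i0 i); split=> // i.
by split; [rewrite -mul_polyC dvdp_mull // | rewrite -mul_polyC dvdp_mull // | rewrite dE];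
  apply: dvdp_mulr.
Qed.

(** The image under [comb] of a syzygy for [si] has the common factor [prodL si]. Dividing it out
    lowers the exponents from q (u_i + 1) to q (u_i + 1) - si_i, and the determinants stay
    nonzero. *)
Lemma syz_basis_reflect u t si al be G H :
  ((\sum_i u i).+1 = 2 * t)%N -> (forall i, (u i < t)%N) -> (t < p)%N ->
  (forall i, (si i <= q)%N) -> syz_basis si al be G H ->
  exists al' be' G' H', [/\ (al' + \sum_i si i = q * t.+1 + al)%N,
    (be' + \sum_i si i = q * t.+1 + be)%N
    & syz_basis (fun i => q * (u i).+1 - si i)%N al' be' G' H'].
Proof.
move=> su ut tp siq b; have [Ga [De [bu dvd]]] := normal_basis_odd su ut tp.
pose U i := (u i).+1; pose a i := (q * U i - si i)%N.
have siU i : (si i <= q * U i)%N.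
  by apply: leq_trans (siq i) _; rewrite leq_pmulr.
have st : (\sum_i si i <= q * t.+1)%N.
  have t2 : (2 <= t)%N by have := ut i0; have := ut i1; have := ut i2; rewrite sumn3 in su; lia.
  apply: (@leq_trans (q * 3)); last by rewrite leq_mul2l ltnS t2 orbT.
  by rewrite sumn3; have := siq i0; have := siq i1; have := siq i2; lia.
(* In entry i both Ga and De provide L_i^(q U_i). For j different from i, the factor L_j^(si_j)
   comes from S_j in one term and from the q-th power of a multiple of L_j in the other, as si_j <=
   q. *)
have dvd_comb S n i : syz si n S -> prodL si * L i ^+ a i %| comb Ga De S i.
  move=> [S0 Sd _].
  have -> : prodL si * L i ^+ a i = prodL (fun j => if j == i then q * U j else si j)%N.
    rewrite /prodL (bigD1 i) //= [in RHS](bigD1 i) //= eqxx mulrAC -exprD subnKC //.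
    by congr (_ * _); apply: eq_bigr => j /negbTE ->.
  apply: dvd_prodL => // j; have [->|ji] := eqVneq j i; first exact: comb_dvd bu S i.
  have [dDe dGa dDG] := dvd i.
  have dq l f : L l %| f -> L l ^+ si l %| f ^+ q.
    by move=> h; apply: (@dvdp_trans _ (L l ^+ q)); [exact: dvdp_exp2l | exact: dvdp_exp2r].
  move: j {ji}; elim/ord3P.
  - by apply: dvdp_add; [apply: dvdp_mulr | apply: dvdp_mull; apply: dq].
  - by apply: dvdp_add; [apply: dvdp_mull; apply: dq | apply: dvdp_mulr].
  - by rewrite combE2 //; apply: dvdp_sub; [apply: dvdp_mull; apply: dq | apply: dvdp_mulr].
pose quo S : 'I_3 -> {poly k} := fun i => comb Ga De S i %/ prodL si.
have quoE S n i : syz si n S -> comb Ga De S i = quo S i * prodL si.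
  move=> sS; rewrite /quo divpK //; apply: dvdp_trans (dvd_comb _ _ _ sS).
  exact: dvdp_mulr.
have pn0 : prodL si != 0 by apply: prodL_neq0.
have syz_quo S n : syz si n.+1 S -> syz a (q * t.+1 + n - \sum_i si i).+1 (quo S).
  move=> sS; have [S0 Sd Ss] := sS; split.
  - apply: (mulIf pn0); rewrite mul0r mulr_suml -[RHS](comb_sum bu S).
    by apply: eq_bigr => i _; rewrite (quoE _ _ _ sS).
  - by move=> i; have := dvd_comb _ _ i sS; rewrite (quoE _ _ _ sS) mulrC dvdp_mul2r.
  - move=> i; rewrite /quo size_divp // size_prodL //=.
    by move: (comb_size bu i Ss); move: (size _) (\sum_i _)%N (q * _)%N => x y z; lia.
have d0 := syz_basis_det size_L b; have du0 := syz_basis_det size_L bu.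
have [e sG sH _] := b.
exists (q * t.+1 + al - \sum_i si i)%N, (q * t.+1 + be - \sum_i si i)%N, (quo G), (quo H).
split; [by lia | by lia |].
apply: syz_basis_det_intro => //.
- have -> : (\sum_i (q * (u i).+1 - si i) = q * (2 * t).+2 - \sum_i si i)%N.
    have := siU i0; have := siU i1; have := siU i2; rewrite /U -su !sumn3; lia.
  by rewrite -e; lia.
- exact: syz_quo.
- exact: syz_quo.
- suff : det2 (quo G) (quo H) * (prodL si * prodL si) != 0.
    by rewrite mulf_eq0 negb_or => /andP [].
  have -> : det2 (quo G) (quo H) * (prodL si * prodL si) = det2 (comb Ga De G) (comb Ga De H).
    by rewrite /det2 !(quoE _ _ _ sG) !(quoE _ _ _ sH); ring.
  by rewrite det2_comb mulf_neq0 ?expf_neq0.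
Qed.

End Frobenius.

Lemma uniq3 (T : eqType) (i j l : T) : uniq [:: i; j; l] = [&& i != j, i != l & j != l].
Proof. by rewrite /= !inE negb_or andbT andbA. Qed.

Lemma exists_between (B a : 'I_3 -> nat) m : (forall i, (a i <= B i)%N) ->
  (\sum_i a i <= m <= \sum_i B i)%N ->
  exists b, [/\ forall i, (a i <= b i)%N, forall i, (b i <= B i)%N & (\sum_i b i = m)%N].
Proof.
have [n] := ubnP (m - \sum_i a i)%N; elim: n a => // n IHn a an aB /andP [am mB].
have [e|lt] := eqVneq (\sum_i a i)%N m; first by exists a.
have [l al|h] := pickP (fun l => a l < B l)%N; last first.
  have : (\sum_i B i <= \sum_i a i)%N.
    by apply: leq_sum => i _; rewrite leqNgt h.
  by move: lt; lia.
have [|i||b [ab bB sb]] := IHn (inc a l).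
- by rewrite sum_inc; lia.
- by rewrite /inc; case: eqP => [->|_]; rewrite ?addn1 ?addn0.
- by rewrite sum_inc mB andbT ltn_neqAle lt.
exists b; split=> // i; apply: leq_trans (ab i); exact: leq_addr.
Qed.

(** * Koszul syzygies, duality, and ranks in the unbalanced cases *)

Section Ranks.
Variables (k : closedFieldType) (L : 'I_3 -> {poly k}).
Hypothesis size_L : forall i, size (L i) = 2.
Hypothesis coprime_L : forall i j, i != j -> coprimep (L i) (L j).
Implicit Types (a b u : 'I_3 -> nat) (S T G H : 'I_3 -> {poly k}) (f g : {poly k}).

Local Notation syz := (syz L).
Local Notation syz_basis := (syz_basis L).
Local Notation prodL := (prodL L).
Local Notation no_syz := (no_syz L).
Local Notation syz_space := (syz_space L).

Definition koszul a (i j l : 'I_3) : 'I_3 -> {poly k} := fun x =>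
  if x == i then 0 else
  if x == j then L j ^+ a j * L l ^+ a l else - (L j ^+ a j * L l ^+ a l).

Lemma size_koszul_entry a j l :
  size (L j ^+ a j * L l ^+ a l) = (a j + a l).+1.
Proof. by rewrite size_mulf ?expf_neq0 ?L_neq0 // !size_L_exp // addn1. Qed.

Lemma koszul_syz a i j l : uniq [:: i; j; l] -> syz a (a j + a l).+1 (koszul a i j l).
Proof.
move=> uq; have := uq; rewrite uniq3 => /and3P [ij il jl].
split.
- rewrite (@big3 _ _ _ _ i j l uq) /koszul /= eqxx (eq_sym j) (negbTE ij) eqxx.
  by rewrite (eq_sym l) (negbTE il) (eq_sym l) (negbTE jl) subrr addr0.
- move=> x; rewrite /koszul; have [->|xi] := eqVneq x i; first exact: dvdp0.
  have [->|xj] := eqVneq x j; first exact: dvdp_mulr.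
  have -> : x = l.
    by move: i j l x uq xi xj {ij il jl}; do 4![elim/ord3P => //].
  by rewrite dvdpNr dvdp_mull.
- move=> x; rewrite /koszul; case: ifP => _; first by rewrite size_poly0.
  by case: ifP => _; rewrite ?size_polyN size_koszul_entry.
Qed.

(** Entry i is a multiple of L_i^(a_i) of too small a size, hence zero; only multiples of the Koszul
    syzygy of the other two powers remain. *)
Lemma rank_syz_big N a i j l : uniq [:: i; j; l] -> (N <= a i)%N ->
  \rank (syz_space N a) = (N - (a j + a l))%N.
Proof.
move=> uq Nai; have := uq; rewrite uniq3 => /and3P [ij il jl].
have e0 : L j ^+ a j * L l ^+ a l != 0 by rewrite mulf_neq0 ?expf_neq0 ?L_neq0.
apply: (@rank_syz_space_param _ _ _ _ _ (fun v x => rVpoly v * koszul a i j l x)).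
- by move=> c u v x; rewrite linearP /= mulrDl scalerAl.
- move=> v; have [le|lt] := leqP N (a j + a l).
    move: v; rewrite (eqP (_ : N - (a j + a l) == 0)%N) ?subn_eq0 // => v.
    have -> : rVpoly v = 0.
      by apply/eqP; rewrite -size_poly_leq0 size_rVpoly.
    by split=> [|x|x]; rewrite ?mul0r ?dvdp0 ?size_poly0 // big1 // => x _; rewrite mul0r.
  have := @syzM _ L a (a j + a l).+1 (rVpoly v) (N - (a j + a l).+1) (koszul a i j l).
  rewrite subnKC // => h; apply: h; last exact: koszul_syz.
  by apply: leq_trans (size_rVpoly v) _; lia.
- move=> v /(_ j); rewrite /koszul eq_sym (negbTE ij) eqxx => /eqP.
  by rewrite mulf_eq0 (negbTE e0) orbF => /eqP/rVpoly_inj0.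
- move=> S [S0 Sd Ss].
  have Si : S i = 0.
    apply/eqP; apply: contraT => Sn0.
    have := leq_trans (dvdp_leq Sn0 (Sd i)) (Ss i).
    by rewrite size_L_exp // ltnNge Nai.
  have Sl : S l = - S j.
    have := S0; rewrite (@big3 _ _ _ _ i j l uq) /= Si add0r => /eqP.
    by rewrite addrC addr_eq0 => /eqP.
  have /dvdpP [f fE] : L j ^+ a j * L l ^+ a l %| S j.
    by rewrite Gauss_dvdp ?coprime_L_exp // Sd -dvdpNr -Sl Sd.
  exists (poly_rV f) => x; rewrite poly_rV_K.
    rewrite /koszul; have [->|xi] := eqVneq x i; first by rewrite mulr0.
    have [->|xj] := eqVneq x j; first by rewrite fE.
    have -> : x = l.
      by move: i j l x uq xi xj {ij il jl e0 Nai Si Sl fE}; do 4![elim/ord3P => //].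
    by rewrite Sl fE mulrN.
  have [->|f0] := eqVneq f 0; first by rewrite size_poly0.
  have sz : size (S j) = ((size f).-1 + (a j + a l) + 1)%N.
    by rewrite fE size_mulf // size_koszul_entry.
  have f1 : (0 < size f)%N by rewrite size_poly_gt0.
  by move: sz f1 (Ss j); move: (size f) (size _); lia.
Qed.

(** As N + M = al + be, one has N - al = be - M and N - be = al - M in the integers, so the two
    ranks are the sums of the positive and negative parts of the same two numbers. *)
Lemma rank_syz_dual N M a : (N + M = \sum_i a i)%N ->
  (\rank (syz_space N a) + M = \rank (syz_space M a) + N)%N.
Proof.
move=> NM; have [al [be [G [H [_ b]]]]] := syz_basis_exists size_L a.
have [e _ _ _] := b.
rewrite !(rank_syz_space_basis size_L coprime_L _ b); lia.
Qed.

Lemma rank_syz0 N a : no_syz a N -> \rank (syz_space N a) = 0%N.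
Proof.
move=> no; have [al [be [G [H [le b]]]]] := syz_basis_exists size_L a.
have := syz_basis_no_syz size_L b no.
by rewrite (rank_syz_space_basis size_L coprime_L _ b); lia.
Qed.

(** The dimension of the Koszul syzygies of size at most [N]: one truncated difference for each
    pair, the three families being independent as long as [N] is at most the sum of the
    exponents. *)
Definition koszul_dim N a :=
  (N - (a i0 + a i1) + (N - (a i0 + a i2)) + (N - (a i1 + a i2)))%N.

Lemma koszul_dimE N a i j l : uniq [:: i; j; l] ->
  koszul_dim N a = (N - (a i + a j) + (N - (a i + a l)) + (N - (a j + a l)))%N.
Proof.
rewrite /koszul_dim; move: i j l; do 3![elim/ord3P => //] => _.
all: rewrite ?(addnC (a i1) (a i0)) ?(addnC (a i2) (a i0)) ?(addnC (a i2) (a i1)); lia.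
Qed.

(** With [N] = d + 1 and a_i = w_i + 1, [n1] and [n0] are the multiplicities of the weight w in h^1
    and h^0. *)
Definition n1 N a := (\rank (syz_space N a) - koszul_dim N a)%N.
Definition n0 N a := (N - rank_sum L N a)%N.

Lemma koszul_dim_dual N M a : (N + M = \sum_i a i)%N ->
  koszul_dim N a = (\sum_i (a i - M))%N.
Proof. by rewrite /koszul_dim !sumn3; lia. Qed.

(** A duality between the two cohomologies, obtained by combining the dimension count of
    [rank_syz_space] with [rank_syz_dual]; the Koszul part in size [N] is rewritten in terms of
    [M]. *)
Lemma n0_n1 N M a : (N + M = \sum_i a i)%N -> n0 N a = n1 M a.
Proof.
move=> NM; rewrite /n0 /n1; have := rank_syz_dual NM.
have := rank_syz_space size_L N a.
have : (rank_sum L N a <= N)%N by apply: rank_leq_row.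
rewrite (@koszul_dim_dual M N) 1?addnC //.
by move: NM; rewrite !sumn3; lia.
Qed.

Lemma n1_big N M a i : (N + M = \sum_i a i)%N -> (N <= a i)%N -> n1 N a = 0%N.
Proof.
move=> NM Nai.
have [j [l uq]] : exists j l, uniq [:: i; j; l].
  have [j ij] : exists j, i != j by have [->|h] := eqVneq i i0; [exists i1 | exists i0].
  by have [l uq] := third_index ij; exists j, l.
rewrite /n1 (rank_syz_big uq Nai) (koszul_dimE _ _ uq); lia.
Qed.

Variables (p r : nat).
Hypothesis pchar_k : p \in [pchar k].
Local Notation q := (p ^ r)%N.

(** If some a_i is at least Q, only Koszul syzygies are left. Otherwise there are no syzygies at
    all, by comparison with exponents of sum 2Q and entries at most Q, where balance applies. *)
Lemma n1_vanish Q m N M a : Q = (m * q)%N -> (m <= p)%N -> (N <= Q <= M)%N ->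
  (N + M = \sum_i a i)%N -> n1 N a = 0%N.
Proof.
move=> QE mp /andP [NQ QM] NM.
have [i Qi|lt] := pickP (fun i => Q <= a i)%N.
  by apply: (n1_big NM (i := i)); apply: leq_trans Qi.
have aQ i : (a i < Q)%N by rewrite ltnNge lt.
have noQ b : (forall i, (b i <= Q)%N) -> (\sum_i b i = 2 * Q)%N -> no_syz b Q.
  apply: no_syz_pred => // i; rewrite QE => iQ; exact: bin_pred_neq0.
suff no : no_syz a N by rewrite /n1 rank_syz0.
(* If the sum is too large, lowering the exponents to sum 2Q only weakens the divisibility
   conditions. *)
have [le|gt] := leqP (2 * Q) (\sum_i a i).
  have [|b [_ ba sb]] := @exists_between a (fun=> 0%N) (2 * Q) (fun=> leq0n _).
    by rewrite le andbT sumn3.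
  have bQ i : (b i <= Q)%N by apply: leq_trans (ba i) (ltnW (aQ i)).
  exact: (no_syz_le ba NQ (noQ b bQ sb)).
have [||b [ab bQ sb]] := @exists_between (fun=> Q) a (2 * Q).
- by move=> i; apply: ltnW.
- by rewrite (ltnW gt) sumn3; lia.
move=> S sS i.
(* If the sum is too small, the exponents are raised by multiplying the syzygy. This adds 2Q - (N +
   M) to the size, which remains at most 2Q - M <= Q. *)
have := syz_mulprod size_L (fun i => b i - a i)%N sS => sS'.
have sb' : (N + \sum_i (b i - a i) <= Q)%N.
  move: NM gt sb (ab i0) (ab i1) (ab i2); rewrite !sumn3; lia.
have := noQ b bQ sb (fun i => prodL (fun j => b j - a j)%N * S i) _ i.
have sS2 : syz b Q (fun i => prodL (fun j => b j - a j)%N * S i).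
  by apply: syz_le sS' => // j; rewrite subnKC.
by move=> /(_ sS2) /eqP; rewrite mulf_eq0 (negbTE (prodL_neq0 size_L _)) => /eqP.
Qed.

(* L i ^+ t lies in the complete intersection (L j ^+ (u j).+1, L l ^+ (u l).+1);
   its q-th power provides the syzygy that completes the Koszul one. *)
Lemma rank_syz_split u ro t i j l N : uniq [:: i; j; l] ->
  u i = t -> (u j + u l < t)%N -> (forall x, (ro x <= q)%N) ->
  let a x := (q * u x + ro x)%N in
  \rank (syz_space N a) = (N - a i + (N - (a j + a l)))%N.
Proof.
move=> uq uit ujl roq a; have := uq; rewrite uniq3 => /and3P [ij il jl].
pose D := L j ^+ (u j).+1; pose D' := L l ^+ (u l).+1.
have sD : size D = (u j).+2 by rewrite size_L_exp.
have sD' : size D' = (u l).+2 by rewrite size_L_exp.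
have D'0 : D' != 0 by rewrite expf_neq0 ?L_neq0.
have /Bezout_eq1_coprimepP [[x y] /= xy] : coprimep D D' by exact: coprime_L_exp.
(* The Bezout relation writes [f] as f x D + f y D'. Reducing f x modulo D' keeps A D of degree at
   most u_j + u_l + 1 <= t, so both summands of [f] have degree at most t. *)
pose f := L i ^+ t; pose A := (f * x) %% D'.
have sA : (size A <= (u l).+1)%N by rewrite -ltnS -sD' ltn_modp.
have sAD : (size (A * D)%R <= t.+1)%N.
  by have := size_mul_le sA (leqnn (size D)); rewrite sD => /leq_trans; apply; lia.
have sf : (size f <= t.+1)%N by rewrite size_L_exp.
have fAD : D' %| f - A * D.
  have -> : f - A * D = D' * (f * y + (f * x) %/ D' * D).
    have -> : A = f * x - (f * x) %/ D' * D'.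
      by rewrite {1}(divp_eq (f * x) D') addrC addKr.
    by rewrite -{1}[f]mulr1 -xy; move: (_ %/ _) => z; ring.
  exact: dvdp_mulr.
pose T z := if z == i then f else if z == j then - (A * D) else - (f - A * D).
have sT z : (size (T z) <= t.+1)%N.
  rewrite /T; do 2![case: ifP => _ //]; rewrite ?size_polyN //.
  by rewrite (leq_trans (size_polyD _ _)) // size_polyN geq_max sf.
have Tq0 : \sum_z T z = 0.
  rewrite (@big3 _ _ _ _ i j l uq) /T /= eqxx (eq_sym j) (negbTE ij) eqxx.
  by rewrite (eq_sym l) (negbTE il) (eq_sym l) (negbTE jl); ring.
pose G z := L i ^+ ro i * T z ^+ q.
have dvdq z m : (m <= q)%N -> L z ^+ (u z).+1 %| T z -> L z ^+ (q * u z + m) %| G z.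
  move=> mq h; rewrite /G dvdp_mull //; apply: (@dvdp_trans _ ((L z ^+ (u z).+1) ^+ q)).
    by rewrite -exprM dvdp_exp2l // mulSn [in X in (_ <= X)%N]mulnC addnC leq_add2r.
  exact: dvdp_exp2r.
have sG : syz a (a i).+1 G.
  have e : \sum_z T z ^+ q = 0.
    by rewrite sum3 -!(exprDq r pchar_k) -sum3 Tq0 (expr0q _ pchar_k).
  split; first by rewrite -mulr_sumr e mulr0.
    move=> z; have [->|zi] := eqVneq z i.
      by rewrite /G /a addnC exprD dvdp_mul // /T eqxx uit mulnC exprM.
    apply: dvdq => //; rewrite /T (negbTE zi).
    have [->|zj] := eqVneq z j; first by rewrite dvdpNr dvdp_mull.
    have -> : z = l by move: (i) (j) (l) z uq zi zj; do 4![elim/ord3P => //].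
    by rewrite dvdpNr.
  move=> z; rewrite /G.
  have s1 : (size (L i ^+ ro i) <= (ro i).+1)%N by rewrite size_L_exp.
  have := size_mul_le s1 (size_exprq p r (sT z)).
  by rewrite /a uit addSn addnS addnC.
have sK := koszul_syz a uq.
(* The Koszul syzygy is zero in entry i, so the minor is, up to sign, a product of two nonzero
   entries. *)
have b : syz_basis a (a i) (a j + a l) G (koszul a i j l).
  apply: syz_basis_det_intro => //; first by rewrite (@big3 _ _ _ _ i j l uq).
  have [[G0 _ _] [K0 _ _]] := (sG, sK).
  have : G i * koszul a i j l j - G j * koszul a i j l i != 0.
    rewrite /koszul !eqxx (eq_sym j) (negbTE ij) mulr0 subr0.
    by rewrite /G /T eqxx !mulf_neq0 ?expf_neq0 // ?expf_neq0 ?L_neq0.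
  by case: (det2E G0 K0 ij) => ->; rewrite ?oppr_eq0.
exact: rank_syz_space_basis b.
Qed.

(** The basis for u has degrees t and t + 1, and N <= q (t + 1) excludes the q-th power of the
    second vector. So a syzygy is f G^q, and the remainders [ro] force exactly the factor [prodL ro]
    in f. *)
Lemma rank_syz_above u ro t N : (\sum_i u i = (2 * t).+1)%N -> (forall i, (u i <= t)%N) ->
  (t < p)%N -> (forall i, (ro i <= q)%N) -> (N <= q * t.+1)%N ->
  \rank (syz_space N (fun i => q * u i + ro i)%N) = (N - (q * t + \sum_i ro i))%N.
Proof.
move=> su ut tp roq Nq.
have no : no_syz u t.
  have [|l [u' uE]] := @dec_inc u; first by rewrite su.
  have : no_syz u' t.
    apply: (no_syz_small size_L coprime_L pchar_k (ltnW tp)) => [i|].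
      by have := ut i; rewrite uE /inc; lia.
    by apply/eqP; rewrite -eqSS -(sum_inc u' l) -uE su.
  by apply: no_syz_le => // i; rewrite uE leq_addr.
have no2 l : no_syz (inc u l) t.+1.
  apply: (no_syz_small size_L coprime_L pchar_k tp) => [i|]; last by rewrite sum_inc su; lia.
  by rewrite /inc; have := ut i; case: eqP => _ /=; lia.
have [G [H b]] := syz_basis_gap1 size_L su no.
have bq := syz_basis_exprq size_L coprime_L r pchar_k b.
have [[_ sG _ _] [_ sGq _ _]] := (b, bq).
have [_ Gd _] := sG.
have [x Gx] := syz_basis_neq0 size_L b.
have Gqx : G x ^+ q != 0 by rewrite expf_neq0.
(* A further factor L_i in entry i would make [G] a syzygy for u raised at i, of sum 2(t + 1), which
   balance excludes in this size. *)
have cop i : exists2 g, G i = g * L i ^+ u i & coprimep (L i) g.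
  have /dvdpP [g gE] := Gd i; exists g => //.
  rewrite /coprimep; apply/eqP; apply/eqP.
  have -> : (size (gcdp (L i) g) == 1) = coprimep (L i) g by [].
  rewrite [L i](LE size_L) coprimepZl ?L_coef1 //.
  rewrite coprimep_sym coprimep_XsubC -(dvd_L size_L).
  apply/negP => Lg; move: Gx; rewrite (no2 i G) ?eqxx //.
  have [S0 Sd Ss] := sG; split=> // z; rewrite /inc.
  have [->|zi] := eqVneq z i; last by rewrite addn0.
  by rewrite addn1 gE exprS dvdp_mul.
pose v' (v : 'rV[k]_(N - (q * t + \sum_i ro i))) := rVpoly v * prodL ro.
apply: (@rank_syz_space_param _ _ _ _ _ (fun v i => v' v * G i ^+ q)).
- by move=> c v w i; rewrite /v' linearP /= -!mul_polyC; ring.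
- move=> v; have [le|lt] := leqP N (q * t + \sum_i ro i).
    move: v @v'; rewrite (eqP (_ : N - (q * t + \sum_i ro i) == 0)%N) ?subn_eq0 // => v v'.
    have -> : v' v = 0.
      rewrite /v'; have -> : rVpoly v = 0 by apply/eqP; rewrite -size_poly_leq0 size_rVpoly.
      by rewrite mul0r.
    by split=> [|z|z]; rewrite ?mul0r ?dvdp0 ?size_poly0 // big1 // => z _; rewrite mul0r.
  have s1 := syz_mulprod size_L ro sGq.
  have := @syzM _ L _ _ (rVpoly v) (N - (q * t + \sum_i ro i).+1) _ _ s1.
  rewrite addSn subnKC // => h.
  have h' : (size (rVpoly v) <= (N - (q * t + \sum_i ro i).+1).+1)%N.
    by apply: leq_trans (size_rVpoly v) _; lia.
  have -> : (fun i => v' v * G i ^+ q) = (fun i => rVpoly v * (prodL ro * G i ^+ q)).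
    by apply: funext => i; rewrite /v' mulrA.
  exact: h.
- move=> v /(_ x) /eqP; rewrite !mulf_eq0 (negbTE Gqx) (negbTE (prodL_neq0 size_L _)) !orbF.
  by move=> /eqP/rVpoly_inj0.
- move=> S sS; have sS' : syz (fun i => q * u i)%N N S.
    by apply: syz_le sS => // i; apply: leq_addr.
  have [f [g [sf sg SE]]] := syz_basis_span size_L coprime_L bq sS'.
  have g0 : g = 0.
    by apply/eqP; rewrite -size_poly_leq0 (leq_trans sg) // leqn0 subn_eq0.
  have SE' i : S i = f * G i ^+ q by rewrite SE g0 mul0r addr0.
  have /dvdpP [h hE] : prodL ro %| f.
    apply: dvd_prodL => // i; have [g' gE cg] := cop i.
    have [_ Sd _] := sS; have := Sd i; rewrite SE' gE exprMn -exprM [(u i * q)%N]mulnC exprD mulrA.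
    rewrite [L i ^+ _ * L i ^+ _]mulrC dvdp_mul2r ?expf_neq0 ?L_neq0 // Gauss_dvdpl //.
    by rewrite coprimep_expl // coprimep_expr.
  exists (poly_rV h) => i; rewrite /v' poly_rV_K ?SE' ?hE //.
  have [->|h0] := eqVneq h 0; first by rewrite size_poly0.
  have e : size f = ((size h).-1 + \sum_i ro i + 1)%N.
    by rewrite hE size_mulf ?prodL_neq0 // size_prodL.
  have h1 : (0 < size h)%N by rewrite size_poly_gt0.
  by move: e h1 sf; move: (size h) (size f) => x1 x2; lia.
Qed.

(** Multiplying a syzygy by [prodL si] brings it to the exponents q (u_i + 1), where it is f G^q as
    the second generator is too large. Then [prodL si] divides f, so the original syzygy is an
    arbitrary multiple of G^q. *)
Lemma rank_syz_below u si t N : (\sum_i u i + 2 = 2 * t)%N -> (forall i, (u i < t)%N) ->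
  (t < p)%N -> (forall i, (si i <= q)%N) -> (N + \sum_i si i <= q * t.+1)%N ->
  \rank (syz_space N (fun i => q * (u i).+1 - si i)%N) = (N - q * t)%N.
Proof.
move=> su ut tp siq Nq; pose U i := (u i).+1.
have sU : (\sum_i U i = (2 * t).+1)%N by rewrite sumn3 /U; rewrite sumn3 in su; lia.
have decU l : U = inc (fun i => u i + (i != l))%N l.
  by apply: funext => i; rewrite /inc /U; case: eqP => _ /=; lia.
have no1 l : no_syz (fun i => u i + (i != l))%N t.
  apply: (no_syz_small size_L coprime_L pchar_k (ltnW tp)) => [i|].
    by have := ut i; case: eqP => _ /=; lia.
  by apply/eqP; rewrite -eqSS -(sum_inc _ l) -decU sU.
have no : no_syz U t.
  by apply: no_syz_le (no1 i0) => // i; rewrite /U; case: eqP => _ /=; lia.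
have [G [H b]] := syz_basis_gap1 size_L sU no.
have bq := syz_basis_exprq size_L coprime_L r pchar_k b.
have [[_ sG _ _] [_ sGq _ _]] := (b, bq).
have [x Gx] := syz_basis_neq0 size_L b.
have Gqx : G x ^+ q != 0 by rewrite expf_neq0.
have siU i : (si i <= q * U i)%N.
  by apply: leq_trans (siq i) _; rewrite leq_pmulr.
have [G0 _ _] := sG.
(* If L_i divided every entry of [G], the quotient would be a syzygy excluded by balance at sum
   2t. *)
have cop i : exists2 j, i != j & coprimep (L i) (G j).
  have [j [l uq]] : exists j l, uniq [:: i; j; l].
    have [j ij] : exists j, i != j by have [->|h] := eqVneq i i0; [exists i1 | exists i0].
    by have [l uq] := third_index ij; exists j, l.
  have := uq; rewrite uniq3 => /and3P [ij il jl].
  have cE z : coprimep (L i) (G z) = ~~ (L i %| G z).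
    rewrite [L i](LE size_L) coprimepZl ?L_coef1 // coprimep_sym coprimep_XsubC.
    by rewrite dvdpZl ?L_coef1 // dvdp_XsubCl.
  have [cj|] := boolP (coprimep (L i) (G j)); first by exists j.
  have [cl|] := boolP (coprimep (L i) (G l)); first by exists l.
  rewrite !cE !negbK => dl dj; exfalso.
  have di : L i %| G i.
    have := G0; rewrite (@big3 _ _ _ _ i j l uq) /= => /eqP; rewrite addr_eq0 => /eqP ->.
    by rewrite dvdpNr dvdp_add.
  have LG z : L i %| G z.
    have [->//|zi] := eqVneq z i; have [->//|zj] := eqVneq z j.
    by have -> : z = l by move: (i) (j) (l) z uq zi zj; do 4![elim/ord3P => //].
  rewrite (decU i) in sG; have [Z sZ ZE] := syz_div size_L coprime_L sG LG.
  by move: Gx; rewrite ZE (no1 i Z sZ) mulr0 eqxx.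
apply: (@rank_syz_space_param _ _ _ _ _ (fun v i => rVpoly v * G i ^+ q)).
- by move=> c v w i; rewrite linearP /= -!mul_polyC; ring.
- move=> v; have [le|lt] := leqP N (q * t).
    move: v; rewrite (eqP (_ : N - (q * t) == 0)%N) ?subn_eq0 // => v.
    have -> : rVpoly v = 0 by apply/eqP; rewrite -size_poly_leq0 size_rVpoly.
    by split=> [|z|z]; rewrite ?mul0r ?dvdp0 ?size_poly0 // big1 // => z _; rewrite mul0r.
  have sGq' : syz (fun i => q * (u i).+1 - si i)%N (q * t).+1 (fun i => G i ^+ q).
    by apply: syz_le sGq => // i; rewrite leq_subr.
  have := @syzM _ L _ _ (rVpoly v) (N - (q * t).+1) _ _ sGq'.
  rewrite subnKC // => h; apply: h.
  by apply: leq_trans (size_rVpoly v) _; lia.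
- move=> v /(_ x) /eqP; rewrite !mulf_eq0 (negbTE Gqx) !orbF.
  by move=> /eqP/rVpoly_inj0.
- move=> S sS; have sS' : syz (fun i => q * U i)%N (N + \sum_i si i) (fun i => prodL si * S i).
    have := syz_mulprod size_L si sS; congr (syz _ _ _); apply: funext => i.
    by rewrite subnK.
  have [f [g [sf sg SE]]] := syz_basis_span size_L coprime_L bq sS'.
  have g0 : g = 0.
    by apply/eqP; rewrite -size_poly_leq0 (leq_trans sg) // leqn0 subn_eq0.
  have SE' i : prodL si * S i = f * G i ^+ q by rewrite SE g0 mul0r addr0.
  have /dvdpP [h hE] : prodL si %| f.
    apply: dvd_prodL => // i; have [j ij cg] := cop i.
    have : L i ^+ si i %| f * G j ^+ q.
      by rewrite -SE' dvdp_mulr // /prodL (bigD1 i) //= dvdp_mulr.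
    by rewrite Gauss_dvdpl // coprimep_expl // coprimep_expr.
  exists (poly_rV h) => i; rewrite poly_rV_K.
    by apply: (mulfI (prodL_neq0 size_L si)); rewrite SE' hE; ring.
  have [->|h0] := eqVneq h 0; first by rewrite size_poly0.
  have e : size f = ((size h).-1 + \sum_i si i + 1)%N.
    by rewrite hE size_mulf ?prodL_neq0 // size_prodL.
  have h1 : (0 < size h)%N by rewrite size_poly_gt0.
  by move: e h1 sf; move: (size h) (size f) => x1 x2; lia.
Qed.

End Ranks.

(** * The recursion for the multiplicities *)

Section Recursion.
Variables (k : closedFieldType) (L : 'I_3 -> {poly k}).
Hypothesis size_L : forall i, size (L i) = 2.
Hypothesis coprime_L : forall i j, i != j -> coprimep (L i) (L j).
Local Notation n1 := (n1 L).
Local Notation n0 := (n0 L).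
Local Notation s N a := (\rank (syz_space L N a)).

Lemma koszul_dim_le N M a : (N + M = \sum_i a i)%N -> (koszul_dim N a <= s N a)%N.
Proof.
move=> NM; have := rank_syz_dual size_L coprime_L NM.
have := rank_syz_space size_L M a.
have : (rank_sum L M a <= M)%N by apply: rank_leq_row.
rewrite (koszul_dim_dual NM).
by move: NM; rewrite !sumn3; lia.
Qed.

Lemma n1E N M a : (N + M = \sum_i a i)%N -> (n1 N a + \sum_i (a i - M) = s N a)%N.
Proof. by move=> NM; rewrite -(koszul_dim_dual NM) /n1 subnK // (koszul_dim_le NM). Qed.

Variables (p r : nat).
Hypothesis pchar_k : p \in [pchar k].
Local Notation q := (p ^ r)%N.
Variables (t d e : nat) (u v : 'I_3 -> nat).
Hypothesis tp : (0 < t < p)%N.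
Hypothesis dq : (d < q)%N.
Hypothesis eq : (e.+1 < q)%N.
Hypothesis vq : forall i, (v i < q)%N.
Hypothesis weight : (q * (\sum_i u i) + \sum_i v i + 1 = q * t + d + (q * t + e))%N.

(** Exponents in the truncated Schur function are below 2q, so they split as q b + v with carries
    b_i in {0, 1}. The test says that x^(u - b) is a normalised monomial of the dual of h_(t - 1),
    and the value is the linear coefficient from [box_count_linear], where q b_i + v_i - (q - 1)
    truncates to b_i (v_i + 1). *)
Definition second_term (b0 b1 b2 : nat) : nat :=
  if [&& (\sum_i u i + 2 == 2 * t + (b0 + b1 + b2))%N, (b0 <= u i0 < t + b0)%N,
         (b1 <= u i1 < t + b1)%N & (b2 <= u i2 < t + b2)%N]
  then (d.+1 - (b0 * (v i0).+1 + b1 * (v i1).+1 + b2 * (v i2).+1))%N else 0%N.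

Definition second_sum : nat :=
  (second_term 0 0 0 + second_term 0 0 1 + second_term 0 1 0 + second_term 0 1 1 +
   second_term 1 0 0 + second_term 1 0 1 + second_term 1 1 0 + second_term 1 1 1)%N.

Definition first_term : nat :=
  if (\sum_i u i == 2 * t)%N && [&& u i0 <= t, u i1 <= t & u i2 <= t]%N
  then n1 d.+1 (fun i : 'I_3 => (v i).+1) else 0%N.

(** The test says that u - (1, 1, 1) has sum 2(t - 2) and entries at most t - 2, that is, it is a
    normalised exponent of the dual of h_(t - 2). *)
Definition third_term : nat :=
  if ((\sum_i u i).+1 == 2 * t)%N && [&& u i0 < t, u i1 < t & u i2 < t]%N
  then n0 (q - 1 - d) (fun i : 'I_3 => q - 1 - v i)%N else 0%N.

Local Notation N := (q * t + d).+1.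
Local Notation M := (q * t + e).+1.
Local Notation a := (fun i : 'I_3 => q * u i + (v i).+1)%N.

Lemma weight_NM : (N + M = \sum_i a i)%N.
Proof. by move: weight; rewrite !sumn3; lia. Qed.

Lemma small_exponent i : (u i < t)%N -> (q * u i + q <= q * t)%N.
Proof. by move=> h; rewrite addnC -mulnS leq_mul2l h orbT. Qed.

(** Because v_i, d and e + 1 are below q, the weight equation leaves only the sums 2t - 2, 2t - 1,
    2t and 2t + 1 for u, which are the four cases of the recursion. *)
Lemma sum_u_range : exists j, (j <= 3)%N /\ (\sum_i u i + 2 = 2 * t + j)%N.
Proof.
have := vq i0; have := vq i1; have := vq i2; move: weight; rewrite (sumn3 v).
set U := (\sum_i u i)%N => w v2 v1 v0.
have h1 : (q * (2 * t) < q * (U + 3))%N by rewrite mulnDr; lia.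
have h2 : (q * U < q * (2 * t + 2))%N by rewrite mulnDr; lia.
move: h1 h2; rewrite !ltn_mul2l => /andP [_ h1] /andP [_ h2].
by exists (U + 2 - 2 * t)%N; lia.
Qed.

Lemma n1_recursion_large i : (t < u i)%N -> n1 N a = (first_term + second_sum + third_term)%N.
Proof.
move=> tu; have -> : n1 N a = 0%N.
  apply: (n1_big size_L coprime_L weight_NM (i := i)).
  have : (q * t + q <= q * u i)%N by rewrite addnC -mulnS leq_mul2l tu orbT.
  by lia.
have tu3 : [|| t < u i0, t < u i1 | t < u i2]%N.
  by move: i tu; elim/ord3P => ->; rewrite ?orbT.
have s0 b0 b1 b2 : (b0 <= 1)%N -> (b1 <= 1)%N -> (b2 <= 1)%N ->
    second_term b0 b1 b2 = 0%N.
  by move=> *; rewrite /second_term; case: ifP => // /and4P [_]; lia.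
have -> : first_term = 0%N by rewrite /first_term; case: ifP => // /and4P []; lia.
have -> : third_term = 0%N by rewrite /third_term; case: ifP => // /and4P []; lia.
by rewrite /second_sum !s0.
Qed.

Lemma second_term0 b0 b1 b2 :
  (\sum_i u i + 2 != 2 * t + (b0 + b1 + b2))%N -> second_term b0 b1 b2 = 0%N.
Proof. by rewrite /second_term => /negbTE ->. Qed.

(** Translation equates the syzygy ranks for a and for v + 1. The Koszul corrections differ by v_i -
    e exactly at the indices with u_i < t, and these differences are the second terms with two
    carries. *)
Lemma n1_recursion_even : (\sum_i u i = 2 * t)%N -> (forall i, (u i <= t)%N) ->
  n1 N a = (first_term + second_sum + third_term)%N.
Proof.
move=> su ut; have u0 := ut i0; have u1 := ut i1; have u2 := ut i2.
have sv : (\sum_i v i + 1 = d + e)%N by move: weight; rewrite su; lia.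
have NM' : (d.+1 + e.+1 = \sum_i (v i).+1)%N by move: sv; rewrite !sumn3; lia.
have e1 := n1E weight_NM.
have e2 : (n1 d.+1 (fun i : 'I_3 => (v i).+1) + \sum_i ((v i).+1 - e.+1) =
  s d.+1 (fun i : 'I_3 => (v i).+1))%N := n1E NM'.
have ss : s N a = s d.+1 (fun i : 'I_3 => (v i).+1).
  have [al [be [G [H [_ b]]]]] := syz_basis_exists size_L (fun i => (v i).+1).
  have [G' [H' b']] := syz_basis_translate size_L coprime_L pchar_k su ut (proj2 (andP tp)) vq b.
  by rewrite !(rank_syz_space_basis size_L coprime_L _ b)
    (rank_syz_space_basis size_L coprime_L _ b'); lia.
have -> : third_term = 0%N by rewrite /third_term; case: ifP => // /andP []; lia.
have -> : first_term = n1 d.+1 (fun i : 'I_3 => (v i).+1) by rewrite /first_term su eqxx !ut.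
rewrite /second_sum !(@second_term0 0 0 _) ?(@second_term0 0 1 0) ?(@second_term0 1 0 0)
  ?(@second_term0 1 1 1) ?su; try lia.
have s0 : second_term 0 1 1 = if (u i0 < t)%N then (v i0 - e)%N else 0%N.
  rewrite /second_term su !addn0; case: (ltnP (u i0)) => h0; last by case: ifP; lia.
  rewrite ifT; last by move: su; rewrite sumn3; lia.
  by move: sv; rewrite sumn3; lia.
have s1 : second_term 1 0 1 = if (u i1 < t)%N then (v i1 - e)%N else 0%N.
  rewrite /second_term su !addn0; case: (ltnP (u i1)) => h0; last by case: ifP; lia.
  rewrite ifT; last by move: su; rewrite sumn3; lia.
  by move: sv; rewrite sumn3; lia.
have s2 : second_term 1 1 0 = if (u i2 < t)%N then (v i2 - e)%N else 0%N.
  rewrite /second_term su !addn0; case: (ltnP (u i2)) => h0; last by case: ifP; lia.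
  rewrite ifT; last by move: su; rewrite sumn3; lia.
  by move: sv; rewrite sumn3; lia.
rewrite s0 s1 s2.
have h i : (a i - M + (if u i < t then v i - e else 0) = (v i).+1 - e.+1)%N.
  have ui := ut i; have vi := vq i; have [lt|ge] := ltnP (u i) t; last first.
    have -> : u i = t by apply/eqP; rewrite eqn_leq ui.
    by lia.
  by have := small_exponent lt; lia.
rewrite ss sumn3 in e1; rewrite sumn3 in e2; move: e1 e2 (h i0) (h i1) (h i2).
by move: (if _ then _ else _) (if _ then _ else _) (if _ then _ else _) => x y z; lia.
Qed.

Lemma n1_recursion_split i j l : uniq [:: i; j; l] -> u i = t -> (u j + u l < t)%N ->
  (n1 N a + (a i - M) = N - a i + (N - (a j + a l)))%N.
Proof.
move=> uq ut ujl; have := n1E weight_NM.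
rewrite (rank_syz_split size_L coprime_L pchar_k N uq ut ujl vq).
rewrite (@big3 _ _ _ _ i j l uq) /=.
have uj : (u j < t)%N by lia. have ul : (u l < t)%N by lia.
by have := small_exponent uj; have := small_exponent ul; have := vq j; have := vq l; lia.
Qed.

(** Reflection equates the rank with one for q - 1 - v in size q - 1 - e; [rank_syz_dual] moves it
    to size q - 1 - d, where [n0] is taken. What is left over are the numbers d - v_i, the second
    terms with one carry. *)
Lemma n1_recursion_odd_small : ((\sum_i u i).+1 = 2 * t)%N -> (forall i, (u i < t)%N) ->
  n1 N a = (first_term + second_sum + third_term)%N.
Proof.
move=> su ut; have u0 := ut i0; have u1 := ut i1; have u2 := ut i2.
have sv : (\sum_i v i + 1 = q + d + e)%N.
  have : (q * (\sum_i u i) + q = q * t + q * t)%N by rewrite addnC -mulnS su mul2n -addnn mulnDr.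
  by move: weight; lia.
pose si i := (q - 1 - v i)%N.
have siE i : si i = (q - (v i).+1)%N by rewrite /si; lia.
have siq i : (si i <= q)%N by rewrite /si; lia.
have NM' : (q - 1 - d + (q - 1 - e) = \sum_i si i)%N.
  by move: sv (vq i0) (vq i1) (vq i2); rewrite !sumn3 /si; lia.
have ss : s N a = s (q - 1 - e) si.
  have [al [be [G [H [_ b]]]]] := syz_basis_exists size_L si.
  have [al' [be' [G' [H' [ea eb b']]]]] :=
    syz_basis_reflect size_L coprime_L pchar_k su ut (proj2 (andP tp)) siq b.
  have -> : a = (fun i => q * (u i).+1 - si i)%N.
    by apply: funext => i; rewrite /si mulnS; have := vq i; lia.
  rewrite (rank_syz_space_basis size_L coprime_L _ b) (rank_syz_space_basis size_L coprime_L _ b').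
  rewrite -NM' mulnS in ea eb; lia.
have e1 := n1E weight_NM; have e2 := rank_syz_dual size_L coprime_L NM'.
have e3 := rank_syz_space size_L (q - 1 - d) si.
have e4 : (rank_sum L (q - 1 - d) si <= q - 1 - d)%N by apply: rank_leq_row.
have -> : third_term = n0 (q - 1 - d) si by rewrite /third_term su eqxx !ut.
have -> : first_term = 0%N by rewrite /first_term; case: ifP => // /andP []; lia.
have z i : (a i - M = 0)%N by have := small_exponent (ut i); have := vq i; lia.
rewrite /second_sum (@second_term0 0 0 0) ?(@second_term0 0 1 1) ?(@second_term0 1 0 1)
  ?(@second_term0 1 1 _); try lia.
have s0 : second_term 0 0 1 = (d - v i2)%N.
  rewrite /second_term.
  have -> : [&& (\sum_i u i + 2 == 2 * t + (0 + 0 + 1))%N, (0 <= u i0 < t + 0)%N,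
    (0 <= u i1 < t + 0)%N & (0 < u i2 < t + 1)%N] by move: su; rewrite sumn3; lia.
  by lia.
have s1 : second_term 0 1 0 = (d - v i1)%N.
  rewrite /second_term.
  have -> : [&& (\sum_i u i + 2 == 2 * t + (0 + 1 + 0))%N, (0 <= u i0 < t + 0)%N,
    (0 < u i1 < t + 1)%N & (0 <= u i2 < t + 0)%N] by move: su; rewrite sumn3; lia.
  by lia.
have s2 : second_term 1 0 0 = (d - v i0)%N.
  rewrite /second_term.
  have -> : [&& (\sum_i u i + 2 == 2 * t + (1 + 0 + 0))%N, (0 < u i0 < t + 1)%N,
    (0 <= u i1 < t + 0)%N & (0 <= u i2 < t + 0)%N] by move: su; rewrite sumn3; lia.
  by lia.
rewrite s0 s1 s2 /n0; rewrite big1 ?addn0 in e1; last by move=> i _; apply: z.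
rewrite ss in e1; rewrite e1; move: e2 e3 e4 sv.
have h i : (q - 1 - d - si i + d = v i + (d - v i))%N by rewrite /si; have := vq i; lia.
rewrite !sumn3; move: (h i0) (h i1) (h i2) dq eq.
move: (_ - si i0)%N (_ - si i1)%N (_ - si i2)%N (d - v i0)%N (d - v i1)%N (d - v i2)%N.
by move=> *; lia.
Qed.

Lemma n1_recursion_odd_large i j l : uniq [:: i; j; l] -> ((\sum_i u i).+1 = 2 * t)%N ->
  u i = t -> n1 N a = (d - v i)%N.
Proof.
move=> uq su uit.
have ujl : (u j + u l < t)%N.
  by move: su; rewrite (@big3 _ _ _ _ i j l uq) /= uit; lia.
have := n1_recursion_split uq uit ujl.
have := weight; rewrite !(@big3 _ _ _ _ i j l uq) /= uit.
have : (q * (u j + u l) + q = q * t)%N.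
  rewrite addnC -mulnS; congr (_ * _)%N.
  by move: su; rewrite (@big3 _ _ _ _ i j l uq) /= uit; lia.
by rewrite !mulnDr; lia.
Qed.

Lemma n1_recursion : n1 N a = (first_term + second_sum + third_term)%N.
Proof.
have [i|ut] := pickP (fun i => t < u i)%N; first exact: n1_recursion_large.
have {}ut i : (u i <= t)%N by rewrite leqNgt ut.
have u0 := ut i0; have u1 := ut i1; have u2 := ut i2.
have [j [j3 su]] := sum_u_range.
have tp' := proj2 (andP tp).
case: j j3 su => [|[|[|[|//]]]] _ su.
(* Sum 2t - 2. If all u_i < t, [rank_syz_below] gives d + 1; if some u_i = t, the other two sum to t
   - 2 and all syzygies are Koszul. *)
- have sv : (\sum_i v i + 1 = 2 * q + d + e)%N.
    have : (q * (\sum_i u i) + 2 * q = q * t + q * t)%N.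
      by rewrite [(2 * q)%N]mulnC -mulnDr su addn0 mul2n -addnn mulnDr.
    by move: weight; lia.
  have -> : first_term = 0%N by rewrite /first_term; case: ifP => // /andP []; lia.
  have -> : third_term = 0%N by rewrite /third_term; case: ifP => // /andP []; lia.
  rewrite /second_sum !(@second_term0 0 0 1) ?(@second_term0 0 1 _) ?(@second_term0 1 _ _); try lia.
  have [ult|] := boolP [&& u i0 < t, u i1 < t & u i2 < t]%N.
    have ult' i : (u i < t)%N by move: i; elim/ord3P; case/and3P: ult.
    have -> : second_term 0 0 0 = d.+1 by rewrite /second_term su addn0 eqxx !addn0 /= ult.
    have := n1E weight_NM; rewrite big1 => [|i _]; last first.
      by have := small_exponent (ult' i); have := vq i; lia.
    pose si i := (q - (v i).+1)%N.
    have -> : a = (fun i => q * (u i).+1 - si i)%N.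
      by apply: funext => i; rewrite /si mulnS; have := vq i; lia.
    have su' : (\sum_i u i + 2 = 2 * t)%N by rewrite su addn0.
    rewrite (rank_syz_below size_L coprime_L pchar_k (r := r) su' ult' tp'); first lia.
      by move=> i; rewrite leq_subr.
    by move: sv (vq i0) (vq i1) (vq i2); rewrite !sumn3 /si mulnS; lia.
  have z : second_term 0 0 0 = 0%N -> n1 N a = 0%N -> n1 N a = (0 + second_term 0 0 0 + 0)%N.
    by move=> -> ->.
  move=> nlt; rewrite !addn0 add0n.
  have -> : second_term 0 0 0 = 0%N.
    by rewrite /second_term; case: ifP => //; move: nlt; lia.
  have main x y w : uniq [:: x; y; w] -> u x = t -> n1 N a = 0%N.
    move=> uq ux.
    have uyw : (u y + u w < t)%N.
      by move: su; rewrite (@big3 _ _ _ _ x y w uq) /= ux; lia.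
    have := n1_recursion_split uq ux uyw; have := weight_NM.
    move: sv; rewrite !(@big3 _ _ _ _ x y w uq) /= ux.
    by have := vq x; have := vq y; have := vq w; lia.
  have : [|| u i0 == t, u i1 == t | u i2 == t]%N by move: nlt; lia.
  by case/or3P => /eqP; [apply: (main i0 i1 i2) | apply: (main i1 i0 i2) | apply: (main i2 i0 i1)].
- have su' : ((\sum_i u i).+1 = 2 * t)%N by lia.
  have [ult|nlt] := boolP [&& u i0 < t, u i1 < t & u i2 < t]%N.
    by apply: n1_recursion_odd_small => //; elim/ord3P; case/and3P: ult.
  have -> : first_term = 0%N by rewrite /first_term; case: ifP => // /andP []; lia.
  have -> : third_term = 0%N by rewrite /third_term (negbTE nlt) andbF.
  rewrite /second_sum (@second_term0 0 0 0) ?(@second_term0 0 1 1) ?(@second_term0 1 0 1)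
    ?(@second_term0 1 1 _); try lia.
  have su3 := su'; rewrite sumn3 in su3.
  have : [|| u i0 == t, u i1 == t | u i2 == t]%N by move: nlt; lia.
  case/or3P => /eqP h.
  + rewrite (n1_recursion_odd_large (i := i0) (j := i1) (l := i2) isT su' h) /second_term.
    do 2![rewrite ifF; last by lia]; rewrite ifT; lia.
  + rewrite (n1_recursion_odd_large (i := i1) (j := i0) (l := i2) isT su' h) /second_term.
    rewrite ifF; last by lia.
    by rewrite ifT; last lia; rewrite ifF; lia.
  + rewrite (n1_recursion_odd_large (i := i2) (j := i0) (l := i1) isT su' h) /second_term.
    by rewrite ifT; last lia; do 2![rewrite ifF; last by lia]; lia.
- by apply: n1_recursion_even => //; lia.
(* Sum 2t + 1: only the term with three carries survives, and [rank_syz_above] computes the same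
   linear function. *)
- have su' : (\sum_i u i = (2 * t).+1)%N by lia.
  have sv : (q + \sum_i v i + 1 = d + e)%N.
    by move: weight; rewrite su' mulnS mulnA [(q * 2)%N]mulnC -mulnA mul2n -addnn; lia.
  have -> : first_term = 0%N by rewrite /first_term; case: ifP => // /andP []; lia.
  have -> : third_term = 0%N by rewrite /third_term; case: ifP => // /andP []; lia.
  rewrite /second_sum !(@second_term0 0 _ _) ?(@second_term0 1 0 _) ?(@second_term0 1 1 0); try lia.
  have -> : second_term 1 1 1 = (d.+1 - \sum_i (v i).+1)%N.
    rewrite /second_term ifT; last by move: su'; rewrite sumn3; lia.
    by rewrite sumn3; lia.
  have := n1E weight_NM.
  rewrite (rank_syz_above size_L coprime_L pchar_k su' ut tp' vq); last by rewrite mulnS; lia.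
  rewrite big1 => [|i _]; first lia.
  have := ut i; rewrite leq_eqVlt => /orP [/eqP ->|lt].
    have : (v i <= \sum_i v i)%N by rewrite (bigD1 i) //= leq_addr.
    by lia.
  by have := small_exponent lt; have := vq i; lia.
Qed.

End Recursion.

(** * Weight spaces of the Cech complex *)

Section QuotientDimension.
Variables (k : closedFieldType) (M : lmodType k).
Implicit Types (Z B : set M).

Lemma subspaceN (P : M -> Prop) u : subspace P -> P u -> P (- u).
Proof. by move=> [P0 Pl] Pu; have := Pl (-1) u 0 Pu P0; rewrite scaleN1r addr0. Qed.

Lemma subspaceD (P : M -> Prop) u v : subspace P -> P u -> P v -> P (u + v).
Proof. by move=> [P0 Pl] Pu Pv; have := Pl 1 u v Pu Pv; rewrite scale1r. Qed.

Lemma is_quot_dim_leq Z B m n : subspace Z -> subspace B ->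
  is_quot_dim Z B m -> is_quot_dim Z B n -> (m <= n)%N.
Proof.
move=> sZ sB [b Zb bP] [b' Zb' b'P].
have /choice [c cP] : forall i, exists c : {ffun 'I_n -> k}, B (b i - \sum_j c j *: b' j).
  by move=> i; have [c [Bc _]] := b'P _ (Zb i); exists c.
pose C : 'M_(m, n) := \matrix_(i, j) c i j.
have freeC : row_free C.
  rewrite -kermx_eq0; apply/eqP/row_matrixP => l; rewrite row0.
  have : row l (kermx C) *m C = 0 by rewrite -row_mul mulmx_ker row0.
  move: (row l _) => v vC.
  have Bv : B (\sum_i v 0 i *: b i).
    have -> : \sum_i v 0 i *: b i = \sum_i v 0 i *: (b i - \sum_j c i j *: b' j).
      apply/eqP; rewrite -subr_eq0 -sumrB; apply/eqP.
      rewrite (eq_bigr (fun i => \sum_j (v 0 i * c i j) *: b' j)); last first.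
        move=> i _; rewrite -scalerBr opprB addrC subrK scaler_sumr.
        by apply: eq_bigr => j _; rewrite scalerA.
      rewrite exchange_big big1 //= => j _; rewrite -scaler_suml.
      have := congr1 (fun A : 'M_(_, _) => A 0 j) vC; rewrite !mxE.
      by under eq_bigr do rewrite mxE; move=> ->; rewrite scale0r.
    exact: subspace_sum.
  have [c0 [_ uniq]] := bP 0 (proj1 sZ).
  have h1 : c0 = [ffun=> 0].
    apply: uniq; rewrite sub0r; apply: subspaceN => //.
    by rewrite big1 => [|i _]; [case: sB | rewrite ffunE scale0r].
  have h2 : c0 = [ffun i => v 0 i].
    apply: uniq; rewrite sub0r; apply: subspaceN => //.
    by under eq_bigr do rewrite ffunE.
  apply/rowP => i; rewrite mxE.
  have : ([ffun i => v 0 i] : {ffun 'I_m -> k}) i = [ffun=> 0] i by rewrite -h1 -h2.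
  by rewrite !ffunE.
by rewrite -(eqP freeC) rank_leq_col.
Qed.

Lemma quot_dim_unique Z B n : subspace Z -> subspace B ->
  is_quot_dim Z B n -> quot_dim Z B = n.
Proof.
move=> sZ sB h; rewrite /quot_dim; case: xgetP => [m _ hm|/(_ n) []//].
by apply/eqP; rewrite eqn_leq !(is_quot_dim_leq sZ sB).
Qed.

(** The map [g] induces an isomorphism from Z / B to U / W; lifts of a basis of a complement of W in
    U witness the dimension. *)
Lemma quot_dim_rank Z B n (U W : 'M[k]_n) (g : M -> 'rV_n) :
  subspace Z -> subspace B -> (W <= U)%MS ->
  (forall c u v, g (c *: u + v) = c *: g u + g v) ->
  (forall z, Z z -> (g z <= U)%MS) ->
  (forall u, (u <= U)%MS -> exists2 z, Z z & g z = u) ->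
  (forall z, Z z -> B z <-> (g z <= W)%MS) ->
  quot_dim Z B = (\rank U - \rank W)%N.
Proof.
move=> sZ sB WU gl gU gsurj BW; apply: quot_dim_unique => //.
have rk : \rank (U :\: W)%MS = (\rank U - \rank W)%N.
  have := mxrank_cap_compl U W; have -> : \rank (U :&: W)%MS = \rank W; last lia.
  by apply/eqmx_rank/eqmxP/capmx_idPr.
have g0 : g 0 = 0.
  by have /eqP := gl 1 0 0; rewrite !scale1r addr0 -subr_eq0 opprD addNKr oppr_eq0 => /eqP.
rewrite -rk; set C := row_base (U :\: W)%MS.
have CU i : (row i C <= U)%MS.
  by rewrite (submx_trans (row_sub _ _)) // eq_row_base diffmxSl.
have /choice [b bP] : forall i, exists z, Z z /\ g z = row i C.
  by move=> i; have [z Zz gz] := gsurj _ (CU i); exists z.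
have gsum m (c : 'I_m -> k) (z : 'I_m -> M) : g (\sum_i c i *: z i) = \sum_i c i *: g (z i).
  by elim/big_rec2: _ => [|i x y _ <-]; rewrite ?g0 ?gl.
exists b => [i|z Zz]; first by case: (bP i).
have gc (c : {ffun _ -> k}) : g (\sum_i c i *: b i) = (\row_i c i) *m C.
  rewrite gsum mulmx_sum_row; apply: eq_bigr => i _; rewrite mxE.
  by case: (bP i) => _ ->.
have Bc (c : {ffun 'I_(\rank (U :\: W)%MS) -> k}) :
    B (z - \sum_i c i *: b i) <-> (g z - (\row_i c i) *m C <= W)%MS.
  have -> : g z - (\row_i c i) *m C = g (z - \sum_i c i *: b i).
    by rewrite -gc -scaleN1r [z + _]addrC gl addrC scaleN1r.
  apply: BW; apply: subspaceD => //; apply: subspaceN => //.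
  by apply: subspace_sum => // i; case: (bP i).
have : (g z <= U :\: W + U :&: W)%MS by rewrite addsmx_diff_cap_eq gU.
move=> /sub_addsmxP [[x y] /= gzE].
have /submxP [c cE] : (x *m (U :\: W)%MS <= C)%MS by rewrite eq_row_base submxMl.
have yW : (y *m (U :&: W)%MS <= W)%MS by rewrite (submx_trans (submxMl _ _)) ?capmxSr.
exists [ffun i => c 0 i]; split.
  apply/Bc; have -> : \row_i [ffun i => c 0 i] i = c by apply/rowP => i; rewrite !mxE ffunE.
  by rewrite gzE cE addrC addKr.
move=> c' /Bc h; apply/ffunP => i; rewrite ffunE.
suff -> : c = \row_i c' i by rewrite mxE.
apply: (row_free_inj (row_base_free _)); apply/eqP; rewrite -subr_eq0 -submx0.
rewrite -(capmx_diff U W) sub_capmx; apply/andP; split.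
  by rewrite -mulmxBl (submx_trans (submxMl _ _)) ?eq_row_base.
have -> : c *m C - (\row_i c' i) *m C = (g z - (\row_i c' i) *m C) - y *m (U :&: W)%MS.
  by rewrite gzE cE addrAC addrK.
by rewrite addmx_sub // eqmx_opp.
Qed.

End QuotientDimension.

(** * Functionals on binary forms *)

Section Functionals.
Variables (k : closedFieldType) (L : 'I_3 -> {poly k}).
Hypothesis size_L : forall i, size (L i) = 2.
Hypothesis sum_L : \sum_i L i = 0.
Hypothesis coprime_L : forall i j, i != j -> coprimep (L i) (L j).

(** Subtracting a multiple of L_j^(n + 1) makes [h] vanish at the root of L_i; the quotient by L_i
    has lower degree. *)
Lemma span_monomials i j n (h : {poly k}) : i != j -> (size h <= n.+1)%N ->
  exists c : 'I_n.+1 -> k, h = \sum_(x < n.+1) c x *: (L i ^+ x * L j ^+ (n - x)).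
Proof.
move=> ij; elim: n h => [|n IHn] h sh.
  exists (fun=> h`_0); rewrite big_ord_recl big_ord0 addr0 mulr1.
  by rewrite {1}(size1_polyC sh) -alg_polyC.
have Lj0 : (L j).[rt L i] != 0.
  have : coprimep (L j) (L i) by rewrite coprime_L // eq_sym.
  by rewrite [L i](LE size_L) coprimepZr ?L_coef1 // coprimep_XsubC.
pose ka := h.[rt L i] / ((L j).[rt L i] ^+ n.+1).
have : L i %| h - ka *: L j ^+ n.+1.
  rewrite dvd_L //; apply/eqP; rewrite hornerD hornerN hornerZ horner_exp /ka.
  by rewrite divfK ?expf_neq0 // subrr.
move=> /dvdpP [h' h'E].
have [|c cE] := IHn h'.
  have [->|h'0] := eqVneq h' 0; first by rewrite size_poly0.
  have e : size (h - ka *: L j ^+ n.+1) = ((size h').-1 + 1 + 1)%N.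
    rewrite h'E size_mulf //; last exact: L_neq0.
    by rewrite (size_L i).
  have e' : (size (h - ka *: L j ^+ n.+1)%R <= n.+2)%N.
    rewrite (leq_trans (size_polyD _ _)) // geq_max sh size_polyN.
    by rewrite (leq_trans (size_scale_leq _ _)) // size_L_exp.
  by move: e e'; move: (size h') (size _) => x y; lia.
exists (fun x => if unlift ord0 x is Some y then c y else ka).
rewrite -[h](subrK (ka *: L j ^+ n.+1)) h'E big_ord_recl unlift_none /= mul1r subn0 addrC.
congr (_ + _); rewrite cE mulr_suml; apply: eq_bigr => x _.
by rewrite liftK /= -scalerAl mulrAC -exprSr subSS.
Qed.

Variable d : nat.
Local Notation N := d.+1.
Local Notation expo := (fun i : 'I_N =>
  [multinom (if j == i0 then i : nat else if j == i1 then d - i else 0)%N | j < 3]).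

Definition monomial_matrix : 'M[k]_N := \matrix_i poly_rV (L i0 ^+ i * L i1 ^+ (d - i)).

Lemma monomial_size (i : 'I_N) : (size (L i0 ^+ i * L i1 ^+ (d - i))%R <= N)%N.
Proof. by rewrite size_mulf ?expf_neq0 ?L_neq0 // !size_L_exp //=; have := ltn_ord i; lia. Qed.

Lemma monomial_matrix_unit : monomial_matrix \in unitmx.
Proof.
rewrite -row_full_unit -sub1mx; apply/rV_subP => v _.
have [c cE] := @span_monomials i0 i1 d (rVpoly v) isT (size_rVpoly v).
have -> : v = (\row_i c i) *m monomial_matrix.
  apply: (can_inj rVpolyK); rewrite cE mulmx_sum_row linear_sum; apply: eq_bigr => i _.
  by rewrite linearZ /= rowK poly_rV_K ?monomial_size // mxE.
exact: submxMl.
Qed.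

(** The functional with prescribed values on the basis L_0^i L_1^(d - i), that is on the y^a without
    the third variable; the inverse matrix converts these values to the coefficient basis. *)
Definition functional (f : 'X_{1..3} -> k) : 'rV[k]_N :=
  (\row_i f (expo i)) *m invmx monomial_matrix^T.

Lemma functional_linear c f g :
  functional (fun a => c * f a + g a) = c *: functional f + functional g.
Proof.
rewrite /functional scalemxAl -mulmxDl; congr (_ *m _).
by apply/rowP => i; rewrite !mxE.
Qed.

Lemma pairing_functional0 f (i : 'I_N) :
  pairing (functional f) (L i0 ^+ i * L i1 ^+ (d - i)) = f (expo i).
Proof.
have e : functional f *m monomial_matrix^T = \row_i f (expo i).
  by rewrite /functional mulmxKV // unitmx_tr monomial_matrix_unit.
have := congr1 (fun A : 'rV_N => A 0 i) e; rewrite [RHS]mxE => <-.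
rewrite mxE /pairing; apply: eq_bigr => j _; rewrite !mxE.
by rewrite coef_poly_rV || rewrite -[in LHS](poly_rV_K (monomial_size i)) coef_rVpoly_ord mxE.
Qed.

(** The relations satisfied by [f] mirror L_0 + L_1 + L_2 = 0, so induction on the third exponent
    eliminates the third variable on both sides in the same way. *)
Lemma pairing_functional f a : mdeg a = d ->
  (forall b, (mdeg b).+1 = d -> \sum_i f (b + U_(i))%MM = 0) ->
  f a = pairing (functional f) (prodL L a).
Proof.
move=> ad rel.
have [n an] : exists n, a i2 = n by exists (a i2).
elim: n a an ad => [|n IHn] a an ad.
  have da : (a i0 + a i1 = d)%N by rewrite -ad mdegE sumn3 an addn0.
  have a0 : (a i0 < N)%N by rewrite ltnS -da leq_addr.
  have -> : prodL L a = L i0 ^+ Ordinal a0 * L i1 ^+ (d - Ordinal a0).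
    rewrite /prodL (@big3 _ _ _ _ i0 i1 i2) //= an expr0 mulr1.
    by rewrite -da addKn.
  rewrite pairing_functional0; congr f; apply/mnmP; elim/ord3P; rewrite mnmE //=.
  by rewrite -da addKn.
have [b bE] : exists b, a = (b + U_(i2))%MM.
  exists (a - U_(i2))%MM; rewrite submK //; apply/mnm_lepP => i; rewrite mnm1E.
  by case: eqP => // <-; rewrite an.
have bd : (mdeg b).+1 = d by rewrite -ad bE mdegD mdeg1 addn1.
have bn : b i2 = n by move: an; rewrite bE mnmDE mnm1E eqxx addn1 => -[].
have := rel b bd; rewrite sum3 /= -bE addrA addrC => /eqP; rewrite addr_eq0 => /eqP ->.
have step i : i != i2 -> f (b + U_(i))%MM = pairing (functional f) (prodL L (b + U_(i))%MM).
  move=> ii2; apply: IHn; last by rewrite mdegD mdeg1 addn1.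
  by rewrite mnmDE mnm1E (negbTE ii2) addn0.
have prodLU i : prodL L (b + U_(i))%MM = L i * prodL L b.
  rewrite -prodL_inc; congr prodL; apply: funext => j.
  by rewrite mnmDE mnm1E /inc eq_sym.
rewrite !step // -linearD -linearN /= bE !prodLU; congr pairing.
by rewrite (sum3_eq0 sum_L); ring.
Qed.

Lemma functional_pairing (r : 'rV[k]_N) (f : 'X_{1..3} -> k) :
  (forall a, mdeg a = d -> f a = pairing r (prodL L a)) -> functional f = r.
Proof.
move=> h; rewrite /functional.
have -> : \row_i f (expo i) = r *m monomial_matrix^T.
  apply/rowP => i; rewrite !mxE h; last first.
    by rewrite mdegE sumn3 !mnmE /=; have := ltn_ord i; lia.
  have -> : prodL L (expo i) = L i0 ^+ i * L i1 ^+ (d - i).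
    by rewrite /prodL (@big3 _ _ _ _ i0 i1 i2) //= !mnmE /= mulr1.
  rewrite /pairing; apply: eq_bigr => j _; rewrite !mxE.
  by rewrite -[in LHS](poly_rV_K (monomial_size i)) coef_rVpoly_ord mxE.
by rewrite mulmxK // unitmx_tr monomial_matrix_unit.
Qed.

(** By [span_monomials] in the two forms other than L_l, the multiples of L_l^(m l) of degree at
    most [d] are spanned by products [prodL a]. *)
Lemma mem_orth_powerspace (r : 'rV[k]_N) (m : 'I_3 -> nat) l :
  (r <= orth (powerspace L N m l))%MS <->
  (forall a : 'X_{1..3}, mdeg a = d -> (m l <= a l)%N -> pairing r (prodL L a) = 0).
Proof.
split=> [/mem_orth h a ad ma|h].
  have sa : (size (prodL L a) <= N)%N by rewrite size_prodL // -mdegE ad.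
  rewrite -(poly_rV_K sa); apply/mulmx_tr_eq0/h/mem_multiples; rewrite poly_rV_K //.
  by rewrite /prodL (bigD1 l) //= dvdp_mulr // dvdp_exp2l.
apply/mem_orth => v /mem_multiples /dvdpP [g gE]; apply/mulmx_tr_eq0.
have [g0|g0] := eqVneq g 0; first by rewrite gE g0 mul0r linear0.
have sz : size (rVpoly v) = ((size g).-1 + m l + 1)%N.
  rewrite gE size_mulf //; last by rewrite expf_neq0 ?L_neq0.
  by rewrite (size_L_exp size_L l (m l)).
have vN : (size (rVpoly v) <= N)%N := size_rVpoly v.
have [i li] : exists i, l != i by have [->|h'] := eqVneq l i0; [exists i1 | exists i0].
have [j uq] := third_index li; have := uq; rewrite uniq3 => /and3P [_ lj ij].
have sg : (size g <= (d - m l).+1)%N by move: sz vN; move: (size g) (size _); lia.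
have md : (m l <= d)%N by move: sz vN; move: (size g) (size _); lia.
have [c cE] := span_monomials ij sg.
rewrite gE cE mulr_suml linear_sum big1 //= => x _.
rewrite -scalerAl linearZ /=.
pose a := [multinom (if y == l then m l else if y == i then x : nat else d - m l - x)%N | y < 3].
have -> : L i ^+ x * L j ^+ (d - m l - x) * L l ^+ m l = prodL L a.
  rewrite /prodL (@big3 _ _ _ _ l i j uq) /= !mnmE !eqxx (eq_sym i) (negbTE li).
  by rewrite (eq_sym j) (negbTE lj) (eq_sym j) (negbTE ij) mulrC.
have al : (m l <= a l)%N by rewrite /a mnmE eqxx.
have ad : mdeg a = d.
  rewrite mdegE (@big3 _ _ _ _ l i j uq) /= /a !mnmE !eqxx (eq_sym i) (negbTE li).
  rewrite (eq_sym j) (negbTE lj) (eq_sym j) (negbTE ij).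
  by have := ltn_ord x; lia.
by rewrite (h a ad al) scaler0.
Qed.

End Functionals.

(** * Weights and torus characters *)

Definition weight := {ffun 'I_3 -> int}.

Definition wt (a : 'X_{1..3}) (u : weight) : weight := [ffun i => (a i)%:Z + u i].
Definition unwt (om : weight) (a : 'X_{1..3}) : weight := [ffun i => om i - (a i)%:Z].

Lemma wtK a : cancel (wt a) (unwt^~ a).
Proof. by move=> u; apply/ffunP => i; rewrite !ffunE addrC addKr. Qed.

Lemma unwtK a : cancel (unwt^~ a) (wt a).
Proof. by move=> u; apply/ffunP => i; rewrite !ffunE addrC subrK. Qed.

Lemma sum_wt a u : \sum_i wt a u i = (mdeg a)%:Z + \sum_i u i.
Proof.
by rewrite mdegE sumn3 !sum3 !ffunE !PoszD; ring.
Qed.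

Lemma wt_shift b i (v : weight) :
  wt (b + U_(i))%MM (v - [ffun j => (j == i)%:R]) = wt b v.
Proof.
apply/ffunP => j; rewrite !ffunE mnmDE mnm1E (eq_sym i) PoszD natz.
by move: (Posz (b j)) (Posz (j == i)) (v j) => x y z; ring.
Qed.

(* The number of values 0, ..., om i that the exponent of y_i may take. *)
Definition bound (om : weight) i : nat := if om i is Posz n then n.+1 else 0.

Lemma bound_leq om i n : (bound om i <= n)%N = (om i < n%:Z).
Proof. by rewrite /bound; case: (om i). Qed.

Section Torus.
Variable k : closedFieldType.

Lemma exists_power_neq1 (n : nat) : (0 < n)%N -> exists2 s : k, s != 0 & s ^+ n != 1.
Proof.
(* A root s satisfies s (s^n - 1) = -1, which excludes both s = 0 and s^n = 1. *)
move=> n0; pose P : {poly k} := 'X * ('X^n - 1) + 1.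
have sP : size P != 1%N.
  have s1 : size ('X^n - 1 : {poly k}) = n.+1 by rewrite -polyC1 size_XnsubC.
  have s2 : size ('X * ('X^n - 1) : {poly k}) = n.+2.
    by rewrite mulrC size_mulX ?s1 // -size_poly_eq0 s1.
  by rewrite /P size_polyDl s2 // size_poly1.
have /closed_rootP [s] := sP; rewrite /root /P !hornerE => /eqP h.
exists s; apply: contraTneq isT => e; move/eqP: h.
  by rewrite e mul0r add0r oner_eq0.
by rewrite e subrr mulr0 add0r oner_eq0.
Qed.

Lemma torus_separates (om : weight) i j : om i != om j ->
  exists2 t : 'I_3 -> k, torus t & \prod_l t l ^ om l != 1.
Proof.
move=> omij; have ij : i != j by apply: contraNneq omij => ->.
have n0 : (0 < `|om i - om j|)%N by rewrite absz_gt0 subr_eq0.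
have [s s0 sn] := exists_power_neq1 n0.
exists (fun l => if l == i then s else if l == j then s^-1 else 1).
  have [l uq] := third_index ij; have := uq; rewrite uniq3 => /and3P [_ il jl].
  rewrite /torus (@big3 _ _ _ _ i j l uq) /= eqxx (eq_sym j) (negbTE ij) eqxx.
  by rewrite (eq_sym l) (negbTE il) (eq_sym l) (negbTE jl) mulr1 divff.
have [l uq] := third_index ij; have := uq; rewrite uniq3 => /and3P [_ il jl].
rewrite (@big3 _ _ _ _ i j l uq) /= eqxx (eq_sym j) (negbTE ij) eqxx.
rewrite (eq_sym l) (negbTE il) (eq_sym l) (negbTE jl) exp1rz mulr1.
rewrite exprz_inv -expfzDr //; apply: contraNneq sn.
case: (om i - om j) => m /= e; apply/eqP; first exact: e.
by rewrite -[_ ^+ _]invrK; apply: (canLR (@invrK _)); rewrite invr1; exact: e.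
Qed.

Lemma torus_neq0 (t : 'I_3 -> k) i : torus t -> t i != 0.
Proof.
move=> h; apply: contraTneq isT => ti; move/eqP: h.
by rewrite (bigD1 i) //= ti mul0r eq_sym oner_eq0.
Qed.

Lemma torus_shift (t : 'I_3 -> k) (om om' : weight) c : torus t ->
  (forall i, om' i = om i + c) -> \prod_i t i ^ om' i = \prod_i t i ^ om i.
Proof.
move=> ht h; under eq_bigr => i _ do rewrite h expfzDr ?torus_neq0 //.
rewrite big_split /=; have -> : \prod_i t i ^ c = (\prod_i t i) ^ c.
  by rewrite !(@big3 _ _ _ _ i0 i1 i2) //= !expfzMl.
by rewrite ht exp1rz mulr1.
Qed.

End Torus.

Section SectionSpaces.
Variables (k : closedFieldType) (d m : int).
Implicit Types (phi : DR_cochain k) (I : {set 'I_3}).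
Local Notation sections := (@DR_sections k d m).

Lemma sum_cochain (F : 'I_3 -> laurent k) v : (\sum_i F i) v = \sum_i F i v.
Proof. by rewrite !sum3. Qed.

Lemma sections_rel I phi b v : sections I phi ->
  \sum_i phi (b + U_(i))%MM (v - [ffun j => (j == i)%:R]) = 0.
Proof.
move=> [_ _ /(_ b) /(congr1 (fun f : laurent k => f v))].
by rewrite sum_cochain.
Qed.

Lemma sections_subspace I : subspace (sections I).
Proof.
split=> [|c f g sf sg].
  split=> // [a|b].
    by split=> [|u]; rewrite ?eqxx //;
      apply: (sub_finite_set _ (finite_set0 _)) => u /=; rewrite eqxx.
  by apply: funext => v; rewrite sum_cochain big1.
have [f1 f2 f3] := sf; have [g1 g2 g3] := sg; split=> [a ad|a|b].
- apply: funext => u; have -> : (c *: f + g) a u = c * f a u + g a u by [].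
  have -> : f a u = 0 by rewrite f1.
  have -> : g a u = 0 by rewrite g1.
  by rewrite mulr0 addr0.
- have [finf hf] := f2 a; have [fing hg] := g2 a.
  have key u : (c *: f + g) a u = c * f a u + g a u by [].
  have or u : (c *: f + g) a u != 0 -> f a u != 0 \/ g a u != 0.
    rewrite key; have [->|] := eqVneq (f a u) 0; last by left.
    by rewrite mulr0 add0r; right.
  split=> [|u /or [/hf|/hg] //].
  apply: (sub_finite_set (B := [set u | f a u != 0] `|` [set u | g a u != 0])%classic).
    by move=> u /= /or.
  by rewrite finite_setU.
- apply: funext => v; rewrite sum_cochain.
  have -> : \sum_i mulx i ((c *: f + g) (b + U_(i))%MM) v =
      c * \sum_i f (b + U_(i))%MM (v - [ffun j => (j == i)%:R]) +
      \sum_i g (b + U_(i))%MM (v - [ffun j => (j == i)%:R]).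
    by rewrite mulr_sumr -big_split.
  by rewrite (sections_rel _ _ sf) (sections_rel _ _ sg) mulr0 addr0.
Qed.

End SectionSpaces.

(** * Sections of a given weight *)

Section Sections.
Variables (k : closedFieldType) (L : 'I_3 -> {poly k}).
Hypothesis size_L : forall i, size (L i) = 2.
Hypothesis sum_L : \sum_i L i = 0.
Hypothesis coprime_L : forall i j, i != j -> coprimep (L i) (L j).
Variables (d : nat) (m : int).
Local Notation N := d.+1.
Implicit Types (phi psi : DR_cochain k) (om : weight) (I : {set 'I_3}).
Local Notation sections := (@DR_sections k d m).

(** Multiplication by a scalar depending only on the weight. It preserves sections, since the
    relations are homogeneous, and it covers both the torus action ([actE]) and the projection to
    one weight ([proj]). *)
Definition scale (th : weight -> k) phi : DR_cochain k :=
  fun a u => th (wt a u) * phi a u.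

Lemma sections_deg I phi a u : sections I phi -> phi a u != 0 -> mdeg a = d.
Proof.
move=> [h _ _]; apply: contraNeq => ad; rewrite h //.
Qed.

Lemma sections_wt I phi a u : sections I phi -> phi a u != 0 ->
  \sum_i wt a u i = d%:Z + m.
Proof.
move=> s pn0; rewrite sum_wt (sections_deg s pn0); case: s => _ /(_ a) [_ h] _.
by rewrite (proj1 (h _ pn0)).
Qed.

Lemma sections_scale I th phi : sections I phi -> sections I (scale th phi).
Proof.
move=> s; have [h1 h2 h3] := s; split=> [a ad|a|b].
- by apply: funext => u; rewrite /scale h1 // mulr0.
- have [fin h] := h2 a; split=> [|u].
    by apply: sub_finite_set fin => u /=; apply: contraNN => /eqP e; rewrite /scale e mulr0.
  by rewrite /scale mulf_eq0 negb_or => /andP [_]; apply: h.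
- apply: funext => v; rewrite sum_cochain /mulx /scale.
  under eq_bigr do rewrite wt_shift.
  by rewrite -mulr_sumr (sections_rel _ _ s) mulr0.
Qed.

Lemma sections_mono I phi a u i : sections I phi -> phi a u != 0 -> i \notin I -> 0 <= u i.
Proof. by move=> [_ /(_ a) [_ h] _] /h [_]; apply. Qed.

Definition comp om phi : 'rV[k]_N := functional L d (fun a => phi a (unwt om a)).

Lemma comp_linear om c phi psi : comp om (c *: phi + psi) = c *: comp om phi + comp om psi.
Proof. exact: functional_linear. Qed.

Lemma sections_comp I phi a u : sections I phi -> mdeg a = d ->
  phi a u = pairing (comp (wt a u) phi) (prodL L a).
Proof.
move=> s ad; rewrite /comp.
have := @pairing_functional k L size_L sum_L coprime_L d (fun b => phi b (unwt (wt a u) b)) a ad.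
rewrite wtK; apply=> b bd.
rewrite -[RHS](sections_rel b (unwt (wt a u) b) s); apply: eq_bigr => i _.
congr (phi _ _); apply: (can_inj (wtK (b + U_(i))%MM)).
by rewrite wt_shift !unwtK.
Qed.

(** A nonzero value at y^a x^u requires u_l = om_l - a_l >= 0 for l outside I, so the functional
    vanishes on [prodL a] as soon as a_l exceeds om_l. *)
Lemma sections_orth I phi om l : sections I phi -> l \notin I ->
  (comp om phi <= orth (powerspace L N (bound om) l))%MS.
Proof.
move=> s lI; apply/mem_orth_powerspace => // a ad; rewrite bound_leq => al.
have := sections_comp (unwt om a) s ad; rewrite unwtK => <-.
apply/eqP; apply: contraTT al => pn0; rewrite -leNgt.
by have := sections_mono s pn0 lI; rewrite ffunE subr_ge0.
Qed.

Definition coch om (r : 'rV[k]_N) : DR_cochain k := fun a u =>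
  if (mdeg a == d) && (wt a u == om) then pairing r (prodL L a) else 0.

Lemma coch_sections I om r : \sum_i om i = d%:Z + m ->
  (forall l, l \notin I -> r <= orth (powerspace L N (bound om) l))%MS ->
  sections I (coch om r).
Proof.
move=> som hr; split=> [a ad|a|b].
- by apply: funext => u; rewrite /coch (negbTE (_ : mdeg a != d)).
- split=> [|u].
    apply: (sub_finite_set (B := [set unwt om a]%classic)); last exact: finite_set1.
    move=> u /=; rewrite /coch; case: ifP => [/andP [_ /eqP <-] _|_]; last by rewrite eqxx.
    by rewrite wtK.
  rewrite /coch; case: ifP => [/andP [/eqP ad /eqP wu] pn0|_]; last by rewrite eqxx.
  split; first by move: som; rewrite -wu sum_wt ad => /addrI.
  move=> l lI; have /(mem_orth_powerspace size_L coprime_L) /(_ a ad) h := hr l lI.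
  rewrite leNgt; apply: contraNN pn0 => ul; apply/eqP/h.
  by rewrite bound_leq -wu ffunE gtrDl.
- apply: funext => v; rewrite sum_cochain /mulx /coch.
  under eq_bigr do rewrite wt_shift mdegD mdeg1.
  have [_|_] := boolP (((mdeg b + 1)%N == d) && (wt b v == om)); last by rewrite big1.
  have prodLU i : prodL L (b + U_(i))%MM = L i * prodL L b.
    rewrite -prodL_inc; congr prodL; apply: funext => j.
    by rewrite mnmDE mnm1E /inc eq_sym.
  under eq_bigr do rewrite prodLU.
  by rewrite -linear_sum -mulr_suml sum_L mul0r linear0.
Qed.

Lemma comp_coch om r : comp om (coch om r) = r.
Proof.
apply: functional_pairing => // a ad; rewrite /coch ad eqxx unwtK eqxx //.
Qed.

Lemma coch_linear om c r r' : coch om (c *: r + r') = c *: coch om r + coch om r'.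
Proof.
apply: funext => a; apply: funext => u; rewrite /coch.
have -> : (c *: coch om r + coch om r') a u = c * coch om r a u + coch om r' a u by [].
rewrite /coch; case: ifP => _; last by rewrite mulr0 addr0.
rewrite /pairing mulr_sumr -big_split; apply: eq_bigr => i _.
by rewrite !mxE /= mulrDl mulrA.
Qed.

Definition proj om : DR_cochain k -> DR_cochain k := scale (fun om' => (om' == om)%:R).

Lemma proj_coch I om phi : sections I phi -> proj om phi = coch om (comp om phi).
Proof.
move=> s; apply: funext => a; apply: funext => u; rewrite /proj /scale /coch.
have [ad|ad] := eqVneq (mdeg a) d; last first.
  by case: s => h _ _; rewrite h // mulr0.
by have [<-|_] := eqVneq (wt a u) om; rewrite ?mul0r // mul1r (sections_comp u s ad).
Qed.

End Sections.

Lemma finite_mdeg d : finite_set [set a : 'X_{1..3} | mdeg a = d]%classic.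
Proof.
pose F (f : {ffun 'I_3 -> 'I_d.+1}) := [multinom (f i : nat) | i < 3].
apply: (@sub_finite_set _ _ (F @` [set: _])%classic); last exact: finite_image.
move=> a /= ad; have aid i : (a i < d.+1)%N.
  by rewrite ltnS -ad mdegE (bigD1 i) //= leq_addr.
exists [ffun i => Ordinal (aid i)] => //.
by apply/mnmP => i; rewrite mnmE ffunE.
Qed.

(** A torus character fixes the integer weight up to adding a constant vector, and the sum fixes the
    constant. *)
Lemma weight_unique (om om' : weight) (w : 'X_{1..3}) : (exists c, forall i, om i = (w i)%:Z + c) ->
  (exists c, forall i, om' i = (w i)%:Z + c) -> \sum_i om i = \sum_i om' i -> om = om'.
Proof.
move=> [c hc] [c' hc']; rewrite !sum3 !hc !hc' => e; apply/ffunP => i.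
by rewrite hc hc'; congr (_ + _); move: e; lia.
Qed.

Section Cochains.
Variables (k : closedFieldType) (d m : int).

Lemma C0_subspace : subspace (@cech_C0 k d m).
Proof.
split=> [i|c u v hu hv i]; first by case: (sections_subspace k d m [set i]%SET).
exact: (proj2 (sections_subspace k d m [set i]%SET)).
Qed.

Lemma cech_d0_linear c (u v : 'I_3 -> DR_cochain k) :
  cech_d0 (c *: u + v) = c *: cech_d0 u + cech_d0 v.
Proof.
apply: funext => i; apply: funext => j.
have -> : cech_d0 (c *: u + v) i j = (c *: u j + v j) - (c *: u i + v i) by [].
have -> : (c *: cech_d0 u + cech_d0 v) i j = c *: (u j - u i) + (v j - v i) by [].
by rewrite opprD scalerBr addrACA.
Qed.

Lemma cech_d00 : cech_d0 (0 : 'I_3 -> DR_cochain k) = 0.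
Proof. by apply: funext => i; apply: funext => j; rewrite /cech_d0 subrr. Qed.

Lemma Z0_subspace : subspace (@cech_Z0 k d m).
Proof.
split=> [|c u v [Cu du] [Cv dv]]; first by split; [case: C0_subspace | exact: cech_d00].
by split; [apply: (proj2 C0_subspace) | rewrite cech_d0_linear du dv scaler0 addr0].
Qed.

End Cochains.

(** * Multiplicities in the zeroth cohomology *)

Section CechWeights.
Variables (k : closedFieldType) (L : 'I_3 -> {poly k}).
Hypothesis size_L : forall i, size (L i) = 2.
Hypothesis sum_L : \sum_i L i = 0.
Hypothesis coprime_L : forall i j, i != j -> coprimep (L i) (L j).
Variables (d : nat) (m : int).
Hypothesis m_ge : -1 <= m.
Local Notation N := d.+1.
Implicit Types (phi psi : DR_cochain k) (om : weight) (I : {set 'I_3}).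
Implicit Types (w : 'X_{1..3}) (t : 'I_3 -> k).
Local Notation T0 := (fun t (c : 'I_3 -> DR_cochain k) i => act t (c i)).
Local Notation P om l := (orth (powerspace L N (bound om) l)).

Lemma weight_space_subspace (M : lmodType k) (T : ('I_3 -> k) -> M -> M) Z B w :
  (forall t c u v, T t (c *: u + v) = c *: T t u + T t v) ->
  subspace Z -> subspace B -> subspace (weight_space T Z B w).
Proof.
move=> Tl sZ sB; split=> [|c u v [Zu Bu] [Zv Bv]].
  split=> [|t _]; first by case: sZ.
  have T0 : T t 0 = 0.
    by have /eqP := Tl t 1 0 0; rewrite !scale1r addr0 -subr_eq0 opprD addNKr oppr_eq0 => /eqP.
  by rewrite T0 scaler0 subr0; case: sB.
split=> [|t ht]; first exact: (proj2 sZ).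
have := proj2 sB c _ _ (Bu t ht) (Bv t ht).
congr (B _); rewrite Tl (scalerBr c) [_ *: (c *: u + v)]scalerDr opprD addrACA.
by congr (_ + (- _ - _)); rewrite !scalerA mulrC.
Qed.

Lemma actE t phi : act t phi = scale (fun om => \prod_i t i ^ om i) phi.
Proof.
apply: funext => a; apply: funext => u; rewrite /act /scale; congr (_ * _).
by apply: eq_bigr => i _; rewrite ffunE.
Qed.

Lemma scale_linear th c phi psi :
  scale th (c *: phi + psi) = c *: scale th phi + scale th psi.
Proof.
apply: funext => a; apply: funext => u.
have -> : (c *: scale th phi + scale th psi) a u = c * scale th phi a u + scale th psi a u by [].
have e : (c *: phi + psi) a u = c * phi a u + psi a u by [].
by rewrite /scale e mulrDr mulrCA.
Qed.

Lemma act_linear t c phi psi : act t (c *: phi + psi) = c *: act t phi + act t psi.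
Proof. by rewrite !actE scale_linear. Qed.

Lemma B1_subspace : subspace (@cech_B1 k d m).
Proof.
split=> [|c _ _ [u Cu <-] [v Cv <-]].
  by exists 0; [case: (C0_subspace k d m) | exact: cech_d00].
by exists (c *: u + v); [apply: (proj2 (C0_subspace k d m)) | rewrite cech_d0_linear].
Qed.

Lemma Z1_subspace : subspace (@cech_Z1 k d m).
Proof.
split=> [|c u v [su cu] [sv cv]].
  split=> [i j|i j l]; first by case: (sections_subspace k d m [set i; j]%SET).
  by rewrite subrr addr0.
split=> [i j|i j l]; first exact: (proj2 (sections_subspace k d m [set i; j]%SET)).
have -> : (c *: u + v) j l - (c *: u + v) i l + (c *: u + v) i j =
    c *: (u j l - u i l + u i j) + (v j l - v i l + v i j).
  have e x y : (c *: u + v) x y = c *: u x y + v x y by [].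
  by rewrite !e scalerDr scalerBr opprD [X in X + _ = _]addrACA [LHS]addrACA.
by rewrite cu cv scaler0 addr0.
Qed.

Lemma weight_separates om w : ~ (exists c, forall i, om i = (w i)%:Z + c) ->
  exists2 t : 'I_3 -> k, torus t & \prod_i t i ^ om i != \prod_i t i ^+ w i.
Proof.
move=> nc; pose de : weight := [ffun i => om i - (w i)%:Z].
have [j dj] : exists j, de i0 != de j.
  apply: contrapT => h; apply: nc; exists (de i0) => i.
  suff -> : de i0 = de i by rewrite ffunE addrC subrK.
  by apply/eqP; apply: contrapT => /negP h'; apply: h; exists i.
have [t ht tn] := torus_separates k dj; exists t => //.
apply: contraNneq tn => e.
have wn0 : \prod_i t i ^+ w i != 0.
  by apply/prodf_neq0 => i _; rewrite expf_neq0 // torus_neq0.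
apply/eqP/(mulIf wn0); rewrite mul1r -[RHS]e -big_split; apply: eq_bigr => i _ /=.
by rewrite exprnP -expfzDr ?torus_neq0 // ffunE subrK.
Qed.

Lemma weight_prod om w t : torus t -> (exists c, forall i, om i = (w i)%:Z + c) ->
  \prod_i t i ^ om i = \prod_i t i ^+ w i.
Proof.
move=> ht [c h]; pose w' : weight := [ffun i => (w i)%:Z].
rewrite (@torus_shift k t w' om c ht) => [|i]; last by rewrite ffunE.
by apply: eq_bigr => i _; rewrite ffunE exprnP.
Qed.

(** This is where e >= 0 enters: the three powers have total degree at least d + 1, so no nonzero
    polynomial of size at most d + 1 is a multiple of all three, as [rank_orth_defect] requires. *)
Lemma bound_sum_le om : \sum_i om i = d%:Z + m -> (N <= \sum_i bound om i)%N.
Proof.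
have h i : om i + 1 <= (bound om i)%:Z by rewrite /bound; case: (om i) => n; lia.
move: (h i0) (h i1) (h i2); rewrite sum3 sumn3 => h0 h1 h2 e.
by move: m_ge h0 h1 h2 e; lia.
Qed.

Lemma rank_P_cap om : \rank (P om i0 :&: (P om i1 :&: P om i2))%MS = n0 L N (bound om).
Proof.
rewrite /n0 /rank_sum -rank_orth; apply/eqmx_rank/eqmxP/eqmx_sym.
apply: (eqmx_trans (orthD _ _)); apply: cap_eqmx => //; exact: orthD.
Qed.

(** The component of weight [om] of the common section is orthogonal to each power space, read off
    on a chart with another index. Components of other weights vanish because some torus element
    separates them from w. *)
Lemma quot_dim_h0 w om : (exists c, forall i, om i = (w i)%:Z + c) ->
  \sum_i om i = d%:Z + m ->
  quot_dim (weight_space T0 (@cech_Z0 k d m) [set 0]%classic w) [set 0]%classic =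
  n0 L N (bound om).
Proof.
move=> omw som.
have s0 : subspace [set 0 : 'I_3 -> DR_cochain k]%classic.
  by split=> // c u v /= -> ->; rewrite scaler0 addr0.
have Zeq (z : 'I_3 -> DR_cochain k) : cech_Z0 d m z -> forall i j, z i = z j.
  move=> [_ dz] i j; apply/eqP; rewrite -subr_eq0; apply/eqP.
  by have := congr1 (fun f : 'I_3 -> 'I_3 -> DR_cochain k => f j i) dz.
rewrite -rank_P_cap -[RHS]subn0 -[X in (_ - X)%N](mxrank0 k N N).
apply: (quot_dim_rank (g := fun z => comp L d om (z i0))) => //.
- by apply: weight_space_subspace => // [t c u v|];
    [apply: funext => i; exact: act_linear | exact: Z0_subspace].
- exact: sub0mx.
- by move=> c u v; exact: comp_linear.
- move=> z [zZ _]; have [Cz _] := zZ; rewrite !sub_capmx.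
  apply/and3P; split.
  + by rewrite (Zeq _ zZ i0 i1) (sections_orth _ _ _ _ (Cz i1)) // inE.
  + by rewrite (Zeq _ zZ i0 i2) (sections_orth _ _ _ _ (Cz i2)) // inE.
  + by rewrite (sections_orth _ _ _ _ (Cz i0)) // inE.
- move=> r; rewrite !sub_capmx => /and3P [r0 r1 r2].
  exists (fun=> coch L om r); last exact: comp_coch.
  split; first split.
  + by move=> i; apply: coch_sections => // l _; move: l; elim/ord3P.
  + by apply: funext => i; apply: funext => j; rewrite /cech_d0 subrr.
  + move=> t ht /=; apply/eqP; rewrite subr_eq0; apply/eqP.
    apply: funext => i; apply: funext => a; apply: funext => u; rewrite actE.
    rewrite -(weight_prod ht omw) /scale.
    have -> : ((\prod_j t j ^ om j) *: (fun=> coch L om r)) i a u =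
      (\prod_j t j ^ om j) * coch L om r a u by [].
    by rewrite /coch; case: ifP => [/andP [_ /eqP ->]|]; rewrite ?mulr0.
- move=> z [zZ zw]; rewrite submx0; split=> [/= ->|/eqP z0].
    apply/eqP; have := comp_linear L d om (-1) (0 : DR_cochain k) 0.
    by rewrite scaler0 addr0 scaleN1r addNr.
  apply: funext => i; apply: funext => a; apply: funext => u.
  have [Cz _] := zZ; have si := Cz i.
  apply/eqP; apply: contrapT => /negP pn0.
  have ad := sections_deg si pn0.
  have [e|wn] := eqVneq (wt a u) om.
    have := sections_comp size_L sum_L coprime_L u si ad.
    rewrite e (Zeq _ zZ i i0) z0 => zz; move: pn0; rewrite (Zeq _ zZ i i0) zz.
    by rewrite /pairing big1 ?eqxx // => x _; rewrite mxE mul0r.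
  have [t ht tn] : exists2 t : 'I_3 -> k, torus t & \prod_j t j ^ wt a u j != \prod_j t j ^+ w j.
    apply: weight_separates => h; case/eqP: wn; apply: weight_unique h omw _.
    by rewrite (sections_wt si pn0) som.
  have := zw t ht => /= /(congr1 (fun f : 'I_3 -> DR_cochain k => f i a u)).
  have -> : ((fun i1 => act t (z i1)) - (\prod_j t j ^+ w j) *: z) i a u =
    act t (z i) a u - (\prod_j t j ^+ w j) * z i a u by [].
  rewrite actE /scale -mulrBl => /eqP; rewrite mulf_eq0 (negbTE pn0) orbF subr_eq0.
  by rewrite (negbTE tn).
Qed.

End CechWeights.

(** * Multiplicities in the first cohomology *)

Section CechOne.
Variables (k : closedFieldType) (L : 'I_3 -> {poly k}).
Hypothesis size_L : forall i, size (L i) = 2.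
Hypothesis sum_L : \sum_i L i = 0.
Hypothesis coprime_L : forall i j, i != j -> coprimep (L i) (L j).
Variables (d : nat) (m : int).
Hypothesis m_ge : -1 <= m.
Local Notation N := d.+1.
Implicit Types (phi psi : DR_cochain k) (om : weight) (I : {set 'I_3}).
Implicit Types (w : 'X_{1..3}) (t : 'I_3 -> k).
Local Notation sections := (@DR_sections k d m).
Local Notation T0 := (fun t (c : 'I_3 -> DR_cochain k) i => act t (c i)).
Local Notation T1 := (fun t (c : 'I_3 -> 'I_3 -> DR_cochain k) i j => act t (c i j)).
Local Notation P om l := (orth (powerspace L N (bound om) l)).
Local Notation family := ('I_3 -> 'I_3 -> DR_cochain k).

Lemma quot_dim0 (M : lmodType k) (Z B : set M) :
  subspace Z -> subspace B -> (forall z, Z z -> B z) -> quot_dim Z B = 0%N.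
Proof.
move=> sZ sB ZB.
have := @quot_dim_rank k M Z B 0 0 0 (fun=> 0) sZ sB (sub0mx _ _).
rewrite mxrank0; apply=> [c u v|z _|u|z /ZB Bz].
- by rewrite scaler0 addr0.
- exact: sub0mx.
- by rewrite submx0 => /eqP ->; exists 0; [case: sZ |].
- by split=> // _; exact: sub0mx.
Qed.

Lemma quot_dim_h0_none w :
  (forall om, \sum_i om i = d%:Z + m -> ~ exists c, forall i, om i = (w i)%:Z + c) ->
  quot_dim (weight_space T0 (@cech_Z0 k d m) [set 0]%classic w) [set 0]%classic = 0%N.
Proof.
move=> none.
have s0 : subspace [set 0 : 'I_3 -> DR_cochain k]%classic.
  by split=> // c u v /= -> ->; rewrite scaler0 addr0.
apply: quot_dim0 => //.
  by apply: weight_space_subspace => // [t c u v|];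
    [apply: funext => i; exact: act_linear | exact: Z0_subspace].
move=> z [[Cz _] zw]; apply: funext => i; apply: funext => a; apply: funext => u.
apply/eqP; apply: contrapT => /negP pn0.
have [t ht tn] := weight_separates k (none _ (sections_wt (Cz i) pn0)).
have := zw t ht => /= /(congr1 (fun f : 'I_3 -> DR_cochain k => f i a u)).
have -> : ((fun i1 => act t (z i1)) - (\prod_j t j ^+ w j) *: z) i a u =
  act t (z i) a u - (\prod_j t j ^+ w j) * z i a u by [].
rewrite actE /scale -mulrBl => /eqP; rewrite mulf_eq0 (negbTE pn0) orbF subr_eq0.
by rewrite (negbTE tn).
Qed.

Lemma B1_scale th (z : family) : cech_B1 d m z ->
  cech_B1 d m (fun i j => scale th (z i j)).
Proof.
move=> [c Cc <-]; exists (fun i => scale th (c i)); first by move=> i; apply: sections_scale.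
apply: funext => i; apply: funext => j; rewrite /cech_d0.
have := scale_linear th (-1) (c i) (c j).
by rewrite !scaleN1r addrC => ->; rewrite addrC.
Qed.

(** Primitives chosen weight by weight are glued. Only finitely many weights occur in [z], and the
    primitive is set to 0 at all others, so that the glued cochain keeps finite support. *)
Lemma B1_of_proj (z : family) : cech_Z1 d m z ->
  (forall om, \sum_i om i = d%:Z + m -> cech_B1 d m (fun i j => proj om (z i j))) ->
  cech_B1 d m z.
Proof.
move=> [sz _] hz.
pose F : set weight := [set om | exists i j a u, z i j a u != 0 /\ wt a u = om]%classic.
have finF : finite_set F.
  pose G i j : set weight :=
    (\bigcup_(a in [set a | mdeg a = d]) (wt a @` [set u | z i j a u != 0]))%classic.
  apply: (@sub_finite_set _ _ (\bigcup_(i in [set: 'I_3]) \bigcup_(j in [set: 'I_3]) G i j)%classic).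
    move=> om [i [j [a [u [zn0 <-]]]]]; exists i => //; exists j => //.
    by exists a; [apply: sections_deg (sz i j) zn0 | exists u].
  apply: bigcup_finite => // i _; apply: bigcup_finite => // j _.
  apply: bigcup_finite; first exact: finite_mdeg.
  by move=> a _; apply: finite_image; have [_ /(_ a) [] ] := sz i j.
have /choice [c0 c0P] : forall om, exists c0 : 'I_3 -> DR_cochain k,
    [/\ cech_C0 d m c0, F om -> cech_d0 c0 = (fun i j => proj om (z i j))
      & ~ F om -> c0 = 0].
  move=> om; have [Fom|nF] := pselect (F om); last first.
    by exists 0; split=> //; case: (C0_subspace k d m).
  have [|c Cc cE] := hz om; last by exists c.
  by case: Fom => i [j [a [u [zn0 <-]]]]; apply: sections_wt (sz i j) zn0.
exists (fun i a u => c0 (wt a u) i a u).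
  move=> i; split=> [a ad|a|b].
  - by apply: funext => u; have [/(_ i) [h _ _] _ _] := c0P (wt a u); rewrite h.
  - split=> [|u un0].
      apply: (@sub_finite_set _ _ (unwt^~ a @` F)%classic); last exact: finite_image.
      move=> u /= un0; exists (wt a u); last exact: wtK.
      apply: contrapT => nF; move: un0; have [_ _ /(_ nF) ->] := c0P (wt a u).
      by rewrite eqxx.
    by have [/(_ i) [_ /(_ a) [_ h] _] _ _] := c0P (wt a u); apply: h.
  - apply: funext => v; rewrite sum_cochain /mulx.
    under eq_bigr do rewrite wt_shift.
    by have [/(_ i) h _ _] := c0P (wt b v); apply: sections_rel h.
apply: funext => i; apply: funext => j; apply: funext => a; apply: funext => u.
have -> : cech_d0 (fun i a u => c0 (wt a u) i a u) i j a u =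
  cech_d0 (c0 (wt a u)) i j a u by [].
have [Fw|nF] := pselect (F (wt a u)).
  by have [_ /(_ Fw) -> _] := c0P (wt a u); rewrite /proj /scale eqxx mul1r.
have [_ _ /(_ nF) ->] := c0P (wt a u); rewrite cech_d00.
apply/esym/eqP; apply: contrapT => /negP zn0; apply: nF.
by exists i, j, a, u.
Qed.

(** On the component of weight [om] the given coboundary is (x - y) z with x different from y;
    projecting to [om] and dividing by x - y leaves a coboundary. *)
Lemma B1_proj_other w (z : family) om :
  (forall t, torus t -> cech_B1 d m (T1 t z - (\prod_i t i ^+ w i) *: z)) ->
  ~ (exists c, forall i, om i = (w i)%:Z + c) ->
  cech_B1 d m (fun i j => proj om (z i j)).
Proof.
move=> zw nc; have [t ht tn] := weight_separates k nc.
set x := \prod_i t i ^ om i in tn; set y := \prod_i t i ^+ w i in tn.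
have := B1_scale (fun om' => (om' == om)%:R / (x - y)) (zw t ht).
congr cech_B1; apply: funext => i; apply: funext => j; apply: funext => a; apply: funext => u.
rewrite /scale /proj /scale.
have -> : (T1 t z - y *: z) i j a u = act t (z i j) a u - y * z i j a u by [].
rewrite actE /scale; have [->|_] := eqVneq (wt a u) om; last by rewrite !mul0r.
by rewrite -/x -mulrBl mul1r mulrA mulVf ?mul1r // subr_eq0.
Qed.

Lemma T1_linear t c (u v : family) : T1 t (c *: u + v) = c *: T1 t u + T1 t v.
Proof. by apply: funext => i; apply: funext => j; exact: act_linear. Qed.

Lemma weight_space1_subspace w :
  subspace (weight_space T1 (@cech_Z1 k d m) (@cech_B1 k d m) w).
Proof.
apply: weight_space_subspace => [t c u v||]; first exact: T1_linear.
  exact: Z1_subspace.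
exact: B1_subspace.
Qed.

Lemma quot_dim_h1_none w :
  (forall om, \sum_i om i = d%:Z + m -> ~ exists c, forall i, om i = (w i)%:Z + c) ->
  quot_dim (weight_space T1 (@cech_Z1 k d m) (@cech_B1 k d m) w) (@cech_B1 k d m) = 0%N.
Proof.
move=> none; apply: quot_dim0; [exact: weight_space1_subspace | exact: B1_subspace |].
move=> z [zZ zw]; apply: B1_of_proj => // om /none nc.
exact: B1_proj_other zw nc.
Qed.

Lemma rank_P_defect om : \sum_i om i = d%:Z + m ->
  (\rank (P om i0 :&: (P om i1 + P om i2)) -
   \rank (P om i0 :&: P om i1 + P om i0 :&: P om i2))%N = n1 L N (bound om).
Proof.
move=> som; have le := bound_sum_le m_ge som.
have := rank_orth_defect (powerspace_cap3 size_L coprime_L le).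
rewrite !rank_powerspace_cap // !rank_powerspace //.
have := rank_syz_space size_L N (bound om).
by rewrite sumn3 /n1 /koszul_dim /rank_sum; lia.
Qed.

Lemma Z1_diag (z : family) i : cech_Z1 d m z -> z i i = 0.
Proof. by move=> [_ /(_ i i i)]; rewrite subrr add0r. Qed.

Lemma Z1_split (z : family) i j l : cech_Z1 d m z -> z i j = z i l - z j l.
Proof.
by move=> [_ /(_ i j l)] /eqP; rewrite addrC addr_eq0 opprB => /eqP.
Qed.

Lemma compB om phi psi : comp L d om (phi - psi) = comp L d om phi - comp L d om psi.
Proof. by rewrite addrC -scaleN1r comp_linear scaleN1r addrC. Qed.

Lemma comp0 om : comp L d om (0 : DR_cochain k) = 0.
Proof. by rewrite -(subrr (0 : DR_cochain k)) compB subrr. Qed.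

Lemma cochB om (r r' : 'rV[k]_N) : coch L om (r - r') = coch L om r - coch L om r'.
Proof. by rewrite addrC -scaleN1r coch_linear scaleN1r addrC. Qed.

Lemma submxB n' n (A : 'M[k]_(n', n)) (u v : 'rV_n) :
  (u <= A)%MS -> (v <= A)%MS -> (u - v <= A)%MS.
Proof. by move=> uA vA; rewrite addmx_sub // eqmx_opp. Qed.

Lemma differences_submx n (A : 'I_3 -> 'M[k]_n) (ka : 'I_3 -> 'rV_n) :
  (ka i1 - ka i0 <= A i2)%MS -> (ka i2 - ka i0 <= A i1)%MS ->
  (ka i2 - ka i1 <= A i0)%MS ->
  forall i j l, l \notin [set i; j]%SET -> (ka j - ka i <= A l)%MS.
Proof.
move=> h01 h02 h12.
have sw x y l : (ka x - ka y <= A l)%MS -> (ka y - ka x <= A l)%MS.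
  by rewrite -[ka y - ka x]opprB eqmx_opp.
have h01' := sw _ _ _ h01; have h02' := sw _ _ _ h02; have h12' := sw _ _ _ h12.
by do 3![elim/ord3P]; rewrite !inE // => _; rewrite subrr sub0mx.
Qed.

Lemma offdiagonal_submx n (A : 'I_3 -> 'M[k]_n) (ka : 'I_3 -> 'rV_n) :
  (ka i0 <= A i1)%MS -> (ka i0 <= A i2)%MS -> (ka i1 <= A i0)%MS ->
  (ka i1 <= A i2)%MS -> (ka i2 <= A i0)%MS -> (ka i2 <= A i1)%MS ->
  forall i l, l \notin [set i]%SET -> (ka i <= A l)%MS.
Proof. by move=> h01 h02 h10 h12 h20 h21; do 2![elim/ord3P]; rewrite inE. Qed.

(** A cocycle is read through its entry (1, 2). It is orthogonal to the power space 0, and since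
    z_12 = z_10 - z_20 it lies in the sum of the complements 1 and 2. For a coboundary c_2 - c_1,
    each term is also orthogonal to the power space 0; the quotient is thus the defect in
    [rank_P_defect]. *)
Lemma quot_dim_h1 w om : (exists c, forall i, om i = (w i)%:Z + c) ->
  \sum_i om i = d%:Z + m ->
  quot_dim (weight_space T1 (@cech_Z1 k d m) (@cech_B1 k d m) w) (@cech_B1 k d m) =
  n1 L N (bound om).
Proof.
move=> omw som; rewrite -rank_P_defect //.
have cs := coch_sections size_L sum_L coprime_L som.
have so I phi l : sections I phi -> l \notin I -> (comp L d om phi <= P om l)%MS.
  exact: sections_orth.
apply: (quot_dim_rank (g := fun z : family => comp L d om (z i1 i2))).
- exact: weight_space1_subspace.
- exact: B1_subspace.
- rewrite sub_capmx; apply/andP; split.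
    by rewrite addsmx_sub !capmxSl.
  by rewrite addsmxS // capmxSr.
- by move=> c u v; exact: comp_linear.
- move=> z [zZ _]; have [sz _] := zZ; rewrite sub_capmx; apply/andP; split.
    by apply: so (sz i1 i2) _; rewrite !inE.
  rewrite (Z1_split i1 i2 i0 zZ) compB; apply: submxB.
    by apply: submx_trans (addsmxSr _ _); apply: so (sz i1 i0) _; rewrite !inE.
  by apply: submx_trans (addsmxSl _ _); apply: so (sz i2 i0) _; rewrite !inE.
- move=> r; rewrite sub_capmx => /andP [r0 /sub_addsmxP [[x1 x2] /= rE]].
  set r1 := x1 *m _ in rE; set r2 := x2 *m _ in rE.
  have h1 : (r1 <= P om i1)%MS by exact: submxMl.
  have h2 : (r2 <= P om i2)%MS by exact: submxMl.
  (* A potential whose differences form the cocycle: the values make entry (1, 2) equal to r1 + r2 =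
     r and place each difference in the complement its overlap demands. *)
  pose ka (i : 'I_3) : 'rV[k]_N := if i == i0 then 0 else if i == i1 then - r2 else r1.
  have h01 : (ka i1 - ka i0 <= P om i2)%MS by rewrite /ka /= subr0 eqmx_opp.
  have h02 : (ka i2 - ka i0 <= P om i1)%MS by rewrite /ka /= subr0.
  have h12 : (ka i2 - ka i1 <= P om i0)%MS by rewrite /ka /= opprK -rE.
  exists (fun i j => coch L om (ka j - ka i)).
    split; first split.
    + move=> i j; apply: cs => l.
      exact: (differences_submx (A := fun l => P om l) h01 h02 h12).
    + move=> i j l; rewrite !cochB.
      move: (coch L om (ka i)) (coch L om (ka j)) (coch L om (ka l)) => x y s.
      by rewrite opprB [s - y + _]addrC (addrA (x - s)) subrK addrA subrK subrr.
    + move=> t ht; have -> : T1 t (fun i j => coch L om (ka j - ka i)) -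
          (\prod_i t i ^+ w i) *: (fun i j => coch L om (ka j - ka i)) = 0.
        apply/eqP; rewrite subr_eq0; apply/eqP.
        apply: funext => i; apply: funext => j; apply: funext => a; apply: funext => u.
        rewrite actE -(weight_prod ht omw) /scale.
        have -> : ((\prod_j t j ^ om j) *: (fun i j => coch L om (ka j - ka i))) i j a u =
          (\prod_j t j ^ om j) * coch L om (ka j - ka i) a u by [].
        by rewrite /coch; case: ifP => [/andP [_ /eqP ->]|]; rewrite ?mulr0.
      by case: (B1_subspace k d m).
  by rewrite comp_coch // /ka /= opprK rE.
- move=> z [zZ zw]; have [sz cz] := zZ; split=> [[c Cc zE]|].
    rewrite -zE /cech_d0 compB; apply: submxB.
      apply: submx_trans (addsmxSl _ _); rewrite sub_capmx.
      by rewrite !(so _ _ _ (Cc i2)) // inE.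
    apply: submx_trans (addsmxSr _ _); rewrite sub_capmx.
    by rewrite !(so _ _ _ (Cc i1)) // inE.
  move=> /sub_addsmxP [[x1 x2] /= rE].
  set s2 := x1 *m _ in rE; set s1 := x2 *m _ in rE.
  have : (s2 <= P om i0 :&: P om i1)%MS by exact: submxMl.
  rewrite sub_capmx => /andP [s20 s21].
  have : (s1 <= P om i0 :&: P om i2)%MS by exact: submxMl.
  rewrite sub_capmx => /andP [s10 s12].
  pose f i j := comp L d om (z i j).
  have fE i j l : f i j = f i l - f j l by rewrite /f (Z1_split i j l zZ) compB.
  have f02 : (f i0 i2 <= P om i1)%MS by apply: so (sz i0 i2) _; rewrite !inE.
  have f01 : (f i0 i1 <= P om i2)%MS by apply: so (sz i0 i1) _; rewrite !inE.
  (* The splitting f_12 = s2 + s1 dictates the values at 1 and 2; the value at 0 is forced by entry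
     (0, 2), and it also equals - s1 - f_01, which gives its second orthogonality. *)
  pose ka (i : 'I_3) : 'rV[k]_N :=
    if i == i0 then s2 - f i0 i2 else if i == i1 then - s1 else s2.
  apply: B1_of_proj => // om' som'.
  have [om'E|omn] := eqVneq om' om; last first.
    apply: B1_proj_other zw _ => h; case/eqP: omn.
    exact: (weight_unique h omw (etrans som' (esym som))).
  rewrite om'E; exists (fun i => coch L om (ka i)).
    move=> i; apply: cs => l; apply: (offdiagonal_submx (A := fun l => P om l)) => {i l}.
    + exact: submxB.
    + have -> : ka i0 = - s1 - f i0 i1.
        by rewrite /ka /= (fE i0 i1 i2) -/(f i1 i2) [f i1 i2]rE opprB addrA [- s1 + _]addrC addrK.
      by apply: submxB => //; rewrite eqmx_opp.
    + by rewrite /ka /= eqmx_opp.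
    + by rewrite /ka /= eqmx_opp.
    + by rewrite /ka /=.
    + by rewrite /ka /=.
  apply: funext => i; apply: funext => j.
  rewrite (proj_coch size_L sum_L coprime_L om (sz i j)) -/(f i j) /cech_d0 -cochB.
  congr (coch _ _ _).
  have fk l : f l i2 = s2 - ka l.
    move: l; elim/ord3P; rewrite /ka /=; first by rewrite opprB addrC subrK.
      by rewrite opprK [LHS]rE.
    by rewrite subrr /f (Z1_diag i2 zZ) comp0.
  by rewrite (fE i j i2) !fk opprB [s2 - _ + _]addrC addrA subrK.
Qed.

End CechOne.

(** * Characters as sums over monomials *)

Lemma linear_forms_exist (k : closedFieldType) : exists L : 'I_3 -> {poly k},
  [/\ forall i, size (L i) = 2, \sum_i L i = 0
    & forall i j, i != j -> coprimep (L i) (L j)].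
Proof.
(* Any c other than 0 and -1 would do for the roots 0, 1, c / (c + 1) with leading coefficients 1,
   c, -(c + 1); a solution of c (c + 1) = -1 is one. *)
have [c] : exists c, root ('X * ('X + 1) + 1 : {poly k}) c.
  apply/closed_rootP.
  have s1 : size ('X + 1 : {poly k}) = 2 by rewrite -polyC1 size_XaddC.
  have s2 : size ('X * ('X + 1) : {poly k}) = 3.
    by rewrite mulrC size_mulX ?s1 // -size_poly_eq0 s1.
  by rewrite size_polyDl s2 // size_poly1.
rewrite /root !hornerE => /eqP h.
have c0 : c != 0.
  by apply: contraTneq isT => e; move/eqP: h; rewrite e mul0r add0r oner_eq0.
have c1 : c + 1 != 0.
  by apply: contraTneq isT => e; move/eqP: h; rewrite e mulr0 add0r oner_eq0.
pose mu (i : 'I_3) := if i == i0 then 1 else if i == i1 then c else - (c + 1).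
pose x (i : 'I_3) := if i == i0 then 0 else if i == i1 then 1 else c / (c + 1).
have mu0 i : mu i != 0.
  by move: i; elim/ord3P; rewrite /mu /= ?oner_eq0 ?oppr_eq0.
exists (fun i => mu i *: ('X - (x i)%:P)); split.
- by move=> i; rewrite size_scale ?size_XsubC.
- have e : (c + 1) *: ('X - (c / (c + 1))%:P) = (c + 1) *: 'X - c%:P.
    by rewrite scalerBr -[(c + 1) *: _%:P]mul_polyC -polyCM mulrCA divff ?mulr1.
  rewrite sum3 /mu /x /= polyC0 subr0 scale1r scaleNr e -!mul_polyC polyCD polyC1.
  by ring.
- have x20 : c / (c + 1) != 0 by rewrite mulf_neq0 ?invr_eq0.
  have x21 : c / (c + 1) != 1.
    apply: contraTneq isT => e; have := divfK c1 c; rewrite e mul1r => /eqP.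
    by rewrite -subr_eq0 addrAC subrr add0r oner_eq0.
  have x10 : (1 : k) != 0 by exact: oner_neq0.
  have xn i j : i != j -> x i != x j.
    move: i j; do 2![elim/ord3P] => //= _; rewrite /x /= //; by rewrite eq_sym.
  move=> i j ij; rewrite coprimepZl // coprimepZr // coprimep_XsubC root_XsubC.
  by apply: xn; rewrite eq_sym.
Qed.

Definition mon (f : 'I_3 -> nat) : chA := \prod_i xA i ^+ f i.

Lemma monD f g : mon f * mon g = mon (fun i => f i + g i)%N.
Proof. by rewrite /mon -big_split; apply: eq_bigr => i _; rewrite exprD. Qed.

Lemma mon_const c : mon (fun=> c) = 1.
Proof. by rewrite /mon prodrXl prod_x expr1n. Qed.

Lemma mon_shift (f g : 'I_3 -> nat) c : (forall i, f i = g i + c)%N -> mon f = mon g.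
Proof.
move=> h; rewrite -[RHS]mulr1 -(mon_const c) monD.
by apply: eq_bigr => i _; rewrite h.
Qed.

(** Subtracting its minimum from an exponent vector of sum [D] gives the representative w with a
    zero entry, without changing the monomial since x_1 x_2 x_3 = 1. Weights with a negative entry
    contribute nothing, and the others have entries below [K]. *)
Lemma character_sum (nn : 'X_{1..3} -> nat) (n : weight -> nat) (D : int) (K : nat) :
  (forall (w : 'X_{1..3}) (om : weight), (exists c, forall i, om i = (w i)%:Z + c) ->
    \sum_i om i = D -> nn w = n om) ->
  (forall w : 'X_{1..3}, (forall om : weight, \sum_i om i = D ->
      ~ exists c, forall i, om i = (w i)%:Z + c) ->
    nn w = 0%N) ->
  (forall (om : weight) i, om i < 0 -> n om = 0%N) -> D < K%:Z ->
  \sum_(w \in [set w : 'X_{1..3} | exists i, w i = 0%N]%classic) mon w *+ nn w =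
  \sum_(f : {ffun 'I_3 -> 'I_K} | (\sum_i f i)%N%:Z == D)
    mon (fun i => f i) *+ n [ffun i => (f i)%:Z].
Proof.
move=> H1 H2 H3 DK.
pose S (f : {ffun 'I_3 -> 'I_K}) := (\sum_i f i)%N%:Z == D.
pose mi (f : {ffun 'I_3 -> 'I_K}) := minn (f i0) (minn (f i1) (f i2)).
have mile f i : (mi f <= f i)%N by move: i; elim/ord3P; rewrite /mi; lia.
pose g (f : {ffun 'I_3 -> 'I_K}) : 'X_{1..3} := [multinom (f i - mi f)%N | i < 3].
have gE (f : {ffun 'I_3 -> 'I_K}) i : (f i : nat) = (g f i + mi f)%N by rewrite mnmE subnK.
have g0 (f : {ffun 'I_3 -> 'I_K}) : exists i, g f i = 0%N.
  have h : [|| mi f == f i0 :> nat, mi f == f i1 :> nat | mi f == f i2 :> nat].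
    by rewrite /mi; move: (nat_of_ord (f i0)) (nat_of_ord (f i1)) (nat_of_ord (f i2)); lia.
  by case/or3P: h => /eqP h; [exists i0 | exists i1 | exists i2]; rewrite mnmE -h subnn.
have sumS (f : {ffun 'I_3 -> 'I_K}) : (\sum_i f i)%N%:Z = \sum_i ([ffun i => (f i)%:Z] : weight) i.
  by rewrite sumn3 sum3 !ffunE !PoszD.
have g_inj : {in [pred f | S f] &, injective g}.
  move=> f f'; rewrite !inE /S => /eqP sf /eqP sf' e.
  have {}e i : g f i = g f' i by rewrite e.
  apply/ffunP => i; apply: val_inj => /=.
  have := gE f i0; have := gE f i1; have := gE f i2; have := gE f i.
  have := gE f' i0; have := gE f' i1; have := gE f' i2; have := gE f' i.
  by move: sf sf' (e i0) (e i1) (e i2) (e i); rewrite !sumn3; lia.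
pose r := [seq g f | f <- enum S].
have ur : uniq r.
  by rewrite map_inj_in_uniq ?enum_uniq // => f f'; rewrite !mem_enum; apply: g_inj.
rewrite (@fsbigE _ _ _ _ _ r) //; first last.
- move=> w [l wl] wr; have [h|h] := pselect (exists2 om : weight, \sum_i om i = D &
    exists c, forall i, om i = (w i)%:Z + c); last first.
    by rewrite H2 ?mulr0n // => om so co; apply: h; exists om.
  have [om so co] := h; rewrite (H1 _ _ co so).
  have [[i omi]|nneg] := pselect (exists i, om i < 0); first by rewrite (H3 _ _ omi) mulr0n.
  have om0 i : 0 <= om i by rewrite leNgt; apply/negP => hi; apply: nneg; exists i.
  have omE i : om i = `|om i|%N%:Z by rewrite gez0_abs.
  have omK i : (`|om i| < K)%N.
    have := omE i0; have := omE i1; have := omE i2; have := omE i; have := om0 i.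
    have := om0 i0; have := om0 i1; have := om0 i2; rewrite sum3 in so.
    have : om i <= om i0 + (om i1 + om i2).
      by move: (om0 i0) (om0 i1) (om0 i2); move: i; elim/ord3P; lia.
    by lia.
  pose f : {ffun 'I_3 -> 'I_K} := [ffun i => Ordinal (omK i)].
  case/negP: wr; apply/mapP; exists f.
    rewrite mem_enum; apply/eqP; rewrite -so sumS; apply: eq_bigr => i _.
    by rewrite !ffunE /= -omE.
  have [c hc] := co; apply/mnmP => i; rewrite mnmE.
  have fE j : (f j : nat)%:Z = (w j)%:Z + c by rewrite ffunE /= -omE hc.
  have := fE i0; have := fE i1; have := fE i2; have := fE i; rewrite /mi.
  move: (nat_of_ord (f i)) (nat_of_ord (f i0)) (nat_of_ord (f i1)) (nat_of_ord (f i2)).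
  have wl0 : minn (w i0) (minn (w i1) (w i2)) = 0%N by move: l wl; elim/ord3P; lia.
  by lia.
- move=> w /= /mapP [f _ ->].
  exact: g0.
rewrite big_mkcond big_seq.
transitivity (\sum_(w <- r) mon w *+ nn w).
  rewrite [RHS]big_seq; apply: eq_bigr => w wr; rewrite ifT //; apply/mem_set.
  have /mapP [f _ ->] := wr.
  exact: g0.
rewrite big_map big_enum_cond /=; apply: eq_big => [f|f /andP [/eqP Sf _]].
  by rewrite andbT.
rewrite (@mon_shift (fun i => f i) (g f) (mi f) (gE f)).
congr (_ *+ _); apply: H1; last by rewrite -sumS.
by exists (mi f)%:Z => i; rewrite ffunE gE PoszD.
Qed.

Section CharacterSums.
Variables (k : closedFieldType) (L : 'I_3 -> {poly k}).
Hypothesis size_L : forall i, size (L i) = 2.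
Hypothesis sum_L : \sum_i L i = 0.
Hypothesis coprime_L : forall i j, i != j -> coprimep (L i) (L j).

Lemma bound_nat (f : 'I_3 -> nat) : bound [ffun i => (f i)%:Z] = (fun i => (f i).+1).
Proof. by apply: funext => i; rewrite /bound ffunE. Qed.

Lemma n0_unit N a i : a i = 0%N -> n0 L N a = 0%N.
Proof.
move=> ai; rewrite /n0; apply/eqP; rewrite subn_eq0 -{1}[N](subn0) -ai.
rewrite -(rank_powerspace size_L N a i); apply: mxrankS; move: i {ai}; elim/ord3P.
- exact: addsmxSl.
- exact: submx_trans (addsmxSl _ _) (addsmxSr _ _).
- exact: submx_trans (addsmxSr _ _) (addsmxSr _ _).
Qed.

Lemma n1_unit N a i : a i = 0%N -> n1 L N a = 0%N.
Proof.
move=> ai; have := n0_unit N ai; rewrite /n0 /n1.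
have : (rank_sum L N a <= N)%N by apply: rank_leq_row.
have := rank_syz_space size_L N a; rewrite sumn3 /koszul_dim.
by move: i ai; elim/ord3P => ->; lia.
Qed.

Lemma h1_sum (d : nat) (e : int) (K : nat) : 0 <= e -> d%:Z + (e - 1) < K%:Z ->
  h1 k d e = \sum_(f : {ffun 'I_3 -> 'I_K} | (\sum_i f i)%N%:Z == d%:Z + (e - 1))
    mon (fun i => f i) *+ n1 L d.+1 (fun i => (f i).+1).
Proof.
move=> e0 DK; have m_ge : -1 <= e - 1 by lia.
rewrite /h1 /character.
rewrite (character_sum (n := fun om => n1 L d.+1 (bound om)) (D := d%:Z + (e - 1)) (K := K)) //.
- by apply: eq_bigr => f _; rewrite bound_nat.
- by move=> w om; exact: quot_dim_h1.
- by move=> w; exact: quot_dim_h1_none.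
- by move=> om i omi; apply: (@n1_unit _ _ i); rewrite /bound; case: (om i) omi.
Qed.

(** Indexing by N = d + 1 includes d = -1, where the convention makes h^0 zero; this occurs in the
    third summand when d - tq = q - 1. *)
Lemma h0_sum (N : nat) (e : int) (K : nat) : 0 <= e -> N%:Z - 1 + (e - 1) < K%:Z ->
  h0 k (N%:Z - 1) e =
  \sum_(f : {ffun 'I_3 -> 'I_K} | (\sum_i f i)%N%:Z == N%:Z - 1 + (e - 1))
    mon (fun i => f i) *+ n0 L N (fun i => (f i).+1).
Proof.
move=> e0 DK; have m_ge : -1 <= e - 1 by lia.
case: N DK => [|d] DK.
  rewrite [RHS]big1 => [|f _]; last by rewrite /n0 sub0n mulr0n.
  rewrite /h0 /character fsbig1 // => w _.
  have s0 : subspace [set 0 : 'I_3 -> DR_cochain k]%classic.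
    by split=> // c u v /= -> ->; rewrite scaler0 addr0.
  have Z0 z : @cech_Z0 k (0%N%:Z - 1) (e - 1) z -> z = 0.
    move=> [Cz _]; apply: funext => i; apply: funext => a.
    by have [h _ _] := Cz i; apply: h.
  rewrite quot_dim0 ?mulr0n // => [|z [/Z0 -> _] //].
  split=> [|c u v [/Z0 -> hu] [/Z0 -> hv]].
    split=> [|t _ /=]; first by case: (Z0_subspace k (0%N%:Z - 1) (e - 1)).
    rewrite scaler0 subr0; apply: funext => i; apply: funext => a; apply: funext => x.
    exact: mulr0.
  rewrite scaler0 addr0; split=> //.
  by case: (Z0_subspace k (0%N%:Z - 1) (e - 1)).
have -> : d.+1%:Z - 1 = d%:Z by lia.
rewrite /h0 /character.
rewrite (character_sum (n := fun om => n0 L d.+1 (bound om)) (D := d%:Z + (e - 1)) (K := K)) //.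
- by apply: eq_bigr => f _; rewrite bound_nat.
- by move=> w om; exact: quot_dim_h0.
- by move=> w; exact: quot_dim_h0_none.
- by move=> om i omi; apply: (@n0_unit _ _ i); rewrite /bound; case: (om i) omi.
- by move: DK; rewrite -addn1 PoszD addrK.
Qed.

End CharacterSums.

(** * Sums over boxes of exponent vectors *)

Definition vec (x y z : nat) : 'I_3 -> nat := fun i =>
  if i == i0 then x else if i == i1 then y else z.

Lemma vecE (f : 'I_3 -> nat) : f = vec (f i0) (f i1) (f i2).
Proof. by apply: funext; elim/ord3P. Qed.

Section TripleSums.
Variable V : nmodType.
Implicit Types (F G : ('I_3 -> nat) -> V).

Definition sumv (K : nat) F : V :=
  \sum_(x < K) \sum_(y < K) \sum_(z < K) F (vec x y z).

Lemma sumv_ffun K F :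
  \sum_(f : {ffun 'I_3 -> 'I_K}) F (fun i => f i) = sumv K F.
Proof.
rewrite /sumv (eq_bigr (fun x : 'I_K => \sum_(yz : 'I_K * 'I_K) F (vec x yz.1 yz.2))); last first.
  by move=> x _; rewrite pair_big.
rewrite pair_big /=.
pose h (s : 'I_K * ('I_K * 'I_K)) : {ffun 'I_3 -> 'I_K} :=
  [ffun i => if i == i0 then s.1 else if i == i1 then s.2.1 else s.2.2].
pose h' (f : {ffun 'I_3 -> 'I_K}) := (f i0, (f i1, f i2)).
rewrite (reindex h) /=; last first.
  exists h' => [[x [y z]] _|f _]; first by rewrite /h' !ffunE.
  by apply/ffunP; elim/ord3P; rewrite ffunE.
apply: eq_bigr => [[x [y z]] _]; congr F; apply: funext.
by elim/ord3P; rewrite ffunE.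
Qed.

Lemma eq_sumv K F G : (forall f, (forall i, (f i < K)%N) -> F f = G f) ->
  sumv K F = sumv K G.
Proof.
move=> h; apply: eq_bigr => x _; apply: eq_bigr => y _; apply: eq_bigr => z _.
by apply: h; elim/ord3P; apply: ltn_ord.
Qed.

Lemma sumvD K F G : sumv K (fun f => F f + G f) = sumv K F + sumv K G.
Proof.
rewrite -big_split; apply: eq_bigr => x _; rewrite -big_split; apply: eq_bigr => y _.
by rewrite -big_split.
Qed.

Lemma sumv_exchange K K' (F : ('I_3 -> nat) -> ('I_3 -> nat) -> V) :
  sumv K (fun f => sumv K' (F f)) = sumv K' (fun g => sumv K (F^~ g)).
Proof.
rewrite -(sumv_ffun K) -[RHS]sumv_ffun.
under eq_bigr do rewrite -sumv_ffun.
by rewrite exchange_big /=; apply: eq_bigr => g _; rewrite -sumv_ffun.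
Qed.

Lemma sumr_shift (g : nat -> V) b K K' : (b + K <= K')%N ->
  \sum_(x < K) g x = \sum_(y < K') g (y - b)%N *+ (b <= y < b + K)%N.
Proof.
move=> /subnKC <-; rewrite !big_split_ord /=.
rewrite [X in X + _ + _]big1 ?add0r => [|y _]; last first.
  by rewrite leqNgt ltn_ord mulr0n.
rewrite [X in _ + X]big1 ?addr0 => [|y _]; last first.
  by rewrite [X in _ && X]ltnNge leq_addr andbF mulr0n.
by apply: eq_bigr => y _; rewrite addKn leq_addr ltn_add2l ltn_ord mulr1n.
Qed.

Definition in_shift K (b f : 'I_3 -> nat) : bool :=
  [&& b i0 <= f i0 < b i0 + K, b i1 <= f i1 < b i1 + K & b i2 <= f i2 < b i2 + K]%N.

Lemma sumv_shift (b : 'I_3 -> nat) K K' F : (forall i, b i + K <= K')%N ->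
  sumv K F = sumv K' (fun f => F (fun i => f i - b i)%N *+ in_shift K b f).
Proof.
move=> h; rewrite /sumv.
rewrite (sumr_shift (fun x => \sum_(y < K) \sum_(z < K) F (vec x y z)) (h i0)).
apply: eq_bigr => x _.
rewrite (sumr_shift (fun y => \sum_(z < K) F (vec _ y z)) (h i1)) -sumrMnl.
apply: eq_bigr => y _.
rewrite (sumr_shift (fun z => F (vec _ _ z)) (h i2)) -!sumrMnl.
apply: eq_bigr => z _; rewrite -!mulrnA; congr (_ *+ _).
  by congr F; rewrite [RHS]vecE.
by rewrite /in_shift /= !mulnb; do 3![case: (_ <= _ < _)%N => //].
Qed.

Lemma sumv_widen K K' F : (K <= K')%N ->
  (forall f, (exists i, K <= f i)%N -> F f = 0) -> sumv K' F = sumv K F.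
Proof.
move=> KK' h; rewrite (@sumv_shift (fun=> 0%N) K K') //; apply: eq_sumv => f _.
have -> : (fun i => f i - 0)%N = f by apply: funext => i; rewrite subn0.
have [_|nb] := boolP (in_shift K (fun=> 0%N) f); rewrite ?mulr1n // mulr0n; apply: h.
move: nb; rewrite /in_shift !add0n !leq0n /= !negb_and -!leqNgt.
by case/or3P => ?; [exists i0 | exists i1 | exists i2].
Qed.

Lemma sumr_divmod (g : nat -> V) K q :
  \sum_(x < K * q) g x = \sum_(u < K) \sum_(v < q) g (q * u + v)%N.
Proof.
elim: K => [|K IH]; first by rewrite mul0n !big_ord0.
rewrite mulSn addnC big_split_ord /= IH [RHS]big_ord_recr /=; congr (_ + _).
by apply: eq_bigr => v _; rewrite mulnC.
Qed.

Lemma sumv_divmod K q F :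
  sumv (K * q) F = sumv K (fun u => sumv q (fun v => F (fun i => q * u i + v i)%N)).
Proof.
rewrite /sumv (sumr_divmod (fun x => \sum_(y < K * q) \sum_(z < K * q) F (vec x y z))).
apply: eq_bigr => x _.
under eq_bigr => x' _ do rewrite (sumr_divmod (fun y => \sum_(z < K * q) F (vec _ y z))).
rewrite exchange_big /=; apply: eq_bigr => y _.
under eq_bigr => x' _.
  under eq_bigr => y' _ do rewrite (sumr_divmod (fun z => F (vec _ _ z))).
  rewrite exchange_big /=; over.
rewrite exchange_big /=; apply: eq_bigr => z _.
apply: eq_bigr => x' _; apply: eq_bigr => y' _; apply: eq_bigr => z' _.
by congr F; rewrite [RHS]vecE.
Qed.

Lemma sumv_rev K F : sumv K F = sumv K (fun f => F (fun i => K.-1 - f i)%N).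
Proof.
rewrite /sumv (reindex_inj rev_ord_inj) /=; apply: eq_bigr => x _.
rewrite (reindex_inj rev_ord_inj) /=; apply: eq_bigr => y _.
rewrite (reindex_inj rev_ord_inj) /=; apply: eq_bigr => z _.
by congr F; apply: funext; elim/ord3P; rewrite /vec /= -subn1 -subnDA add1n.
Qed.

End TripleSums.

Lemma sumv_eq0 (V : nmodType) K (F : ('I_3 -> nat) -> V) :
  (forall f, (forall i, (f i < K)%N) -> F f = 0) -> sumv K F = 0.
Proof.
by move=> h; rewrite (eq_sumv h) /sumv big1 // => x _; rewrite big1 // => y _; rewrite big1.
Qed.

Lemma sumv_distrr (R : pzSemiRingType) K (x : R) F :
  x * sumv K F = sumv K (fun f => x * F f).
Proof.
rewrite /sumv mulr_sumr; apply: eq_bigr => a _; rewrite mulr_sumr; apply: eq_bigr => b _.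
by rewrite mulr_sumr.
Qed.

Lemma sumv_mul (R : pzSemiRingType) K K' (F G : ('I_3 -> nat) -> R) :
  sumv K F * sumv K' G = sumv K (fun u => sumv K' (fun v => F u * G v)).
Proof.
rewrite /sumv mulr_suml; apply: eq_bigr => x _; rewrite mulr_suml; apply: eq_bigr => y _.
rewrite mulr_suml; apply: eq_bigr => z _; rewrite mulr_sumr; apply: eq_bigr => a _.
by rewrite mulr_sumr; apply: eq_bigr => b _; rewrite mulr_sumr.
Qed.

Lemma sumv_mulrn (V : nmodType) K (x : V) (c : ('I_3 -> nat) -> nat) :
  sumv K (fun f => x *+ c f) = x *+ sumv K c.
Proof.
rewrite /sumv -sumrMnr; apply: eq_bigr => a _; rewrite -sumrMnr; apply: eq_bigr => b _.
by rewrite -sumrMnr.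
Qed.

(** * Coefficients of truncated Schur functions *)

Section Counting.
Local Open Scope nat_scope.

Lemma sum_interval q l h : \sum_(x < q) (l <= x <= h) = minn q h.+1 - l.
Proof. by elim: q => [|q IH]; rewrite ?big_ord0 ?big_ord_recr /= ?IH; lia. Qed.

Lemma sum_eq_index q c (P : nat -> nat) : \sum_(y < q) (y == c :> nat) * P y = (c < q) * P c.
Proof.
have [cq|qc] := ltnP c q; last first.
  rewrite big1 // => y _; have := ltn_ord y; case: eqP => // ->.
  by rewrite ltnNge qc.
rewrite (bigD1 (Ordinal cq)) //= eqxx big1 ?addn0 // => y yc.
by rewrite (negbTE (yc : y != c :> nat)).
Qed.

Variables (q : nat) (om : 'I_3 -> nat).
Hypothesis om_lt : forall i, om i < q + q.

(** The ends of the interval of those b below q for which om_i - b also lies in [0, q), as shown by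
    [interval_shift]. *)
Definition lo i := om i - q.-1.
Definition hi i := minn (om i) q.-1.

Lemma lo_hi i : [/\ lo i + hi i = om i, hi i <= q.-1 & (lo i == 0) || (hi i == q.-1)].
Proof. by rewrite /lo /hi; split; lia. Qed.

Lemma interval_shift i b : b < q -> (b <= om i < b + q) = (lo i <= b <= hi i).
Proof. by rewrite /lo /hi => bq; apply/idP/idP; lia. Qed.

Definition count2 (m : int) : nat :=
  \sum_(x < q) \sum_(y < q) ((x + y)%:Z == m) * ((lo i0 <= x <= hi i0) * (lo i1 <= y <= hi i1)).

Lemma count2E n : count2 n%:Z =
  (lo i1 <= n) * ((minn (hi i0) (n - lo i1)).+1 - maxn (lo i0) (n - hi i1)).
Proof.
rewrite /count2.
rewrite (eq_bigr (fun x : 'I_q =>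
  (lo i1 <= n) * (maxn (lo i0) (n - hi i1) <= x <= minn (hi i0) (n - lo i1)) : nat)); last first.
  move=> x _.
  rewrite (eq_bigr (fun y : 'I_q => (y == n - x :> nat) *
      ((x <= n) * ((lo i0 <= x <= hi i0) * (lo i1 <= y <= hi i1))))); last first.
    move=> y _; rewrite !mulnA; congr (_ * _ * _).
    by have -> : ((x + y)%:Z == n%:Z) = (x + y == n :> nat) by []; lia.
  rewrite (sum_eq_index q (n - x)
    (fun y => (x <= n) * ((lo i0 <= x <= hi i0) * (lo i1 <= y <= hi i1)))).
  rewrite !mulnb; congr nat_of_bool.
  by have := ltn_ord x; rewrite /hi /lo; lia.
rewrite -big_distrr /= sum_interval; congr (_ * _).
by have := om_lt i0; rewrite /hi /lo; lia.
Qed.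

Lemma count2_neg m : (m < 0)%R -> count2 m = 0.
Proof. by move=> m0; rewrite /count2 big1 // => x _; rewrite big1 // => y _; lia. Qed.

(** The coefficient of x^om in the product of truncated functions of degrees A and [m], when om has
    sum A + m; see [h_trunc_mul]. *)
Definition box_count (m : int) : nat :=
  \sum_(x < q) \sum_(y < q) \sum_(z < q)
    ((\sum_i vec x y z i)%:Z == m) * in_shift q (vec x y z) om.

Lemma box_count_count2 m : box_count m = \sum_(z < q) (lo i2 <= z <= hi i2) * count2 (m - z%:Z)%R.
Proof.
rewrite /count2 /box_count.
under [RHS]eq_bigr do rewrite big_distrr /=.
rewrite [RHS]exchange_big /=; apply: eq_bigr => x _.
under [RHS]eq_bigr do rewrite big_distrr /=.
rewrite [RHS]exchange_big /=; apply: eq_bigr => y _; apply: eq_bigr => z _.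
rewrite sumn3 /in_shift /vec /= !interval_shift ?ltn_ord // !mulnb; congr nat_of_bool.
have -> : ((x + (y + z))%:Z == m) = ((x + y)%:Z == (m - z%:Z)%R) by lia.
by case: (_ == _); case: (_ <= _ <= _); case: (_ <= _ <= _); rewrite /= ?andbT ?andbF.
Qed.

Lemma sum_telescope (g : int -> nat) l h m : l <= h.+1 -> h < q ->
  \sum_(z < q) (l <= z <= h) * g (m - z%:Z)%R + g (m - 1 - h%:Z)%R =
  \sum_(z < q) (l <= z <= h) * g (m - 1 - z%:Z)%R + g (m - l%:Z)%R.
Proof.
move=> lh hq.
have e f : \sum_(z < q) (l <= z <= h) * f (z : nat) = \sum_(0 <= j < h.+1 - l) f (l + j).
  rewrite -(big_mkord xpredT (fun z => (l <= z <= h) * f z)).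
  have {1}-> : q = l + ((h.+1 - l) + (q - h.+1)) by lia.
  rewrite big_mkord !big_split_ord /= big1 ?add0n => [|z _]; last by have := ltn_ord z; lia.
  rewrite [X in _ + X]big1 ?addn0 => [|z _]; last by lia.
  by rewrite big_mkord; apply: eq_bigr => z _; have := ltn_ord z; case: andP; lia.
rewrite (e (fun z => g (m - z%:Z)%R)) (e (fun z => g (m - 1 - z%:Z)%R)).
have [n hn] : exists n, n = h.+1 - l by exists (h.+1 - l).
have -> : h%:Z = ((l + n)%:Z - 1)%R by lia.
rewrite -hn; elim: n {hn} => [|n IH].
  by rewrite !big_geq //; congr (_ + g _); lia.
rewrite !big_nat_recr //= addnAC addnAC.
have -> : (m - 1 - ((l + n.+1)%:Z - 1) = m - (l + n.+1)%:Z)%R by lia.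
have e1 : (m - 1 - ((l + n)%:Z - 1) = m - (l + n)%:Z)%R by lia.
have e2 : (m - 1 - (l + n)%:Z = m - (l + n.+1)%:Z)%R by lia.
by rewrite e1 in IH; rewrite e2; move: IH; lia.
Qed.

(** Passing from m - 1 to m slides the window of the third coordinate by one step, so only its two
    ends remain; a Schur coefficient is thus a difference of two planar counts. *)
Lemma box_count_step m : 0 < q ->
  box_count m + count2 (m - 1 - (hi i2)%:Z)%R = box_count (m - 1)%R + count2 (m - (lo i2)%:Z)%R.
Proof.
move=> q0; rewrite !box_count_count2 (sum_telescope count2) //.
  by have := om_lt i2; rewrite /lo /hi; lia.
by rewrite /hi; lia.
Qed.

(* The truncation bounds never meet in the range of the second summand of the
   recursion, so that the boxes are counted by a linear function. *)
Lemma box_count_linear (d e : nat) : d < q -> (\sum_i om i = d + e + q + q - 1) ->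
  box_count d%:Z = box_count (d%:Z - 1)%R + (d.+1 - \sum_i (om i - q.-1)).
Proof.
move=> dq som; have q0 : 0 < q by lia.
have := box_count_step d%:Z q0.
have [s0 h0 c0] := lo_hi i0; have [s1 h1 c1] := lo_hi i1; have [s2 h2 c2] := lo_hi i2.
rewrite sumn3 -s0 -s1 -s2 in som; rewrite sumn3 -/(lo i0) -/(lo i1) -/(lo i2).
have [f0 f1 f2] : [/\ d <= hi i0 + lo i1 + lo i2, d <= lo i0 + hi i1 + lo i2
    & d <= lo i0 + lo i1 + hi i2].
  by move: som h0 h1 h2 c0 c1 c2; move: (lo _) (lo _) (lo _) (hi _) (hi _) (hi _) => *;
    split; lia.
have -> : count2 (d%:Z - (lo i2)%:Z)%R = d.+1 - (lo i0 + (lo i1 + lo i2)).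
  have [le|lt] := leqP (lo i2) d; last by rewrite count2_neg; lia.
  rewrite subzn // count2E.
  have -> : minn (hi i0) (d - lo i2 - lo i1) = d - lo i2 - lo i1 by apply/minn_idPr; lia.
  have -> : maxn (lo i0) (d - lo i2 - hi i1) = lo i0 by apply/maxn_idPl; lia.
  by case: leqP; lia.
have -> : count2 (d%:Z - 1 - (hi i2)%:Z)%R = 0.
  have [le|lt] := leqP (hi i2).+1 d; last by rewrite count2_neg //; lia.
  have -> : (d%:Z - 1 - (hi i2)%:Z)%R = (d - (hi i2).+1)%:Z by lia.
  rewrite count2E; case: leqP => // h; rewrite mul1n.
  apply/eqP; rewrite subn_eq0 (leq_trans _ (leq_maxl _ _)) //.
  by rewrite (leq_ltn_trans (geq_minr _ _)) //; lia.
by rewrite addn0 => ->.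
Qed.

(** The coefficients without effective truncation, in a subtraction-free form in which the truncated
    differences are those of the Koszul dimensions in [h1_schur]. *)
Lemma box_count_full (d e : nat) : (forall i, om i < q) -> (\sum_i om i + 1 = d + e) ->
  e <= d ->
  box_count e%:Z + \sum_(i < 3) (om i - e) + e =
  box_count (e%:Z - 1)%R + \sum_(i < 3) (om i - d) + d.
Proof.
move=> omq som ed; have q0 : 0 < q by apply: leq_ltn_trans (omq i0).
have := box_count_step e%:Z q0.
have l0 := omq i0; have l1 := omq i1; have l2 := omq i2.
rewrite sumn3 in som; rewrite !sumn3.
have lE i : lo i = 0 by rewrite /lo; have := omq i; lia.
have hE i : hi i = om i by rewrite /hi; have := omq i; lia.
rewrite lE hE subr0 count2E !lE !hE.
have -> : count2 (e%:Z - 1 - (om i2)%:Z)%R =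
    if om i2 < e then (minn (om i0) (e - 1 - om i2)).+1 - (e - 1 - om i2 - om i1) else 0.
  case: ltnP => h; last by rewrite count2_neg //; lia.
  have -> : (e%:Z - 1 - (om i2)%:Z)%R = (e - 1 - om i2)%:Z by lia.
  by rewrite count2E !lE !hE; lia.
move: (om i0) (om i1) (om i2) som => x y z som; rewrite leq0n mul1n subn0 max0n.
by have [? | ?] := leqP x e; have [? | ?] := leqP y e; have [? | ?] := ltnP z e;
  try (have [? | ?] := leqP x (e - 1 - z)); lia.
Qed.

End Counting.

(** * Products, duals and Frobenius twists of truncated symmetric functions *)

Lemma sumv_nat K (c : ('I_3 -> nat) -> nat) :
  sumv K c = (\sum_(x < K) \sum_(y < K) \sum_(z < K) c (vec x y z))%N.
Proof. by []. Qed.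

Lemma h_truncE q m : h_trunc q m =
  sumv q (fun f => mon f *+ ((\sum_i f i)%N%:Z == m)).
Proof.
rewrite /h_trunc big_mkcond -sumv_ffun; apply: eq_bigr => f _.
by rewrite mulrb.
Qed.

Lemma h_trunc_mul q A B : h_trunc q A * h_trunc q B =
  sumv (q + q) (fun om => mon om *+ (((\sum_i om i)%N%:Z == A + B) * box_count q om B)).
Proof.
rewrite !h_truncE sumv_mul sumv_exchange.
rewrite (@eq_sumv _ q _ (fun b => sumv (q + q) (fun om =>
  mon om *+ ((((\sum_i om i)%N%:Z == A + B)%R *
    (((\sum_i b i)%N%:Z == B) * in_shift q b om))%N)))); last first.
  move=> b bq; rewrite (@sumv_shift _ b q (q + q)) => [|i]; last by rewrite leq_add2r ltnW.
  apply: eq_sumv => om _; rewrite !mulrnAr !mulrnAl -!mulrnA.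
  have [/and3P [/andP [h0 _] /andP [h1 _] /andP [h2 _]]|_] := boolP (in_shift q b om); last first.
    by rewrite ?muln0 ?mulr0n.
  rewrite monD.
  have bom i : (b i <= om i)%N by move: i; elim/ord3P.
  have -> : (fun i => om i - b i + b i)%N = om by apply: funext => i; rewrite subnK.
  congr (_ *+ _); rewrite !mulnb andbT; congr nat_of_bool.
  move: (bom i0) (bom i1) (bom i2); rewrite !sumn3.
  by case: eqP => [hB|]; rewrite ?andbT ?andbF //; lia.
rewrite sumv_exchange; apply: eq_sumv => om _.
rewrite sumv_mulrn; congr (_ *+ _); rewrite sumv_nat /box_count big_distrr; apply: eq_bigr => ? _.
by rewrite big_distrr; apply: eq_bigr => ? _; rewrite big_distrr.
Qed.

Lemma s_truncE q A B (si : ('I_3 -> nat) -> nat) :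
  (forall om, (forall i, (om i < q + q)%N) -> (\sum_i om i)%N%:Z = A + B ->
     box_count q om B = (box_count q om (B - 1) + si om)%N) ->
  s_trunc q A B =
  sumv (q + q) (fun om => mon om *+ (((\sum_i om i)%N%:Z == A + B) * si om)).
Proof.
move=> h; rewrite /s_trunc !h_trunc_mul; apply/eqP; rewrite subr_eq -sumvD; apply/eqP.
apply: eq_sumv => om omq; rewrite -mulrnDr; congr (_ *+ _).
have -> : A + 1 + (B - 1) = A + B by ring.
case: eqP => [e|_]; rewrite ?mul0n // !mul1n.
by rewrite h // addnC.
Qed.

Lemma sumv_morph (f : {rmorphism chA -> chA}) K F :
  f (sumv K F) = sumv K (fun u => f (F u)).
Proof.
rewrite /sumv rmorph_sum; apply: eq_bigr => x _; rewrite rmorph_sum; apply: eq_bigr => y _.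
by rewrite rmorph_sum.
Qed.

Lemma Frob_mon q f : Frob q (mon f) = mon (fun i => q * f i)%N.
Proof.
rewrite /mon rmorph_prod; apply: eq_bigr => i _.
by rewrite rmorphXn /= Frob_x exprM.
Qed.

Lemma dual_mon c f : (forall i, (f i <= c)%N) -> dual (mon f) = mon (fun i => c - f i)%N.
Proof.
move=> fc; have e : dual (mon f) * mon f = 1.
  rewrite /mon rmorph_prod -big_split big1 // => i _ /=.
  by rewrite rmorphXn /= -exprMn dual_x expr1n.
rewrite -[RHS]mul1r -e -mulrA monD.
have -> : (fun i => f i + (c - f i))%N = fun=> c by apply: funext => i; rewrite subnKC.
by rewrite mon_const mulr1.
Qed.

Definition below t (u : 'I_3 -> nat) := [&& u i0 <= t, u i1 <= t & u i2 <= t]%N.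

(** Duality sends x^f with f of sum t to x^(t - f), and u = t - f has sum 3t - t = 2t and entries at
    most t. *)
Lemma Frob_dual_h_sym q t K : (t < K)%N -> Frob q (dual (h_sym t%:Z)) =
  sumv K (fun u => mon (fun i => q * u i)%N *+ ((\sum_i u i == 2 * t)%N && below t u)).
Proof.
move=> tK; rewrite /h_sym h_truncE !sumv_morph sumv_rev.
rewrite (sumv_widen tK) => [|f [i fi]]; last first.
  have -> : below t f = false by move: i fi; elim/ord3P; rewrite /below; lia.
  by rewrite andbF mulr0n.
apply: eq_sumv => f ft; rewrite !rmorphMn /= (@dual_mon t) => [|i]; last by rewrite leq_subr.
rewrite Frob_mon; have ft' i : (f i <= t)%N by rewrite -ltnS.
congr (mon _ *+ _); first by apply: funext => i; rewrite subKn.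
congr nat_of_bool; have := ft' i0; have := ft' i1; have := ft' i2.
by rewrite /below !sumn3; lia.
Qed.

(** * Assembling the three summands *)

Section Assembly.
Variables (k : closedFieldType) (L : 'I_3 -> {poly k}).
Hypothesis size_L : forall i, size (L i) = 2.
Hypothesis sum_L : \sum_i L i = 0.
Hypothesis coprime_L : forall i j, i != j -> coprimep (L i) (L j).

Lemma h1_sumv (d e K : nat) : (d + e <= K)%N -> h1 k d%:Z e%:Z =
  sumv K (fun f => mon f *+
    (((\sum_i f i).+1 == d + e)%N * n1 L d.+1 (fun i => (f i).+1))).
Proof.
move=> dK; rewrite (h1_sum size_L sum_L coprime_L (K := K)) //; last by lia.
rewrite big_mkcond -sumv_ffun; apply: eq_bigr => f _.
have -> : ((\sum_i f i)%N%:Z == d%:Z + (e%:Z - 1)) = ((\sum_i f i).+1 == d + e)%N by lia.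
by case: ifP => _; rewrite ?mul1n ?mul0n.
Qed.

Lemma h0_sumv (N e K : nat) : (N + e <= K)%N -> h0 k (N%:Z - 1) e%:Z =
  sumv K (fun f => mon f *+
    (((\sum_i f i).+2 == N + e)%N * n0 L N (fun i => (f i).+1))).
Proof.
move=> dK; rewrite (h0_sum size_L sum_L coprime_L (K := K)) //; last by lia.
rewrite big_mkcond -sumv_ffun; apply: eq_bigr => f _.
have -> : ((\sum_i f i)%N%:Z == N%:Z - 1 + (e%:Z - 1)) = ((\sum_i f i).+2 == N + e)%N by lia.
by case: ifP => _; rewrite ?mul1n ?mul0n.
Qed.

Lemma h_symE (m : int) (K : nat) : m < K%:Z -> h_sym m = h_trunc K m.
Proof.
move=> mK; rewrite /h_sym !h_truncE; have [m0|m0] := ltP m 0.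
  have e f : ((\sum_(i < 3) f i)%N%:Z == m) = false by lia.
  by rewrite !sumv_eq0 // => f _; rewrite e mulr0n.
rewrite (sumv_widen (K := `|m|.+1)) //; first by lia.
move=> f [i fi]; have : (f i <= \sum_i f i)%N by rewrite (bigD1 i) //= leq_addr.
by case: eqP => //; lia.
Qed.

Variables (p r : nat).
Hypothesis pchar_k : p \in [pchar k].
Local Notation q := (p ^ r)%N.

(** The sizes d + 1 and e + 1 lie on the two sides of Q = t q, so [n1_vanish] kills every weight. *)
Lemma h1_eq0 (t d e : nat) : (t <= p)%N -> (d < t * q)%N -> (t * q <= e.+1)%N ->
  h1 k d%:Z e%:Z = 0.
Proof.
move=> tp dt te; rewrite (h1_sumv (leqnn _)).
apply: sumv_eq0 => f _.
case: eqP => [s|_]; last by rewrite mul0n.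
rewrite (n1_vanish size_L coprime_L pchar_k (Q := (t * q)%N) (m := t) (r := r) (M := e.+1)) //.
  by rewrite dt te.
by move: s; rewrite !sumn3; lia.
Qed.

(** Now e + 1 <= t q <= d + 1, so it is the dual multiplicity, in size e + 1, that vanishes. The
    syzygies of that size are Koszul, [rank_syz_dual] gives the rank in size d + 1, and
    [box_count_full] recognises the Schur coefficient. Truncation at d + e + 1 changes nothing in
    these degrees. *)
Lemma h1_schur (t d e : nat) : (t <= p)%N -> (0 < d)%N -> (t * q <= d)%N -> (e < t * q)%N ->
  h1 k d%:Z e%:Z = s_sym (d%:Z - 1) e%:Z.
Proof.
move=> tp d0 td et.
have -> : s_sym (d%:Z - 1) e%:Z = s_trunc (d + e).+1 (d%:Z - 1) e%:Z.
  by rewrite /s_sym /s_trunc !(@h_symE _ (d + e).+1) //; lia.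
rewrite (@s_truncE _ _ _ (fun om => n1 L d.+1 (fun i => (om i).+1))) => [|om omK som].
  rewrite (h1_sumv (K := (d + e).+1 + (d + e).+1)); last by lia.
  apply: eq_sumv => f _; congr (_ *+ (nat_of_bool _ * _)%N).
  by lia.
have som' : (\sum_i om i + 1 = d + e)%N by lia.
have oms i : (om i < (d + e).+1)%N.
  have : (om i <= \sum_i om i)%N by rewrite (bigD1 i) //= leq_addr.
  by lia.
have := box_count_full omK oms som'.
pose a (i : 'I_3) := (om i).+1; rewrite -/a.
have NM : (d.+1 + e.+1 = \sum_i a i)%N by move: som'; rewrite !sumn3 /a; lia.
have MN : (e.+1 + d.+1 = \sum_i a i)%N by rewrite addnC.
have e1 := rank_syz_dual size_L coprime_L NM.
have e2 := n1E size_L coprime_L NM; have e3 := n1E size_L coprime_L MN.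
have e0 : n1 L e.+1 a = 0%N.
  apply: (n1_vanish size_L coprime_L pchar_k (Q := (t * q)%N) (r := r) _ tp _ MN) => //.
  by rewrite et ltnW.
rewrite e0 add0n in e3.
move=> /(_ (ltnW (leq_trans et td))).
by rewrite -e2 -e3 in e1; move: e1; rewrite !sumn3 /a !subSS; lia.
Qed.

End Assembly.

(** * The three summands as sums over pairs (u, v) *)

Section Products.
Variables (k : closedFieldType) (L : 'I_3 -> {poly k}).
Hypothesis size_L : forall i, size (L i) = 2.
Hypothesis sum_L : \sum_i L i = 0.
Hypothesis coprime_L : forall i j, i != j -> coprimep (L i) (L j).
Variables (q t d e : nat).
Hypothesis dq : (d < q)%N.
Hypothesis eq : (e.+1 < q)%N.

Definition has_weight (u v : 'I_3 -> nat) : bool :=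
  (q * (\sum_i u i) + \sum_i v i + 1 == q * t + d + (q * t + e))%N.

Lemma has_weight_lead (b : nat) u v : (\sum_i u i + 2 = 2 * t + b)%N ->
  has_weight u v = (q * b + \sum_i v i + 1 == 2 * q + d + e)%N.
Proof.
move=> su; have : (q * (\sum_i u i) + 2 * q = q * (2 * t) + q * b)%N by rewrite -mulnDr -su; lia.
by rewrite /has_weight; move: (\sum_i u i)%N (q * b)%N; lia.
Qed.

Lemma first_product K : (t < K)%N ->
  Frob q (dual (h_sym t%:Z)) * h1 k d%:Z e%:Z =
  sumv K (fun u => sumv q (fun v =>
    mon (fun i => q * u i + v i)%N *+ (has_weight u v * first_term L t d u v))).
Proof.
move=> tK; rewrite (Frob_dual_h_sym q tK).
rewrite (h1_sumv size_L sum_L coprime_L (K := q + q)); last by lia.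
(* Weights with an entry at least q > d have multiplicity zero, so v ranges over remainders modulo
   q. *)
rewrite (sumv_widen (K := q) (K' := q + q) (leq_addr q q)) => [|f [i fi]]; last first.
  case: eqP => [s|_]; last by rewrite mul0n.
  rewrite (n1_big size_L coprime_L (M := e.+1) (i := i)); first by rewrite muln0.
    by move: s; rewrite !sumn3; lia.
  by lia.
rewrite sumv_mul; apply: eq_sumv => u _; apply: eq_sumv => v _.
rewrite mulrnAl mulrnAr -mulrnA monD /first_term -/(below t u); congr (_ *+ _).
case: ifP => [/andP [/eqP su _]|_]; last by rewrite !muln0.
by rewrite (@has_weight_lead 2) ?su // muln1; congr (nat_of_bool _ * _)%N; lia.
Qed.

(** An exponent of the truncated Schur function is q b + v with b in {0, 1}^3; absorbing b into the
    Frobenius factor shifts its exponent to u, and the sum over b yields the eight terms of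
    [second_sum]. *)
Lemma second_product K : (0 < t)%N -> (t < K)%N ->
  Frob q (dual (h_sym (t%:Z - 1))) * s_trunc q (e%:Z - 1 + 2 * q%:Z) d%:Z =
  sumv K.+1 (fun u => sumv q (fun v =>
    mon (fun i => q * u i + v i)%N *+ (has_weight u v * second_sum t d u v))).
Proof.
move=> t0 tK; have -> : t%:Z - 1 = t.-1%:Z by lia.
rewrite (Frob_dual_h_sym q (K := K)); last by lia.
rewrite (@s_truncE _ _ _ (fun om => d.+1 - \sum_i (om i - q.-1))%N) => [|om omq som]; last first.
  by apply: (@box_count_linear _ _ omq _ e) => //; lia.
have -> : (q + q = 2 * q)%N by lia.
rewrite sumv_divmod sumv_mul sumv_exchange.
pose c u v (b : 'I_3 -> nat) := (has_weight u v * second_term t d u v (b i0) (b i1) (b i2))%N.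
transitivity (sumv 2 (fun b => sumv K.+1 (fun u => sumv q (fun v =>
    mon (fun i => q * u i + v i)%N *+ c u v b)))).
  apply: eq_sumv => b b2; rewrite (@sumv_shift _ b K K.+1) => [|i]; last by have := b2 i; lia.
  have bE i : b i = (b i == 1)%N by have := b2 i; lia.
  apply: eq_sumv => u uK; have [/and3P [bu0 bu1 bu2]|nb] := boolP (in_shift K b u); last first.
    rewrite mulr0n sumv_eq0 // => v _; rewrite /c /second_term.
    by case: ifP => [/and4P [_ h0 h1 h2]|_]; [move: nb; rewrite /in_shift; lia | rewrite muln0].
  have bu i : (b i <= u i)%N by move: i bu0 bu1 bu2; elim/ord3P; lia.
  rewrite mulr1n sumv_distrr; apply: eq_sumv => v vq.
  rewrite mulrnAr (mulrnAl (mon _)) -mulrnA monD.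
  have -> : (fun i => q * (u i - b i) + (q * b i + v i))%N = (fun i => q * u i + v i)%N.
    by apply: funext => i; rewrite addnA -mulnDr subnK.
  congr (_ *+ _); rewrite /c /second_term.
  have -> : ((\sum_i (u i - b i) == 2 * t.-1)%N && below t.-1 (fun i => u i - b i)%N) =
    [&& (\sum_i u i + 2 == 2 * t + (b i0 + b i1 + b i2))%N, (b i0 <= u i0 < t + b i0)%N,
         (b i1 <= u i1 < t + b i1)%N & (b i2 <= u i2 < t + b i2)%N].
    by rewrite /below !sumn3; move: (bu i0) (bu i1) (bu i2); lia.
  case: ifP => [/and4P [/eqP su _ _ _]|_]; last by rewrite !(mul0n, muln0).
  rewrite mul1n (has_weight_lead v su); congr (nat_of_bool _ * (_ - _))%N.
    by rewrite !sumn3; lia.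
  have e1 i : (q * b i + v i - q.-1 = b i * (v i).+1)%N.
    by rewrite (bE i); have := vq i; case: eqP => _ /=; lia.
  by rewrite sumn3 !e1 addnA.
rewrite sumv_exchange; apply: eq_sumv => u _.
rewrite sumv_exchange; apply: eq_sumv => v _.
rewrite sumv_mulrn; congr (_ *+ _).
rewrite /sumv !big_ord_recl !big_ord0 /c /second_sum /= !addr0.
by rewrite !mulnDr !addrA.
Qed.

Lemma third_product K : (0 < t)%N -> (t < K)%N ->
  Frob q (dual (h_sym (t%:Z - 2))) * dual (h0 k (q%:Z - d%:Z - 2) (q%:Z - e%:Z - 2)) =
  sumv K (fun u => sumv q (fun v =>
    mon (fun i => q * u i + v i)%N *+ (has_weight u v *
      (if ((\sum_i u i).+1 == 2 * t)%N && [&& u i0 < t, u i1 < t & u i2 < t]%N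
  then n0 L (q - 1 - d) (fun i : 'I_3 => q - 1 - v i)%N else 0)))).
Proof.
(* For t = 1 the left side contains h_(-1) = 0, and on the right u would be zero, contradicting its
   sum 2t - 1 = 1. *)
move=> t0 tK; have [t1|t1] := eqVneq t 1%N.
  have -> : h_sym (t%:Z - 2) = 0.
    by rewrite t1 /h_sym h_truncE sumv_eq0.
  rewrite !rmorph0 mul0r sumv_eq0 // => u _; rewrite sumv_eq0 // => v _.
  rewrite t1 (_ : (_ && _) = false) ?muln0 //.
  by rewrite sumn3; lia.
have -> : t%:Z - 2 = t.-2%:Z by lia.
rewrite (Frob_dual_h_sym q (K := K.-1)); last by lia.
have -> : q%:Z - d%:Z - 2 = (q - 1 - d)%N%:Z - 1 by lia.
have -> : q%:Z - e%:Z - 2 = (q - 2 - e)%N%:Z by lia.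
rewrite (h0_sumv size_L sum_L coprime_L (K := q + q)); last by lia.
have q1q : (q.-1 <= q)%N by lia.
(* By the duality [n0_n1], weights with an entry at least q - 1 do not occur, so the dual can be
   written with the exponents q - 2 - v_i. *)
rewrite (sumv_widen (K := q.-1) (K' := q + q)) => [||f [i fi]]; first last.
- case: eqP => [s|_]; last by rewrite mul0n.
  have NM : (q - 1 - d + (q - 1 - e) = \sum_i (f i).+1)%N by move: s; rewrite !sumn3; lia.
  rewrite (n0_n1 size_L coprime_L NM) (n1_big size_L coprime_L (M := q - 1 - d) (i := i)).
  + by rewrite muln0.
  + by rewrite addnC.
  + by lia.
- by lia.
have -> : dual (sumv q.-1 (fun f => mon f *+ (((\sum_i f i).+2 == q - 1 - d + (q - 2 - e))%N *
      n0 L (q - 1 - d) (fun i => (f i).+1)))) =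
    sumv q (fun v => mon v *+ ((\sum_i v i + 1 == q + d + e)%N *
      n0 L (q - 1 - d) (fun i => q - 1 - v i)%N)).
  rewrite sumv_morph sumv_rev (sumv_widen q1q) => [|v [i vi]]; last first.
    by rewrite (@n0_unit _ _ size_L _ _ i) ?muln0 //; lia.
  apply: eq_sumv => v vq; rewrite rmorphMn /= (@dual_mon q.-2) => [|i]; last by lia.
  have -> : (fun i => q.-1.-1 - (q.-1.-1 - v i))%N = v by apply: funext => i; have := vq i; lia.
  have -> : (fun i : 'I_3 => (q.-1.-1 - v i).+1) = (fun i => q - 1 - v i)%N.
    by apply: funext => i; have := vq i; lia.
  congr (_ *+ (nat_of_bool _ * _)).
  by have := vq i0; have := vq i1; have := vq i2; rewrite !sumn3; lia.
rewrite sumv_mul (@sumv_shift _ (fun=> 1%N) K.-1 K) => [|i]; last by lia.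
apply: eq_sumv => u uK; have [us|nus] := boolP (in_shift K.-1 (fun=> 1%N) u); last first.
  rewrite mulr0n sumv_eq0 // => v _; case: ifP => [/andP [/eqP su h]|_]; last by rewrite muln0.
  by move: su nus; rewrite /in_shift sumn3; lia.
have u0 i : (0 < u i)%N by move: us; rewrite /in_shift; move: i; elim/ord3P; lia.
rewrite mulr1n; apply: eq_sumv => v vq.
rewrite mulrnAr (mulrnAl (mon _)) -mulrnA monD; congr (_ *+ _).
  (* The exponents q (u_i - 1) + v_i and q u_i + v_i differ by the constant q, which is invisible in
     [chA]. *)
  by symmetry; apply: (@mon_shift _ _ q) => i; rewrite addnAC -mulnSr subn1 prednK.
have -> : ((\sum_i (u i - 1) == 2 * t.-2)%N && below t.-2 (fun i => u i - 1)%N) =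
   (((\sum_i u i).+1 == 2 * t)%N && [&& u i0 < t, u i1 < t & u i2 < t]%N).
  by rewrite /below !sumn3; move: (u0 i0) (u0 i1) (u0 i2); lia.
case: ifP => [/andP [/eqP su _]|_]; last by rewrite (mul0n, muln0) ?muln0.
rewrite (@has_weight_lead 1) ?(mul1n, muln1); last by lia.
by congr (nat_of_bool _ * _)%N; lia.
Qed.

End Products.

Lemma h1_recursion (k : closedFieldType) (L : 'I_3 -> {poly k}) (p r t d e : nat) :
  (forall i, size (L i) = 2) -> \sum_i L i = 0 ->
  (forall i j, i != j -> coprimep (L i) (L j)) -> p \in [pchar k] ->
  (0 < t < p)%N -> (d < p ^ r)%N -> (e.+1 < p ^ r)%N ->
  h1 k (t * p ^ r + d)%N%:Z (t * p ^ r + e)%N%:Z =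
    Frob (p ^ r) (dual (h_sym t%:Z)) * h1 k d%:Z e%:Z
  + Frob (p ^ r) (dual (h_sym (t%:Z - 1))) *
      s_trunc (p ^ r) (e%:Z - 1 + 2 * (p ^ r)%N%:Z) d%:Z
  + Frob (p ^ r) (dual (h_sym (t%:Z - 2))) *
      dual (h0 k ((p ^ r)%N%:Z - d%:Z - 2) ((p ^ r)%N%:Z - e%:Z - 2)).
Proof.
move=> size_L sum_L coprime_L pchar_k tp dq eq; have [t0 _] := andP tp.
rewrite (first_product size_L sum_L coprime_L dq eq (K := (2 * t).+3)); last by lia.
rewrite (second_product dq eq (K := (2 * t).+2)) //; last by lia.
rewrite (third_product size_L sum_L coprime_L dq eq (K := (2 * t).+3)) //; last by lia.
(* The box of side (2t + 3) q holds all exponents, whose sum is below (2t + 2) q, and it matches the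
   range of u in the three products; the identity is then checked for each pair (u, v). *)
rewrite (h1_sumv size_L sum_L coprime_L (K := (2 * t).+3 * p ^ r)); last first.
  by rewrite !mulSn; lia.
rewrite sumv_divmod -!sumvD; apply: eq_sumv => u _; rewrite -!sumvD; apply: eq_sumv => v vq.
rewrite -!mulrnDr -!mulnDr; congr (_ *+ _).
have sE : (\sum_i (p ^ r * u i + v i) = p ^ r * (\sum_i u i) + \sum_i v i)%N.
  by rewrite big_split -big_distrr.
rewrite sE -addn1 mulnC [(t * _)%N]mulnC /has_weight.
case: eqP => [w|_]; last by rewrite muln0 mul0n.
rewrite muln1 mul1n -[RHS](n1_recursion size_L coprime_L pchar_k tp dq eq vq w).
by congr n1; apply: funext => i; rewrite addnS.
Qed.

Theorem theorem1p7 (k : closedFieldType) (p : nat) (hp : prime p)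
    (hk : p \in [pchar k]) (d e : int) (hd : 1 <= d) (he : 0 <= e)
    (t r q : nat) (ht : (1 <= t < p)%N) (hq : q = (p ^ r)%N)
    (hdq : (t * q)%N%:Z <= d < (t.+1 * q)%N%:Z) :
  [/\ (t.+1 * q)%N%:Z - 2 < e -> h1 k d e = 0,
      e < (t * q)%N%:Z -> h1 k d e = s_sym (d - 1) e &
      (t * q)%N%:Z <= e <= (t.+1 * q)%N%:Z - 2 ->
      h1 k d e =
          Frob q (dual (h_sym t%:Z)) * h1 k (d - (t * q)%N%:Z) (e - (t * q)%N%:Z)
        + Frob q (dual (h_sym (t%:Z - 1)))
            * s_trunc q (e - 1 + (2 - t%:Z) * q%:Z) (d - (t * q)%N%:Z)
        + Frob q (dual (h_sym (t%:Z - 2)))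
            * dual (h0 k ((t.+1 * q)%N%:Z - d - 2) ((t.+1 * q)%N%:Z - e - 2))].
Proof.
have [L [size_L sum_L coprime_L]] := linear_forms_exist k.
case: d e hd he hdq => [d|//] [e|//] d0 _ /andP [td dt]; have [t0 tp] := andP ht.
split=> [h|h|/andP [te et]].
(* The threshold is (t + 1) q, and t < p is precisely the bound t + 1 <= p needed there. *)
- by apply: (h1_eq0 size_L sum_L coprime_L hk (t := t.+1) (r := r)) => //; rewrite -hq; lia.
- by apply: (h1_schur size_L sum_L coprime_L hk (t := t) (r := r)); rewrite -?hq //; lia.
have [d' dE] : exists d', d = (t * q + d')%N by exists (d - t * q)%N; lia.
have [e' eE] : exists e', e = (t * q + e')%N by exists (e - t * q)%N; lia.
have dq : (d' < p ^ r)%N by rewrite -hq; move: dt; rewrite mulSn; lia.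
(* The upper bound on e becomes e' <= q - 2, which keeps q - e' - 2 nonnegative in the third
   summand. *)
have eq : (e'.+1 < p ^ r)%N by rewrite -hq; move: et; rewrite mulSn; lia.
have -> : d%:Z - (t * q)%N%:Z = d'%:Z by rewrite dE PoszD addrC addKr.
have -> : e%:Z - (t * q)%N%:Z = e'%:Z by rewrite eE PoszD addrC addKr.
have -> : (t.+1 * q)%N%:Z - d%:Z - 2 = q%:Z - d'%:Z - 2.
  by rewrite dE mulSn !PoszD; ring.
have -> : (t.+1 * q)%N%:Z - e%:Z - 2 = q%:Z - e'%:Z - 2.
  by rewrite eE mulSn !PoszD; ring.
have -> : e%:Z - 1 + (2 - t%:Z) * q%:Z = e'%:Z - 1 + 2 * q%:Z.
  by rewrite eE PoszD PoszM; ring.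
by have := h1_recursion size_L sum_L coprime_L hk ht dq eq; rewrite -hq -dE -eE.
Qed.
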